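(* Consider the estimators computed in the Hermite basis on $I=\mathbb R$. Assume that $f$ is bounded on $\mathbb R$, that $b'$ is square integrable, $\mathbb E[b'(X_1)^4]<\infty$, $\mathbb E(Y_1^4)<\infty$, and that $b\in W_H^s(D)$ with $D>0$. Assume $\|\Psi_m^{-1}\|_{\rm op}\lesssim m^\gamma$ for all $m$ and $s>1+\gamma$. Let $m_{\rm opt}=n^{1/(s+1/2)}$ (understood as an integer of this order), and assume the stability condition $$\mathfrak L(m+1)(\|\Psi_{m+1}^{-1}\|_{\rm op}\vee1)\leqslant\frac{\mathfrak c}{2}\cdot\frac{n}{\log(n)},\qquad \mathfrak c=\frac{3\log(3/2)-1}{9},$$ for $m=m_{\rm opt}$. Then, for $i=1,2$, $$\mathbb E\left[\|\widetilde b_{m_{\rm opt}}^{\prime,i}-b'\|_n^2\right]\leqslant\mathfrak c(D,s,\|f\|_\infty,\sigma^2)\,n^{-2(s-1-\gamma)/(2s+1)},$$ where $\mathfrak c(D,s,\|f\|_\infty,\sigma^2)>0$ is a constant not depending on $n$.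
   Context: Model: $Y_i=b(X_i)+\varepsilon_i$, $i=1,\dots,n$ ($n\geqslant2$), where $b$ is an unknown continuously differentiable function, $X_1,\dots,X_n$ are i.i.d. real random variables with density $f$ with respect to Lebesgue measure, and $\varepsilon_1,\dots,\varepsilon_n$ are i.i.d., centered, with variance $\sigma^2$, and independent of $X_1,\dots,X_n$. $\|\psi\|_n^2=\frac1n\sum_{i=1}^n\psi(X_i)^2$; $\|f\|_\infty=\sup f$; $\lesssim$ means inequality up to a multiplicative constant not depending on $m$ and $n$. Hermite basis: $\varphi_j=h_{j-1}$, $j\geqslant1$, with $h_j(x)=(2^jj!\sqrt\pi)^{-1/2}H_j(x)e^{-x^2/2}$ and $H_j(x)=(-1)^je^{x^2}\frac{d^j}{dx^j}(e^{-x^2})$, $j\geqslant0$. One has $h_0'=-\frac1{\sqrt2}h_1$, $h_j'=\frac1{\sqrt2}(\sqrt j\,h_{j-1}-\sqrt{j+1}\,h_{j+1})$ for $j\geqslant1$; $\Delta_{m,m+1}$ is the $m\times(m+1)$ matrix with $\varphi_j'=\sum_{k=1}^{m+1}[\Delta_{m,m+1}]_{j,k}\varphi_k$, $j=1,\dots,m$. $\mathfrak L(m)=K\sqrt m$, where $K>0$ is a constant such that $\sup_{x\in\mathbb R}\sum_{j=0}^{m-1}h_j(x)^2\leqslant K\sqrt m$ for all $m$. Sobolev–Hermite ball: $W_H^s(D)=\{\theta\in\mathbb L^2(\mathbb R):\sum_{k\geqslant0}k^sa_k^2(\theta)\leqslant D\}$ with $a_k(\theta)=\langle\theta,h_k\rangle$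 (scalar product of $\mathbb L^2(\mathbb R,dx)$). Let $\widehat\Phi_m=(\varphi_j(X_i))_{1\leqslant i\leqslant n,1\leqslant j\leqslant m}$, $\widehat\Psi_m=\frac1n\widehat\Phi_m^*\widehat\Phi_m$ ($M^*$ is the transpose of $M$), $\Psi_m=\mathbb E(\widehat\Psi_m)=(\int\varphi_j\varphi_kf)_{1\leqslant j,k\leqslant m}$, $\mathbf Y=(Y_1,\dots,Y_n)^*$, $\widehat b_m^{\prime,1}=\sum_{j=1}^m[\widehat\theta_m^1]_j\varphi_j'$ with $\widehat\theta_m^1=\frac1n\widehat\Psi_m^{-1}\widehat\Phi_m^*\mathbf Y$, and $\widehat b_m^{\prime,2}=\sum_{j=1}^m[\widehat\theta_m^2]_j\varphi_j$ with $\widehat\theta_m^2=-\frac1n\Delta_{m,m+1}\widehat\Psi_{m+1}^{-1}\widehat\Phi_{m+1}^*\mathbf Y$. Truncated estimators: $\widetilde b_m^{\prime,i}=\widehat b_m^{\prime,i}\mathbf 1_{\Lambda_{m+1}}$ with $\Lambda_m=\{\mathfrak L(m)(\|\widehat\Psi_m^{-1}\|_{\rm op}\vee1)\leqslant\mathfrak c\,n/\log(n)\}$, where the operator norm of the inverse of a singular matrix is $+\infty$.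
   Formalization: The constant, still independent of n, may depend besides D, s, ‖f‖∞, σ² on K, γ, the constant in ‖Ψ_m^{-1}‖ ≲ m^γ, the constants in the order of m_opt, and a bound on E[b'(X_1)^4]; D does not control the coefficient of h_0. *)

(* Defs.v *)
(* MathComp-Analysis, over an abstract [R : realType]. *)
From HB Require Import structures.
From mathcomp Require Export all_boot all_order all_algebra.
From mathcomp Require Export all_classical all_reals all_analysis.

Set Implicit Arguments.
Unset Strict Implicit.
Unset Printing Implicit Defensive.

Export Order.TTheory GRing.Theory Num.Theory.
Export numFieldNormedType.Exports.

Local Open Scope classical_set_scope.
Local Open Scope ring_scope.

Section Hermite.
Context {R : realType}.

Definition hermite_poly (j : nat) (x : R) : R :=
  (-1) ^+ j * expR (x ^+ 2) * derive1n j (fun t : R => expR (- (t ^+ 2))) x.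

(* [hermite j] is the paper's h_j; the basis (varphi_1, ..., varphi_m) is
   (hermite 0, ..., hermite (m - 1)), so it is indexed by ['I_m]. *)
Definition hermite (j : nat) (x : R) : R :=
  (Num.sqrt (2 ^+ j * j`!%:R * Num.sqrt pi))^-1
  * hermite_poly j x * expR (- (x ^+ 2 / 2)).

Definition hermite_coef (theta : R -> R) (k : nat) : R :=
  (\int[lebesgue_measure]_x (theta x * hermite k x))%R.

Definition sobolev_hermite (s D : R) : set (R -> R) :=
  [set theta | theta \in Lfun lebesgue_measure 2%:E /\
    (\sum_(0 <= k <oo) (k%:R `^ s * hermite_coef theta k ^+ 2)%:E <= D%:E)%E].

(* Row j expresses h_j' in (h_0, ..., h_m), through
   h_j' = (sqrt j h_(j-1) - sqrt (j+1) h_(j+1)) / sqrt 2. *)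
Definition Delta (m : nat) : 'M[R]_(m, m.+1) :=
  \matrix_(j, k)
    if k.+1 == j :> nat then Num.sqrt j%:R / Num.sqrt 2
    else if k == j.+1 :> nat then - (Num.sqrt j.+1%:R / Num.sqrt 2)
    else 0.

End Hermite.

Section OperatorNorm.
Context {R : realType}.

Definition l2norm (n : nat) (v : 'cV[R]_n) : R :=
  Num.sqrt (\sum_(i < n) v i ord0 ^+ 2).

(* The norm [`|A|] that the library puts on matrices is the largest modulus of
   an entry, not the operator norm. *)
Definition opnorm (m n : nat) (A : 'M[R]_(m, n)) : R :=
  sup [set l2norm (A *m v) | v in [set v : 'cV[R]_n | l2norm v <= 1]].

Definition opnorm_inv (n : nat) (A : 'M[R]_n) : \bar R :=
  if A \in unitmx then (opnorm (invmx A))%:E else +oo%E.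

End OperatorNorm.

Section Estimators.
Context {R : realType}.

Definition c_frak : R := (3 * ln (3 / 2) - 1) / 9.

Definition Psi (f : R -> R) (m : nat) : 'M[R]_m :=
  \matrix_(j, k)
    (\int[lebesgue_measure]_x (hermite j x * hermite k x * f x))%R.

(* [x] and [y] are the observed samples (X_i) and (Y_i). *)
Variables (n : nat) (x y : 'I_n -> R).

Definition Phi_hat (m : nat) : 'M[R]_(n, m) := \matrix_(i, j) hermite j (x i).

Definition Psi_hat (m : nat) : 'M[R]_m :=
  n%:R^-1 *: ((Phi_hat m)^T *m Phi_hat m).

Definition Y_vec : 'cV[R]_n := \col_i y i.

Definition theta_hat1 (m : nat) : 'cV[R]_m :=
  n%:R^-1 *: (invmx (Psi_hat m) *m (Phi_hat m)^T *m Y_vec).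

Definition theta_hat2 (m : nat) : 'cV[R]_m :=
  - n%:R^-1 *: (Delta m *m invmx (Psi_hat m.+1) *m (Phi_hat m.+1)^T *m Y_vec).

Definition b_hat1 (m : nat) (t : R) : R :=
  \sum_(j < m) theta_hat1 m j ord0 * derive1 (hermite j) t.

Definition b_hat2 (m : nat) (t : R) : R :=
  \sum_(j < m) theta_hat2 m j ord0 * hermite j t.

(* The stability inequality
   K sqrt(m) (||A^-1||_op \/ 1) <= a n / log n. *)
Definition stable (K a : R) (m : nat) (A : 'M[R]_m) : Prop :=
  ((K * Num.sqrt m%:R)%:E * maxe (opnorm_inv A) 1
     <= (a * (n%:R / ln n%:R))%:E)%E.

Definition Lambda (K : R) (m : nat) : Prop := stable K c_frak (Psi_hat m).

Definition b_tilde1 (K : R) (m : nat) (t : R) : R :=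
  if `[< Lambda K m.+1 >] then b_hat1 m t else 0.

Definition b_tilde2 (K : R) (m : nat) (t : R) : R :=
  if `[< Lambda K m.+1 >] then b_hat2 m t else 0.

Definition emp_norm2 (psi : R -> R) : R :=
  n%:R^-1 * \sum_(i < n) psi (x i) ^+ 2.

End Estimators.

Section Model.
Context {R : realType} {d : measure_display} {T : measurableType d}.
Variable P : probability T R.

Definition mutually_independent (n : nat) (Z : 'I_n -> {RV P >-> R}) : Prop :=
  forall (J : {set 'I_n}) (A : 'I_n -> set R),
    (forall i, measurable (A i)) ->
    P (\bigcap_(i in [set i | i \in J]) (Z i @^-1` A i))
    = (\prod_(i in J) P (Z i @^-1` A i))%E.

(* Independence of the two vectors (Z_i) and (Z'_i), i.e. of the sigma-algebras
   which they generate. *)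
Definition independent_families (n : nat) (Z Z' : 'I_n -> {RV P >-> R}) : Prop :=
  forall A B : set T,
    g_sigma_preimage (fun i => Z i : T -> R) A ->
    g_sigma_preimage (fun i => Z' i : T -> R) B ->
    P (A `&` B) = (P A * P B)%E.

Record regression_model (n : nat) (b f : R -> R) (sigma : R)
    (X eps : 'I_n -> {RV P >-> R}) : Prop := RegressionModel {
  b_derivable : forall x, derivable b x 1;
  b_derive_continuous : continuous (derive1 b);
  f_measurable : measurable_fun setT f;
  f_ge0 : forall x, 0 <= f x;
  X_density : forall (i : 'I_n) (A : set R), measurable A ->
    distribution P (X i) A = (\int[lebesgue_measure]_(x in A) (f x)%:E)%E;
  X_independent : mutually_independent X;
  eps_identical : forall (i j : 'I_n) (A : set R), measurable A ->
    distribution P (eps i) A = distribution P (eps j) A;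
  eps_independent : mutually_independent eps;
  eps_centered : forall i, ('E_P[eps i] = 0)%E;
  eps_variance : forall i, ('V_P[eps i] = (sigma ^+ 2)%:E)%E;
  X_eps_independent : independent_families X eps }.

Definition response (n : nat) (b : R -> R) (X eps : 'I_n -> {RV P >-> R})
    (i : 'I_n) (w : T) : R :=
  b (X i w) + eps i w.

(* E ||b_tilde - b'||_n^2 for an estimator [b_tilde] computed from the samples
   (X_i) and (Y_i). *)
Definition risk (n : nat) (b : R -> R) (X eps : 'I_n -> {RV P >-> R})
    (b_tilde : ('I_n -> R) -> ('I_n -> R) -> R -> R) : \bar R :=
  ('E_P[(fun w =>
    let x := fun i => X i w in
    let y := fun i => response b X eps i w in
    emp_norm2 x (fun t => b_tilde x y t - derive1 b t))%R])%E.

End Model.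

(* Main.v *)
(* The fitted values of both estimators are Phi W theta_hat, where theta_hat is the
   least-squares estimator of the coefficients of b in dimension m or m + 1 and W is
   the transpose of Delta or - Delta. Writing Y as the projection of b, plus the
   remainder of b, plus the noise, the error splits into three terms:
   - the approximation error of b', of order m^(1-s) because sum k^s a_k^2 is bounded.
     This requires the Hermite functions to be complete in L^2, proved by letting
     r -> 1 in the Mehler kernel sum_k r^k h_k(x) h_k(y);
   - the image of the remainder, at most ||W||^2 ||Psi^-1|| m^-s, of order m^(1+gamma-s);
   - the image of the noise, at most sigma^2 ||W||^2 ||Psi^-1|| K sqrt m / n, which has
     the same order because n is of the order of m^(s+1/2).
   The last two bounds hold on the event where Psi_hat is comparable to Psi. Let S be
   such that S^T Psi S = 1. A scalar Bernstein bound on each entry of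
   S^T Psi_hat S - 1, with entrywise thresholds of square sum 1/4, shows that this event
   fails with probability at most 2 N^2 exp(- n / (32 a N)), where N = m + 1 and
   a = K sqrt N ||Psi_N^-1||. Since s > 1 + gamma, the exponent grows like a positive
   power of m, so that off this event crude polynomial bounds suffice. *)
Require Import Defs.
From mathcomp Require Import measurable_realfun zify ring lra.

Set Implicit Arguments.
Unset Strict Implicit.
Unset Printing Implicit Defensive.

Local Open Scope classical_set_scope.
Local Open Scope ring_scope.

(** * Integrals of real functions *)

(** The hypothesis s > 1 + gamma is spent in the exponent of the deviation bound: a N has order at
    most m^(3/2 + gamma) and n has order m^(s + 1/2), so n / (a N) is at least of order m^(s - 1 -
    gamma). This margin pays for treating the N^2 entries one by one, hence a scalar inequality is
    enough. The stability condition places the good event inside Lambda: there ||Psi_hat^-1|| is at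
    most 2 max(||Psi^-1||, 1), and this factor 2 is absorbed by passing from c_frak / 2 to c_frak.
    The good event is a finite intersection of conditions on scalar averages of the X_i. It is
    therefore easily seen to be measurable, and it is independent of the noise. The loss is
    dominated pointwise by an explicit integrable function, so that neither Lambda nor the loss
    itself has to be shown measurable. The constant is fixed before b and f, which forces uniform
    bounds on quantities that the hypotheses control only indirectly, such as the coefficient a_0,
    invisible to the weight 0^s = 0. *)

Section RealIntegral.
Context d (T : measurableType d) (R : realType) (mu : {measure set T -> \bar R}).
Implicit Types (f g : T -> R).

Definition itg f := mu.-integrable setT (EFin \o f).

Lemma itg_meas f : itg f -> measurable_fun setT f.
Proof. by move/integrableP => [/measurable_EFinP]. Qed.

Lemma itg_eq f g : f =1 g -> itg f -> itg g.
Proof. by move=> fg; have -> : g = f by apply/funext => x; rewrite fg. Qed.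

Lemma itgD f g : itg f -> itg g -> itg (fun x => f x + g x).
Proof. by move=> intf intg; have := integrableD measurableT intf intg. Qed.

Lemma itgB f g : itg f -> itg g -> itg (fun x => f x - g x).
Proof. by move=> intf intg; have := integrableB measurableT intf intg. Qed.

Lemma itgZ (a : R) f : itg f -> itg (fun x => a * f x).
Proof. by move=> intf; have := integrableZl measurableT a intf. Qed.

Lemma itg_dom f g : measurable_fun setT f -> itg g -> (forall x, `|f x| <= g x) ->
  itg f.
Proof.
move=> mf intg fg; apply: (le_integrable _ _ _ intg) => //.
  exact/measurable_EFinP.
move=> x _ /=; rewrite lee_fin (le_trans (fg x))//; exact: ler_norm.
Qed.

Lemma itg_bnd f g (M : R) : itg f -> measurable_fun setT g ->
  (forall x, `|g x| <= M) -> itg (fun x => f x * g x).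
Proof.
move=> intf mg gM; apply: (@itg_dom _ (fun x => M * `|f x|)).
- exact: measurable_funM (itg_meas intf) mg.
- by apply: itgZ; exact: integrable_norm.
- by move=> x; rewrite normrM mulrC ler_wpM2r.
Qed.

Lemma itg0 : itg (fun=> 0).
Proof. exact: integrable0. Qed.

Lemma itg_sum n (F : 'I_n -> T -> R) : (forall i, itg (F i)) ->
  itg (fun x => \sum_(i < n) F i x).
Proof.
elim: n F => [|n IH] F hF.
  by apply: itg_eq itg0 => x; rewrite big_ord0.
apply: (@itg_eq (fun x => F ord0 x + \sum_(i < n) F (lift ord0 i) x)).
  by move=> x; rewrite big_ord_recl.
by apply: itgD => //; exact: IH.
Qed.

Lemma Rint_sum n (F : 'I_n -> T -> R) : (forall i, itg (F i)) ->
  \int[mu]_x (\sum_(i < n) F i x) = \sum_(i < n) \int[mu]_x F i x.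
Proof.
elim: n F => [|n IH] F hF.
  by rewrite big_ord0 /Rintegral integral0_eq// => x _; rewrite big_ord0.
rewrite big_ord_recl -IH// -RintegralD//; [|exact: hF|exact: itg_sum].
by apply: eq_Rintegral => x _; rewrite big_ord_recl.
Qed.

Lemma itg_fin f : measurable_fun setT f -> (forall x, 0 <= f x) ->
  (\int[mu]_x (f x)%:E < +oo)%E -> itg f.
Proof.
move=> mf f0 foo; apply/integrableP; split; first exact/measurable_EFinP.
by under eq_integral do rewrite /= ger0_norm//.
Qed.

Lemma Rint_EFin f : itg f -> (\int[mu]_x (f x)%:E)%E = (\int[mu]_x f x)%:E.
Proof. by move=> intf; rewrite fineK//; exact: integrable_fin_num. Qed.

Lemma Rint_le f g : itg f -> itg g -> (forall x, f x <= g x) ->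
  \int[mu]_x f x <= \int[mu]_x g x.
Proof. by move=> ? ? fg; exact: le_Rintegral. Qed.

Lemma RintD2 (a b : R) f g : itg f -> itg g ->
  \int[mu]_x (a * f x + b * g x) = a * \int[mu]_x f x + b * \int[mu]_x g x.
Proof.
move=> intf intg; rewrite RintegralD//; [|exact: itgZ|exact: itgZ].
by congr (_ + _); apply: RintegralZl.
Qed.

Lemma Rint_ge0 f : (forall x, 0 <= f x) -> 0 <= \int[mu]_x f x.
Proof. by move=> f0; apply: Rintegral_ge0. Qed.

Lemma itg_le f (A : R) : measurable_fun setT f -> (forall x, 0 <= f x) ->
  (\int[mu]_x (f x)%:E <= A%:E)%E -> itg f /\ \int[mu]_x f x <= A.
Proof.
move=> mf f0 fA; have intf : itg f.
  by apply: itg_fin => //; rewrite (le_lt_trans fA)// ltry.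
by split=> //; rewrite -lee_fin -Rint_EFin.
Qed.

Lemma ge0_integral_mono f g : (forall x, 0 <= f x <= g x) ->
  (\int[mu]_x (f x)%:E <= \int[mu]_x (g x)%:E)%E.
Proof.
move=> fg.
have f0 x : (0 <= (f x)%:E)%E by rewrite lee_fin; case/andP: (fg x).
have g0 x : (0 <= (g x)%:E)%E.
  by rewrite lee_fin; case/andP: (fg x) => ? ?; exact: (@le_trans _ _ (f x)).
rewrite ge0_integralTE// ge0_integralTE//.
apply: ereal_sup_le => _ [h hf <-]; exists h => // x.
by rewrite (le_trans (hf x))// lee_fin; case/andP: (fg x).
Qed.

Definition sqi f := measurable_fun setT f /\ itg (fun x => f x ^+ 2).

Lemma sqiM f g : sqi f -> sqi g -> itg (fun x => f x * g x).
Proof.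
move=> [mf if2] [mg ig2].
apply: (@itg_dom _ (fun x => f x ^+ 2 + g x ^+ 2)).
- exact: measurable_funM.
- exact: itgD.
- move=> x; rewrite normrM -(real_normK (num_real (f x))).
  by rewrite -(real_normK (num_real (g x))); nra.
Qed.

Lemma sqiZ (a : R) f : sqi f -> sqi (fun x => a * f x).
Proof.
move=> [mf if2]; split; first exact: measurable_funM.
by apply: itg_eq (itgZ (a ^+ 2) if2) => x; rewrite exprMn.
Qed.

Lemma sqiD f g : sqi f -> sqi g -> sqi (fun x => f x + g x).
Proof.
move=> hf hg; have [mf if2] := hf; have [mg ig2] := hg.
split; first exact: measurable_funD.
apply: itg_eq (itgD (itgD if2 ig2) (itgZ 2 (sqiM hf hg))) => x; ring.
Qed.

Lemma sqi_eq f g : f =1 g -> sqi f -> sqi g.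
Proof. by move=> fg; have -> : g = f by apply/funext => x; rewrite fg. Qed.

Lemma sqiB f g : sqi f -> sqi g -> sqi (fun x => f x - g x).
Proof.
move=> hf hg; apply: sqi_eq (sqiD hf (sqiZ (-1) hg)) => x; ring.
Qed.

Lemma sqi_sum n (F : 'I_n -> T -> R) : (forall i, sqi (F i)) ->
  sqi (fun x => \sum_(i < n) F i x).
Proof.
elim: n F => [|n IH] F hF.
  apply: (@sqi_eq (fun=> 0)); first by move=> x; rewrite big_ord0.
  by split => //; apply: itg_eq itg0 => x; rewrite expr0n.
apply: (@sqi_eq (fun x => F ord0 x + \sum_(i < n) F (lift ord0 i) x)).
  by move=> x; rewrite big_ord_recl.
by apply: sqiD => //; exact: IH.
Qed.

Lemma Cauchy_Schwarz f g : sqi f -> sqi g ->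
  (\int[mu]_x (f x * g x)) ^+ 2 <= (\int[mu]_x (f x ^+ 2)) * \int[mu]_x (g x ^+ 2).
Proof.
move=> hf hg; have [_ if2] := hf; have [_ ig2] := hg; have ifg := sqiM hf hg.
set a := \int[mu]_x (f x ^+ 2); set b := \int[mu]_x (g x ^+ 2).
set c := \int[mu]_x (f x * g x).
have H t : 0 <= a * t ^+ 2 + 2 * t * c + b.
  have : 0 <= \int[mu]_x ((t * f x + g x) ^+ 2).
    by apply: Rint_ge0 => x; exact: sqr_ge0.
  have -> : \int[mu]_x ((t * f x + g x) ^+ 2) =
      \int[mu]_x (t ^+ 2 * f x ^+ 2 + (2 * t) * (f x * g x) + g x ^+ 2).
    by apply: eq_Rintegral => x _; ring.
  rewrite RintegralD//; last by apply: itgD; exact: itgZ.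
  rewrite RintegralD//; [|exact: itgZ|exact: itgZ].
  by rewrite !RintegralZl// -/a -/b -/c; lra.
have a0 : 0 <= a by apply: Rint_ge0 => x; exact: sqr_ge0.
have [aE|an0] := eqVneq a 0.
  (* When a = 0 the quadratic is affine in t; unless c = 0, this t gives it the value -1. *)
  have := H (- (b + 1) / (2 * c)); rewrite aE !mul0r add0r.
  have [->|cn0] := eqVneq c 0; first by rewrite expr0n.
  suff -> : 2 * (- (b + 1) / (2 * c)) * c = - (b + 1) by lra.
  by field.
have ap : 0 < a by rewrite lt_neqAle eq_sym an0.
have := H (- c / a).
have -> : a * (- c / a) ^+ 2 + 2 * (- c / a) * c + b = b - c ^+ 2 / a by field.
by rewrite subr_ge0 ler_pdivrMr// mulrC.
Qed.

End RealIntegral.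

(** * Integrable functions on the line with an integrable derivative *)

Section RealLine.
Context {R : realType}.
Notation mu := (@lebesgue_measure R).
Implicit Types (f F : R -> R).

Lemma meas_cont f : continuous f -> measurable_fun setT f.
Proof. exact: continuous_measurable_fun. Qed.

Lemma is_derive_cont F (f : R -> R) : (forall x, is_derive x (1 : R) F (f x)) -> continuous F.
Proof.
move=> dF x; apply/differentiable_continuous; rewrite -derivable1_diffP.
by have [] := dF x.
Qed.

Lemma Rint_abs_subset f (A B : set R) : measurable A -> measurable B -> A `<=` B ->
  itg mu f -> \int[mu]_(x in A) `|f x| <= \int[mu]_(x in B) `|f x|.
Proof.
move=> mA mB AB intf; have intn : itg mu (fun x => `|f x|) by exact: integrable_norm.
have intB : mu.-integrable B (EFin \o (fun x => `|f x|)) by exact: integrableS intn.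
have intA : mu.-integrable A (EFin \o (fun x => `|f x|)) by exact: integrableS intB.
rewrite -lee_fin /Rintegral !fineK.
- by apply: ge0_subset_integral => //; move/integrableP : intB => [].
- exact: integrable_fin_num.
- exact: integrable_fin_num.
Qed.

Lemma itg_absS f (A : set R) : measurable A -> itg mu f ->
  \int[mu]_(x in A) `|f x| <= \int[mu]_x `|f x|.
Proof. by move=> mA intf; exact: Rint_abs_subset. Qed.

Lemma FTC2_itv F f (a b : R) : a <= b -> (forall x, is_derive x (1 : R) F (f x)) ->
  continuous f -> \int[mu]_(x in `[a, b]) f x = F b - F a.
Proof.
rewrite le_eqVlt => /predU1P[->|ab] dF cf.
  by rewrite set_itv1 Rintegral_set1 subrr.
have cF := is_derive_cont dF.
rewrite /Rintegral (@continuous_FTC2 _ f F)//.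
- exact: continuous_subspaceT.
- split => [x _||].
  + by have [] := dF x.
  + exact/cvg_at_right_filter/cF.
  + exact/cvg_at_left_filter/cF.
- by move=> x _; rewrite derive1E; have [] := dF x.
Qed.

Lemma itg_itv f (a b : R) : itg mu f -> mu.-integrable `[a, b] (EFin \o f).
Proof. by move=> intf; apply: integrableS intf. Qed.

Lemma diff_le_itv F f (a b : R) : a <= b -> (forall x, is_derive x (1 : R) F (f x)) ->
  continuous f -> itg mu f ->
  `|F b - F a| <= \int[mu]_(x in `[a, b]) `|f x|.
Proof.
move=> ab dF cf intf; rewrite -(FTC2_itv ab dF cf).
by apply: le_normr_Rintegral => //; exact: itg_itv.
Qed.

Lemma small_somewhere F (a b e : R) : itg mu F -> a <= b ->
  \int[mu]_x `|F x| < e * (b - a) ->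
  exists2 t, a <= t <= b & `|F t| < e.
Proof.
move=> iF ab; apply: contraPP => H.
have {}H t : a <= t <= b -> e <= `|F t|.
  by move=> At; rewrite leNgt; apply/negP => Ft; apply: H; exists t.
apply/negP; rewrite -leNgt.
have intn : itg mu (fun x => `|F x|) by exact: integrable_norm.
have mI : measurable (`[a, b]%classic : set R) by [].
apply: (@le_trans _ _ (\int[mu]_(x in `[a, b]) `|F x|)); last exact: itg_absS.
have -> : e * (b - a) = \int[mu]_(x in `[a, b]) e.
  rewrite Rintegral_cst//= lebesgue_measure_itv/= lte_fin.
  by move: ab; rewrite le_eqVlt => /predU1P[->|->//]; rewrite ltxx subrr.
apply: le_Rintegral => //.
- apply: measurable_bounded_integrable => //.
    by rewrite /= lebesgue_measure_itv/= ; case: ifP => _; rewrite -?EFinB ltry.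
  exact: bounded_cst.
- exact: itg_itv.
Qed.

Lemma measurable_tail (n : nat) : measurable [set x : R | n%:R <= `|x|].
Proof.
rewrite (_ : [set x : R | n%:R <= `|x|] = (fun x : R => `|x|) @^-1` `[n%:R, +oo[).
  by rewrite -[X in measurable X]setTI; exact: (normr_measurable (D := setT)).
by apply/seteqP; split => x /=; rewrite in_itv/= andbT.
Qed.

(** Dominated convergence: at each point the truncated function vanishes as soon as n exceeds
    |x|. *)
Lemma tail_small f (e : R) : itg mu f -> 0 < e ->
  exists n : nat, \int[mu]_(x in [set x | n%:R <= `|x|]) `|f x| < e.
Proof.
move=> intf e0.
pose g (n : nat) (x : R) := (`|f x| * (n%:R <= `|x|)%R%:R)%:E.
have mf := itg_meas intf.
have mA := measurable_tail.
have mg n : measurable_fun setT (g n).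
  apply/measurable_EFinP; apply: measurable_funM; first exact: measurableT_comp.
  rewrite (_ : (fun x : R => _) = \1_[set x : R | n%:R <= `|x|]); last first.
    by apply/funext => x; rewrite indicE; congr (nat_of_bool _)%:R; apply/idP/idP;
      rewrite inE.
  exact: measurable_indic.
have : (fun n => (\int[mu]_x g n x)%E) @ \oo --> (\int[mu]_x (cst 0%E x))%E.
  apply: (@dominated_cvg _ _ _ mu setT measurableT g (cst 0%E) (fun x => `|f x|%:E)) => //; last 2 first.
  - exact: integrable_norm.
  - by move=> n x _; rewrite /g lee_fin normrM normr_id ler_piMr// ger0_norm// lern1 leq_b1.
  move=> x _; apply: cvg_near_cst; near=> n.
  rewrite /g leNgt; have -> : `|x| < n%:R by near: n; exact: nbhs_infty_gtr.
  by rewrite mulr0.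
rewrite integral0 => /fine_cvgP[fin /cvgrPdist_lt/(_ _ e0)[n _ /(_ n (leqnn n))]] /=.
rewrite sub0r normrN => Hn; exists n; apply: le_lt_trans (ler_norm _) _.
rewrite Rintegral_mkcond; apply: le_lt_trans Hn; rewrite le_eqVlt; apply/orP; left.
apply/eqP; congr (`| _ |); congr fine; apply: eq_integral => x _; rewrite /g patchE.
by congr EFin; case: ifPn => [/set_mem /= ->|/negP xA]; rewrite ?mulr1//;
  case: (boolP (n%:R <= `|x|)) => [h|_]; rewrite ?mulr0//; case: xA; rewrite inE.
Unshelve. all: by end_near.
Qed.

Section integral_of_derivative.
Variables (F f : R -> R).
Hypotheses (dF : forall x, is_derive x (1 : R) F (f x)) (cf : continuous f).
Hypotheses (iF : itg mu F) (intf : itg mu f).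

(** Integrability does not make F tend to 0, but an interval longer than the integral of |F| divided
    by e must contain a point where |F| < e. [L] is such a length, laid out on both sides of A. *)
Lemma small_beyond (A e : R) : 0 < e ->
  exists t u, [/\ A <= t, u <= A, `|F t| < e & `|F u| < e].
Proof.
move=> e0; pose L := \int[mu]_x `|F x| / e + 1.
have L0 : 0 <= L by rewrite addr_ge0// mulr_ge0 ?invr_ge0 ?(ltW e0)// Rint_ge0.
have LI : \int[mu]_x `|F x| < e * L.
  by rewrite /L mulrDr mulr1 mulrCA divff ?gt_eqF// mulr1 ltrDl.
have [||t /andP[At _] Ft] := @small_somewhere F A (A + L) e iF.
- by rewrite lerDl.
- by rewrite addrAC subrr add0r.
have [||u /andP[_ uA] Fu] := @small_somewhere F (A - L) A e iF.
- by rewrite gerDl oppr_le0.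
- by rewrite opprB addrCA subrr addr0.
by exists t, u.
Qed.

Lemma le_int_derive x : `|F x| <= \int[mu]_x `|f x|.
Proof.
apply/ler_addgt0Pr => e e0; have [t [_ [xt _ Ft _]]] := small_beyond x e0.
rewrite -(subrK (F t) (F x)) (le_trans (ler_normD _ _))// lerD//; last exact: ltW.
rewrite distrC; apply: le_trans (diff_le_itv xt dF cf intf) _; exact: itg_absS.
Qed.

(** This is what removes the boundary terms in integrations by parts. F does tend to 0 here, because
    a far point is linked to one where F is small by an integral of f over the tail only. *)
Lemma int_derive_eq0 : \int[mu]_x f x = 0.
Proof.
apply/eqP; rewrite -normr_eq0; apply/eqP; apply: le_anti; rewrite normr_ge0 andbT.
apply/ler_addgt0Pr => e e0; rewrite add0r.
have e5 : 0 < e / 5 by rewrite divr_gt0.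
have [n] := tail_small intf e5; set tau := (X in X < _) => taue.
have mtail := measurable_tail n.
have n0 : 0 <= n%:R :> R by [].
(* Each of the two boundary values costs 2e/5 (a small value plus a tail), and the integral of f
   outside of the interval costs the last e/5. *)
have FN A : n%:R <= `|A| -> `|F A| <= 2 * (e / 5).
  move=> nA; have [t [u [At uA Ft Fu]]] := small_beyond A e5.
  have [A0|A0] := leP 0 A.
    rewrite -(subrK (F t) (F A)) (le_trans (ler_normD _ _))//.
    rewrite mulrDl !mul1r lerD//; last exact: ltW.
    rewrite distrC (le_trans (diff_le_itv At dF cf intf))// (le_trans _ (ltW taue))//.
    apply: Rint_abs_subset => // x /=; rewrite in_itv/= => /andP[Ax _].
    by rewrite (le_trans nA)// ger0_norm// (le_trans Ax)// ler_norm.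
  rewrite -(subrK (F u) (F A)) (le_trans (ler_normD _ _))//.
  rewrite mulrDl !mul1r lerD//; last exact: ltW.
  rewrite (le_trans (diff_le_itv uA dF cf intf))// (le_trans _ (ltW taue))//.
  apply: Rint_abs_subset => // x /=; rewrite in_itv/= => /andP[_ xA].
  by rewrite (le_trans nA)// ltr0_norm// ler_normr lerN2 xA orbT.
have mI : measurable (`[- n%:R, n%:R]%classic : set R) by [].
rewrite -(setUv `[- n%:R, n%:R]) Rintegral_setU//; last 3 first.
- exact: measurableC.
- by rewrite setUv.
- exact/disj_setPCl.
rewrite FTC2_itv//; last by rewrite (@le_trans _ _ 0)// oppr_le0.
rewrite (le_trans (ler_normD _ _))//.
have : `|\int[mu]_(x in ~` `[- n%:R, n%:R]) f x| <= e / 5.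
  apply: le_trans (ltW taue); apply: le_trans (le_normr_Rintegral _ _) _.
  - exact: measurableC.
  - by apply: integrableS intf => //; exact: measurableC.
  - apply: Rint_abs_subset => //; first exact: measurableC.
    by move=> x /=; rewrite in_itv/= -ler_norml => /negP; rewrite -ltNge => /ltW.
have : `|F n%:R| <= 2 * (e / 5) by apply: FN; rewrite ger0_norm.
have : `|F (- n%:R)| <= 2 * (e / 5) by apply: FN; rewrite normrN ger0_norm.
have := ler_normB (F n%:R) (F (- n%:R)).
by move=> h1 h2 h3 h4; lra.
Qed.

End integral_of_derivative.

End RealLine.

(** * Hermite functions *)

Section HermiteFunctions.
Context {R : realType}.
Notation mu := (@lebesgue_measure R).

Lemma integral_gauss (a b : R) : 0 < a ->
  itg mu (fun y => expR (- a * y ^+ 2 + b * y)) /\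
  \int[mu]_y expR (- a * y ^+ 2 + b * y) =
    Num.sqrt (pi / a) * expR (b ^+ 2 / (4 * a)).
Proof.
(* Completing the square gives a multiple of the normal density with mean b / (2a) and variance 1 /
   (2a). *)
move=> a0; pose s := (Num.sqrt (2 * a))^-1; pose m := b / (2 * a).
have s0 : s != 0 by rewrite invr_eq0 sqrtr_eq0 -ltNge mulr_gt0.
have s2 : s ^+ 2 = (2 * a)^-1 by rewrite exprVn sqr_sqrtr// mulr_ge0// ltW.
have E y : expR (- a * y ^+ 2 + b * y) =
    Num.sqrt (pi / a) * expR (b ^+ 2 / (4 * a)) * normal_pdf m s y.
  rewrite normal_pdfE// /normal_fun /normal_peak s2.
  have -> : (2 * a)^-1 * pi *+ 2 = pi / a :> R by rewrite -mulr_natr; field; rewrite gt_eqF.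
  have S0 : Num.sqrt (pi / a) != 0 by rewrite sqrtr_eq0 -ltNge divr_gt0// pi_gt0.
  rewrite mulrACA divff// mul1r -expRD; congr expR; rewrite -mulr_natr /m.
  by field; rewrite gt_eqF.
have iN : itg mu (normal_pdf m s) by exact: integrable_normal_pdf.
split; first by apply: itg_eq (itgZ _ iN) => y; rewrite E.
under eq_Rintegral do rewrite E.
by rewrite RintegralZl// /Rintegral integral_normal_pdf/= mulr1.
Qed.

Lemma poly_gauss_bound (p : {poly R}) (a : R) : 0 < a ->
  exists C : R, forall x, `|p.[x] * expR (- a * x ^+ 2)| <= C.
Proof.
elim/poly_ind: p a => [|p c IH] a a0.
  by exists 0 => x; rewrite horner0 mul0r normr0.
have a2 : 0 < a / 2 by rewrite divr_gt0.
have [C HC] := IH _ a2.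
exists (C * (1 + (a / 2)^-1) + `|c|) => x.
rewrite hornerMXaddC mulrDl (le_trans (ler_normD _ _))// lerD//; last first.
  by rewrite normrM ler_piMr// ger0_norm ?expR_ge0// expR_le1 mulNr oppr_le0 mulr_ge0 ?sqr_ge0// ltW.
have -> : expR (- a * x ^+ 2) = expR (- (a / 2) * x ^+ 2) * expR (- (a / 2) * x ^+ 2).
  by rewrite -expRD; congr expR; field.
rewrite mulrACA normrM ler_pM// normrM (ger0_norm (expR_ge0 _)).
rewrite mulNr expRN ler_pdivrMr ?expR_gt0//.
(* Half of the Gaussian is left to the induction hypothesis; the other half absorbs the factor x,
   since |x| <= (1 + 2/a) (1 + a x^2 / 2). *)
apply: (@le_trans _ _ ((1 + (a / 2)^-1) * (1 + a / 2 * x ^+ 2))); last first.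
  by rewrite ler_wpM2l ?expR_ge1Dx// addr_ge0// invr_ge0 ltW.
have -> : (1 + (a / 2)^-1) * (1 + a / 2 * x ^+ 2) = 1 + x ^+ 2 + (a / 2)^-1 + a / 2 * x ^+ 2.
  by field; rewrite gt_eqF.
have := normr_ge0 x; rewrite -(real_normK (num_real x)) => x0.
have h1 : 0 <= (a / 2)^-1 by rewrite invr_ge0 ltW.
have h2 : 0 <= a / 2 * `|x| ^+ 2 by rewrite mulr_ge0 ?sqr_ge0// ltW.
by have := sqr_ge0 (`|x| - 2^-1); move: h1 h2 x0; set u := (a / 2)^-1; nra.
Qed.

Lemma itg_poly_gauss (p : {poly R}) (a : R) : 0 < a ->
  itg mu (fun x => p.[x] * expR (- a * x ^+ 2)).
Proof.
move=> a0; have a2 : 0 < a / 2 by rewrite divr_gt0.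
have [C HC] := poly_gauss_bound p a2.
have [ig _] := integral_gauss 0 a2.
have mp : continuous (fun x : R => p.[x] * expR (- (a / 2) * x ^+ 2)).
  move=> x; apply: cvgM; first exact: continuous_horner.
  apply: continuous_comp; last exact: continuous_expR.
  by apply: cvgM; [exact: cvg_cst|exact: exprn_continuous].
apply: itg_eq (itg_bnd ig (meas_cont mp) HC) => x.
by rewrite mul0r addr0 mulrCA; congr (_ * _); rewrite -expRD; congr expR; field.
Qed.

(** Formal Hermite polynomials, through H_(j+1) = 2 x H_j - H_j', the recursion that differentiating
    H_j(x) exp(-x^2) produces. *)
Fixpoint hpoly (j : nat) : {poly R} :=
  if j is i.+1 then 2%:P * 'X * hpoly i - (hpoly i)^`() else 1.

Let hE := (@hornerD R, @hornerN R, @hornerM R, @hornerC R, @hornerX R).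

Lemma deriv_poly1 : (1 : {poly R})^`() = 0.
Proof. by rewrite -polyC1 derivC. Qed.

Lemma deriv_hpolyS j : (hpoly j.+1)^`() = (2 * j.+1%:R)%:P * hpoly j.
Proof.
elim: j => [|j IH].
  by rewrite /= deriv_poly1 subr0 derivM derivM derivX derivC deriv_poly1; ring.
have dd : (hpoly j.+1)^`()^`() = (2 * j.+1%:R)%:P * (hpoly j)^`().
  by rewrite IH derivM derivC mul0r add0r.
have E : hpoly j.+1 = 2%:P * 'X * hpoly j - (hpoly j)^`() by [].
rewrite [hpoly j.+2]/= -/(hpoly j.+1) derivB !derivM derivX derivC dd IH.
have -> : (2 * j.+2%:R)%:P = (2 * j.+1%:R)%:P + 2%:P :> {poly R}.
  by rewrite -polyCD; congr _%:P; rewrite -[j.+2]addn1 natrD; ring.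
by rewrite [in RHS]mulrDl {2}E; ring.
Qed.

Lemma hpoly_rec j (x : R) :
  (hpoly j.+1).[x] = 2 * x * (hpoly j).[x] - 2 * j%:R * (hpoly j.-1).[x].
Proof.
rewrite [hpoly j.+1]/= !hE; congr (_ - _).
case: j => [|j]; first by rewrite deriv_poly1 horner0 mulr0 mul0r.
by rewrite deriv_hpolyS !hE.
Qed.

Lemma is_derive_hpoly_gauss (p : {poly R}) (a x : R) :
  is_derive x (1 : R) (fun t : R => p.[t] * expR (- a * t ^+ 2))
    ((p^`() - (2 * a)%:P * 'X * p).[x] * expR (- a * x ^+ 2)).
Proof.
have dp : is_derive x (1 : R) (fun t : R => p.[t]) (p^`()).[x].
  split; first exact: derivable_horner.
  by rewrite derivE derive1E.
have de : is_derive x (1 : R) (fun t : R => expR (- a * t ^+ 2))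
    (expR (- a * x ^+ 2) * (- a * (2 * x))).
  have h : is_derive x (1 : R) (fun t : R => - a * t ^+ 2) (- a * (2 * x)).
    by apply: is_derive_eq; rewrite -mulr_natl /GRing.scale/=; ring.
  exact: (is_derive1_comp _ h).
have := is_deriveM dp de; rewrite /GRing.scale/= => h.
by apply: (is_derive_eq h); rewrite !hE; ring.
Qed.

Lemma derive1n_gauss j (t : R) :
  derive1n j (fun t : R => expR (- (t ^+ 2))) t =
  (-1) ^+ j * ((hpoly j).[t] * expR (- 1 * t ^+ 2)).
Proof.
elim: j t => [|j IH] t.
  by rewrite derive1n0 expr0 !mul1r hornerC mul1r mulN1r.
rewrite derive1nS.
have -> : derive1n j (fun t : R => expR (- t ^+ 2)) =
  (fun t => (-1) ^+ j * ((hpoly j).[t] * expR (- 1 * t ^+ 2))).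
  by apply/funext => u; exact: IH.
have h := is_derive_hpoly_gauss (hpoly j) 1 t.
have {}h : is_derive t (1 : R) (fun t => (-1) ^+ j * ((hpoly j).[t] * expR (- 1 * t ^+ 2)))
    ((-1) ^+ j * (((hpoly j)^`() - (2 * 1)%:P * 'X * hpoly j).[t] * expR (- 1 * t ^+ 2))).
  exact: is_deriveZ.
rewrite derive1E; have [_ ->] := h.
by rewrite /= [(-1) ^+ j.+1]exprS !hE; ring.
Qed.

Definition hnorm (j : nat) : R := (Num.sqrt (2 ^+ j * j`!%:R * Num.sqrt pi))^-1.

Lemma hermiteE j (x : R) :
  hermite j x = hnorm j * ((hpoly j).[x] * expR (- 2^-1 * x ^+ 2)).
Proof.
rewrite /hermite /hermite_poly derive1n_gauss -/(hnorm j).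
have -> : - (x ^+ 2 / 2) = - 2^-1 * x ^+ 2 by field.
rewrite -!mulrA; congr (_ * _).
have -> : (-1) ^+ j * (expR (x ^+ 2) * ((-1) ^+ j * ((hpoly j).[x] *
   (expR (- 1 * x ^+ 2) * expR (- 2^-1 * x ^+ 2))))) =
   ((-1) ^+ j * (-1) ^+ j) * (expR (x ^+ 2) * expR (- 1 * x ^+ 2)) *
   ((hpoly j).[x] * expR (- 2^-1 * x ^+ 2)) by ring.
by rewrite -expRD mulN1r subrr expR0 -exprD addnn -mul2n exprM sqrrN !expr1n !mul1r.
Qed.

(** The ladder coefficient common to multiplication by x and to differentiation. Since [hq 0] is 0,
    the default value [0.-1 = 0] is harmless in both relations. *)
Definition hq (j : nat) : R := Num.sqrt (j%:R / 2).

Lemma hq0 : hq 0 = 0. Proof. by rewrite /hq mul0r sqrtr0. Qed.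

Lemma hq_ge0 j : 0 <= hq j. Proof. exact: sqrtr_ge0. Qed.

Lemma hq_gt0 j : 0 < hq j.+1. Proof. by rewrite sqrtr_gt0 divr_gt0. Qed.

Lemma hq2 j : hq j ^+ 2 = j%:R / 2. Proof. by rewrite sqr_sqrtr. Qed.

Lemma hnormS j : 2 * hq j.+1 * hnorm j.+1 = hnorm j.
Proof.
rewrite /hnorm exprS factS natrM.
have -> : 2 * 2 ^+ j * (j.+1%:R * (j`!)%:R) * Num.sqrt pi =
  (2 * hq j.+1) ^+ 2 * (2 ^+ j * (j`!)%:R * Num.sqrt pi) :> R.
  by rewrite exprMn hq2; field.
rewrite sqrtrM ?sqr_ge0// sqrtr_sqr ger0_norm ?mulr_ge0 ?hq_ge0// invfM.
by rewrite mulrA divff ?mul1r// mulf_neq0// gt_eqF// ?hq_gt0.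
Qed.

Lemma hermite_xrec j (x : R) :
  x * hermite j x = hq j.+1 * hermite j.+1 x + hq j * hermite j.-1 x.
Proof.
rewrite !hermiteE hpoly_rec.
case: j => [|j]; first by rewrite hq0 -(hnormS 0); ring.
rewrite succnK -(hnormS j) -(hnormS j.+1).
have -> : j.+1%:R = 2 * hq j.+1 ^+ 2 by rewrite hq2; field.
by ring.
Qed.

Lemma is_derive_hermite j (x : R) : is_derive x (1 : R) (hermite j)
  (hq j * hermite j.-1 x - hq j.+1 * hermite j.+1 x).
Proof.
have -> : hermite j = (fun x => hnorm j * ((hpoly j).[x] * expR (- 2^-1 * x ^+ 2))).
  by apply/funext => u; exact: hermiteE.
have h := is_deriveZ (hnorm j) (is_derive_hpoly_gauss (hpoly j) 2^-1 x).
apply: (is_derive_eq h); rewrite /GRing.scale/= !hermiteE hpoly_rec !hE.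
case: j {h} => [|j]; first by rewrite hq0 -(hnormS 0) deriv_poly1 horner0; field.
rewrite deriv_hpolyS succnK !hE -(hnormS j) -(hnormS j.+1).
have -> : j.+1%:R = 2 * hq j.+1 ^+ 2 by rewrite hq2; field.
by field.
Qed.

Lemma continuous_hermite j : continuous (@hermite R j).
Proof. by apply: is_derive_cont => x; exact: is_derive_hermite. Qed.

Let half_gt0 : 0 < 2^-1 :> R. Proof. by rewrite invr_gt0. Qed.

Lemma hermite_bound j : exists C : R, forall x, `|hermite j x| <= C.
Proof.
have [C HC] := @poly_gauss_bound (hnorm j *: hpoly j) 2^-1 half_gt0.
by exists C => x; apply: le_trans (HC x); rewrite hermiteE hornerZ mulrA.
Qed.

Lemma expR_sqr_half (x : R) : expR (- 1 * x ^+ 2) = expR (- 2^-1 * x ^+ 2) ^+ 2.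
Proof. by rewrite [RHS]expr2 -expRD; congr expR; field. Qed.

Lemma sqi_hermite j : sqi mu (hermite j).
Proof.
split; first by apply: meas_cont; exact: continuous_hermite.
have := @itg_poly_gauss ((hnorm j ^+ 2)%:P * (hpoly j * hpoly j)) 1 ltr01.
apply: itg_eq => x; rewrite hermiteE !hE.
rewrite expR_sqr_half.
by ring.
Qed.

Lemma hermite00 : \int[mu]_x (hermite 0 x * hermite 0 x) = 1.
Proof.
have [_] := @integral_gauss 1 0 ltr01.
rewrite expr0n/= mul0r expR0 mulr1 divr1 => E.
transitivity (\int[mu]_x ((hnorm 0) ^+ 2 * expR (- 1 * x ^+ 2 + 0 * x))).
  apply: eq_Rintegral => x _; rewrite !hermiteE !hE mul0r addr0.
  rewrite expR_sqr_half.
  by ring.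
rewrite RintegralZl//; last by have [] := @integral_gauss 1 0 ltr01.
rewrite E /hnorm expr0 fact0 !mul1r exprVn sqr_sqrtr ?sqrtr_ge0//.
by rewrite mulVf// sqrtr_eq0 -ltNge pi_gt0.
Qed.

End HermiteFunctions.

(* Orthonormality comes from the ladder relations, by integrating by parts. *)
Section Orthonormality.
Context {R : realType}.
Notation mu := (@lebesgue_measure R).

Lemma is_derive_mul (u v : R -> R) (x du dv : R) :
  is_derive x (1 : R) u du -> is_derive x (1 : R) v dv ->
  is_derive x (1 : R) (fun t => u t * v t) (du * v x + u x * dv).
Proof.
move=> hu hv; apply: (is_derive_eq (is_deriveM hu hv)).
by rewrite /GRing.scale/= addrC [du * _]mulrC.
Qed.

Lemma int_by_parts (u du v dv : R -> R) :
  (forall x, is_derive x (1 : R) u (du x)) -> (forall x, is_derive x (1 : R) v (dv x)) ->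
  continuous du -> continuous dv ->
  itg mu (fun x => u x * v x) -> itg mu (fun x => du x * v x) ->
  itg mu (fun x => u x * dv x) ->
  \int[mu]_x (du x * v x) = - \int[mu]_x (u x * dv x).
Proof.
move=> hu hv cdu cdv iuv iduv iudv; apply/eqP; rewrite -addr_eq0 -RintegralD//.
apply/eqP/(@int_derive_eq0 _ (fun x => u x * v x)) => //.
- by move=> x; exact: is_derive_mul.
- by move=> x; apply: cvgD; apply: cvgM;
    solve [exact: cdu|exact: cdv|exact: (is_derive_cont hu)|exact: (is_derive_cont hv)].
- exact: itgD.
Qed.

Definition dhermite (k : nat) (x : R) : R :=
  hq k * hermite k.-1 x - hq k.+1 * hermite k.+1 x.

Lemma sqi_dhermite k : sqi mu (dhermite k).
Proof. by apply: sqiB; apply: sqiZ; exact: sqi_hermite. Qed.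

Lemma continuous_dhermite k : continuous (dhermite k).
Proof.
move=> x; apply: cvgB; apply: cvgM;
  solve [exact: cvg_cst|exact: continuous_hermite].
Qed.

Lemma itg_mul_hermite (g : R -> R) k : sqi mu g -> itg mu (fun x => g x * hermite k x).
Proof. by move=> hg; apply: sqiM => //; exact: sqi_hermite. Qed.

Lemma hermite_coefD_lin (g : R -> R) (a b : R) (j k : nat) : sqi mu g ->
  \int[mu]_x (g x * (a * hermite j x + b * hermite k x)) =
  a * hermite_coef g j + b * hermite_coef g k.
Proof.
move=> hg; rewrite /hermite_coef -!RintegralZl//; try exact: itg_mul_hermite.
rewrite -RintegralD//; try by apply: itgZ; exact: itg_mul_hermite.
by apply: eq_Rintegral => x _; ring.
Qed.

Lemma hermite_coef_derive (u du : R -> R) k :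
  (forall x, is_derive x (1 : R) u (du x)) -> continuous du ->
  sqi mu u -> sqi mu du ->
  hermite_coef du k = hq k.+1 * hermite_coef u k.+1 - hq k * hermite_coef u k.-1.
Proof.
move=> hu cdu su sdu.
have hk x : is_derive x (1 : R) (hermite k) (dhermite k x) by exact: is_derive_hermite.
rewrite /hermite_coef (int_by_parts hu hk cdu (@continuous_dhermite k)).
- transitivity (- \int[mu]_x (u x * (- hq k.+1 * hermite k.+1 x + hq k * hermite k.-1 x))).
    by congr (- _); apply: eq_Rintegral => x _; rewrite /dhermite; ring.
  by rewrite hermite_coefD_lin// /hermite_coef; ring.
- exact: itg_mul_hermite.
- exact: itg_mul_hermite.
- by apply: sqiM => //; exact: sqi_dhermite.
Qed.

(** Two identities between the same scalar products: moving the derivative from one factor to the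
    other gives differences, moving the multiplication by x gives sums. Combining them eliminates
    the terms in j - 1 and k + 1. *)
Lemma hermite_ladder j k :
  hq j.+1 * hermite_coef (hermite j.+1) k = hq k * hermite_coef (@hermite R j) k.-1.
Proof.
have sj n := @sqi_hermite R n.
have E1 := @hermite_coef_derive (hermite j) (dhermite j) k
  (@is_derive_hermite R j) (@continuous_dhermite j) (sj j) (sqi_dhermite j).
have E1' : hermite_coef (dhermite j) k =
    hq j * hermite_coef (hermite j.-1) k - hq j.+1 * hermite_coef (hermite j.+1) k.
  transitivity (\int[mu]_x (hermite k x * (hq j * hermite j.-1 x + (- hq j.+1) * hermite j.+1 x))).
    by apply: eq_Rintegral => x _; rewrite /dhermite; ring.
  rewrite hermite_coefD_lin// /hermite_coef mulNr; congr (_ * _ - _ * _);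
    by apply: eq_Rintegral => x _; rewrite mulrC.
have E2 : \int[mu]_x (hermite k x * (hq j.+1 * hermite j.+1 x + hq j * hermite j.-1 x)) =
   \int[mu]_x (hermite j x * (hq k.+1 * hermite k.+1 x + hq k * hermite k.-1 x)).
  by apply: eq_Rintegral => x _; rewrite -!hermite_xrec; ring.
rewrite !hermite_coefD_lin// in E2.
have C n l : hermite_coef (@hermite R n) l = hermite_coef (hermite l) n.
  by apply: eq_Rintegral => x _; rewrite mulrC.
rewrite (C k) (C k) in E2.
by lra.
Qed.

(** The ladder lowers both indices together until one of them is 0, where the coefficient [hq 0]
    kills the other side. *)
Lemma hermite_orthonormal j k : hermite_coef (@hermite R j) k = (j == k)%:R.
Proof.
elim: j k => [|j IH] [|k].
- exact: hermite00.
- transitivity (hermite_coef (@hermite R k.+1) 0).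
    by apply: eq_Rintegral => x _; rewrite mulrC.
  apply: (mulfI (x := hq k.+1)); first by rewrite gt_eqF// hq_gt0.
  by rewrite hermite_ladder hq0 mul0r mulr0.
- apply: (mulfI (x := hq j.+1)); first by rewrite gt_eqF// hq_gt0.
  by rewrite hermite_ladder hq0 mul0r mulr0.
- apply: (mulfI (x := hq j.+1)); first by rewrite gt_eqF// hq_gt0.
  rewrite hermite_ladder IH eqSS; case: eqVneq => [->//|_]; by rewrite !mulr0.
Qed.

Definition hsum (N : nat) (c : nat -> R) (x : R) : R :=
  \sum_(k < N) c k * hermite k x.

Lemma sqi_hsum N c : sqi mu (hsum N c).
Proof. by apply: sqi_sum => k; apply: sqiZ; exact: sqi_hermite. Qed.

Lemma int_mul_hsum (g : R -> R) N c : sqi mu g ->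
  \int[mu]_x (g x * hsum N c x) = \sum_(k < N) c k * hermite_coef g k.
Proof.
move=> hg.
transitivity (\int[mu]_x (\sum_(k < N) c k * (g x * hermite k x))).
  by apply: eq_Rintegral => x _; rewrite mulr_sumr; apply: eq_bigr => k _; ring.
rewrite Rint_sum; last by move=> k; apply: itgZ; exact: itg_mul_hermite.
by apply: eq_bigr => k _; rewrite RintegralZl//; exact: itg_mul_hermite.
Qed.

Lemma hermite_coef_hsum N c k : hermite_coef (hsum N c) k = (k < N)%:R * c k.
Proof.
transitivity (\int[mu]_x (hermite k x * hsum N c x)).
  by apply: eq_Rintegral => x _; rewrite mulrC.
rewrite int_mul_hsum; last exact: sqi_hermite.
under eq_bigr do rewrite hermite_orthonormal.
case: ltnP => kN.
  rewrite (bigD1 (Ordinal kN))//= eqxx mulr1 big1 ?addr0 ?mul1r// => i ik.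
  case: (eqVneq k (i : nat)) => [E|]; rewrite ?mulr0//.
  by case/eqP: ik; apply/val_inj.
rewrite big1 ?mul0r// => i _; case: eqVneq => [E|]; rewrite ?mulr0//.
by have := ltn_ord i; rewrite -E ltnNge kN.
Qed.

Lemma int_hsum_sqr N c : \int[mu]_x (hsum N c x ^+ 2) = \sum_(k < N) c k ^+ 2.
Proof.
transitivity (\int[mu]_x (hsum N c x * hsum N c x)).
  by apply: eq_Rintegral.
rewrite int_mul_hsum; last exact: sqi_hsum.
by apply: eq_bigr => k _; rewrite hermite_coef_hsum ltn_ord mul1r expr2.
Qed.

Lemma int_sub_hsum_sqr (g : R -> R) N c : sqi mu g ->
  \int[mu]_x ((g x - hsum N c x) ^+ 2) =
  \int[mu]_x (g x ^+ 2) - 2 * (\sum_(k < N) c k * hermite_coef g k) + \sum_(k < N) c k ^+ 2.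
Proof.
move=> hg; have [_ ig] := hg; have [_ ih] := sqi_hsum N c.
have igh := sqiM hg (sqi_hsum N c).
rewrite -int_hsum_sqr -int_mul_hsum// -RintegralZl// -RintegralB//; last exact: itgZ.
rewrite -RintegralD//; last by apply: itgB => //; exact: itgZ.
by apply: eq_Rintegral => x _; ring.
Qed.

Lemma hermite_coefB (g h : R -> R) k : sqi mu g -> sqi mu h ->
  hermite_coef (fun x => g x - h x) k = hermite_coef g k - hermite_coef h k.
Proof.
move=> hg hh; rewrite /hermite_coef -RintegralB//; try exact: itg_mul_hermite.
by apply: eq_Rintegral => x _; rewrite mulrBl.
Qed.

End Orthonormality.

(** * Completeness of the Hermite basis, through the Mehler kernel *)

Lemma expR_sqr (R : realType) (u : R) : expR u ^+ 2 = expR (u + u).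
Proof. by rewrite expRD expr2. Qed.

Section Mehler.
Context {R : realType}.
Notation mu := (@lebesgue_measure R).
Variable tau : R.
Hypothesis tau01 : 0 < tau < 1.

Let t0 : 0 < tau. Proof. by case/andP: tau01. Qed.
Let t1 : tau < 1. Proof. by case/andP: tau01. Qed.

Definition mratio : R := (1 - tau) / (1 + tau).
Definition malpha : R := (tau^-1 + tau) / 4.
Definition mbeta : R := (tau^-1 - tau) / 4.
Definition mconst : R := (1 + tau) / (2 * Num.sqrt (pi * tau)).

(* With r = mratio, this is the Mehler kernel sum_k r^k h_k(x) h_k(y); the
   parameter tau = (1 - r) / (1 + r) tends to 0 when r tends to 1. *)
Definition mehler (x y : R) : R :=
  mconst * expR (- malpha * (x ^+ 2 + y ^+ 2) + 2 * mbeta * x * y).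

Let tn0 : tau != 0. Proof. by rewrite gt_eqF. Qed.
Let tp0 : 1 + tau != 0. Proof. by rewrite gt_eqF// addr_gt0. Qed.

Lemma malpha_gt0 : 0 < malpha.
Proof. by rewrite divr_gt0// addr_gt0// invr_gt0. Qed.

Lemma mratio_ge0 : 0 <= mratio.
Proof. by rewrite divr_ge0 ?subr_ge0 ?addr_ge0 ?ltW. Qed.

Lemma mratio_lt1 : mratio < 1.
Proof. by rewrite ltr_pdivrMr ?addr_gt0//; have := t0; lra. Qed.

Lemma mconst_gt0 : 0 < mconst.
Proof. by rewrite divr_gt0 ?addr_gt0// mulr_gt0// sqrtr_gt0 mulr_gt0// pi_gt0. Qed.

Lemma mehler_ge0 x y : 0 <= mehler x y.
Proof. by rewrite mulr_ge0 ?expR_ge0// ltW// mconst_gt0. Qed.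

Lemma continuous_mehler x : continuous (mehler x).
Proof.
move=> y; apply: cvgM; first exact: cvg_cst.
apply: continuous_comp; last exact: continuous_expR.
apply: cvgD; apply: cvgM; try exact: cvg_cst; last exact: cvg_id.
by apply: cvgD; [exact: cvg_cst|exact: exprn_continuous].
Qed.

Lemma mehler_gauss x y : mehler x y =
  mconst * expR (- malpha * x ^+ 2) * expR (- malpha * y ^+ 2 + (2 * mbeta * x) * y).
Proof. by rewrite -mulrA -expRD; congr (_ * expR _); ring. Qed.

Lemma itg_mehler x : itg mu (mehler x).
Proof.
have [ig _] := integral_gauss (2 * mbeta * x) malpha_gt0.
by apply: itg_eq (itgZ (mconst * expR (- malpha * x ^+ 2)) ig) => y; rewrite mehler_gauss.
Qed.

(** The diagonal of the Mehler kernel of ratio r^2, that is sum_k r^(2k) h_k(x)^2; its integral is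
    the trace 1 / (1 - r^2). *)
Definition mdiag (x : R) : R :=
  mconst ^+ 2 * Num.sqrt (pi / (2 * malpha)) *
    expR (- (2 * malpha - 2 * mbeta ^+ 2 / malpha) * x ^+ 2).

Let an0 : malpha != 0. Proof. by rewrite gt_eqF// malpha_gt0. Qed.

Lemma mehler_sqr x : sqi mu (mehler x) /\ \int[mu]_y (mehler x y ^+ 2) = mdiag x.
Proof.
have a2 : 0 < 2 * malpha by rewrite mulr_gt0// malpha_gt0.
have [ig E] := integral_gauss (4 * mbeta * x) a2.
have F y : mehler x y ^+ 2 = mconst ^+ 2 * expR (- (2 * malpha) * x ^+ 2) *
    expR (- (2 * malpha) * y ^+ 2 + 4 * mbeta * x * y).
  rewrite /mehler exprMn expR_sqr -[RHS]mulrA -expRD; congr (_ * expR _); ring.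
have iK : itg mu (fun y => mehler x y ^+ 2).
  by apply: itg_eq (itgZ _ ig) => y; rewrite F.
split; first by split => //; apply: meas_cont; exact: continuous_mehler.
under eq_Rintegral do rewrite F.
rewrite RintegralZl// E /mdiag.
have -> : expR (- (2 * malpha - 2 * mbeta ^+ 2 / malpha) * x ^+ 2) =
    expR (- (2 * malpha) * x ^+ 2) * expR ((4 * mbeta * x) ^+ 2 / (4 * (2 * malpha))).
  by rewrite -expRD; congr expR; field.
ring.
Qed.

Let pit : 0 < pi * tau. Proof. by rewrite mulr_gt0// pi_gt0. Qed.

Lemma mconst2 : mconst ^+ 2 = (1 + tau) ^+ 2 / (4 * (pi * tau)).
Proof.
rewrite /mconst exprMn exprVn exprMn sqr_sqrtr; last exact: ltW.
by congr (_ / (_ * _)); ring.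
Qed.

Lemma mdiag_itg : itg mu mdiag /\ \int[mu]_x mdiag x = (1 - mratio ^+ 2)^-1.
Proof.
have gE : 2 * malpha - 2 * mbeta ^+ 2 / malpha = (2 * malpha)^-1.
  (* This relation is the reason why the Gaussian factors simplify: the exponent of [mdiag] is 1 /
     (2 malpha). *)
  have h : malpha ^+ 2 - mbeta ^+ 2 = 4^-1 by rewrite /malpha /mbeta; field.
  have -> : 2 * malpha - 2 * mbeta ^+ 2 / malpha = 2 * (malpha ^+ 2 - mbeta ^+ 2) / malpha.
    by field.
  by rewrite h; field.
have g0 : 0 < 2 * malpha - 2 * mbeta ^+ 2 / malpha.
  by rewrite gE invr_gt0 mulr_gt0// malpha_gt0.
have [ig E] := integral_gauss 0 g0.
have ig' : itg mu (fun x => expR (- (2 * malpha - 2 * mbeta ^+ 2 / malpha) * x ^+ 2)).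
  by apply: itg_eq ig => x; rewrite mul0r addr0.
split; first exact: itgZ.
rewrite /mdiag RintegralZl//.
have -> : \int[mu]_x expR (- (2 * malpha - 2 * mbeta ^+ 2 / malpha) * x ^+ 2) =
    Num.sqrt (pi / (2 * malpha - 2 * mbeta ^+ 2 / malpha)).
  rewrite expr0n/= mul0r expR0 mulr1 in E.
  by rewrite -E; apply: eq_Rintegral => x _; rewrite mul0r addr0.
rewrite gE invrK -mulrA -sqrtrM; last by rewrite divr_ge0 ?pi_ge0// mulr_ge0// ltW// malpha_gt0.
have -> : pi / (2 * malpha) * (pi * (2 * malpha)) = pi ^+ 2 by field.
rewrite sqrtr_sqr ger0_norm ?pi_ge0// mconst2 /mratio.
have pn0 : pi != 0 :> R by rewrite gt_eqF// pi_gt0.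
have -> : 1 - ((1 - tau) / (1 + tau)) ^+ 2 = 4 * tau / (1 + tau) ^+ 2 by field.
by move: (pi : R) pn0 => p pn0; field; rewrite tn0 tp0 pn0.
Qed.

(** The Hermite functions are eigenfunctions of the kernel. For k = 0 this is a Gaussian integral;
    then both sides obey the same three-term recursion, obtained on the left by integrating the
    y-derivative of the kernel by parts. *)
Lemma mehler_hermite k x : \int[mu]_y (mehler x y * hermite k y) = mratio ^+ k * hermite k x.
Proof.
pose I j := \int[mu]_y (mehler x y * hermite j y).
have [sK _] := mehler_sqr x.
have iK j : itg mu (fun y => mehler x y * hermite j y).
  by apply: sqiM => //; exact: sqi_hermite.
have I0 : I 0 = hermite 0 x.
  have a0 : 0 < malpha + 2^-1 by rewrite addr_gt0// malpha_gt0.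
  have [ig E] := integral_gauss (2 * mbeta * x) a0.
  have F y : mehler x y * hermite 0 y = mconst * hnorm 0 * expR (- malpha * x ^+ 2) *
      expR (- (malpha + 2^-1) * y ^+ 2 + (2 * mbeta * x) * y).
    rewrite hermiteE hornerC mul1r mehler_gauss.
    have -> : expR (- (malpha + 2^-1) * y ^+ 2 + (2 * mbeta * x) * y) =
        expR (- malpha * y ^+ 2 + (2 * mbeta * x) * y) * expR (- 2^-1 * y ^+ 2).
      by rewrite -expRD; congr expR; ring.
    by ring.
  rewrite /I; under eq_Rintegral do rewrite F.
  rewrite RintegralZl// E hermiteE hornerC mul1r.
  have aE : malpha + 2^-1 = (1 + tau) ^+ 2 / (4 * tau) by rewrite /malpha; field.
  have -> : Num.sqrt (pi / (malpha + 2^-1)) = mconst^-1.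
    have -> : pi / (malpha + 2^-1) = (mconst^-1) ^+ 2.
      rewrite exprVn mconst2 aE.
      have : pi != 0 :> R by rewrite gt_eqF// pi_gt0.
      by move: (pi : R) => p pn0; field; rewrite tn0 tp0 pn0.
    by rewrite sqrtr_sqr ger0_norm// invr_ge0 ltW// mconst_gt0.
  have cn0 : mconst != 0 by rewrite gt_eqF// mconst_gt0.
  have -> : expR (- 2^-1 * x ^+ 2) = expR (- malpha * x ^+ 2) *
      expR ((2 * mbeta * x) ^+ 2 / (4 * (malpha + 2^-1))).
    rewrite -expRD; congr expR; rewrite aE /malpha /mbeta; field.
    by rewrite tn0 tp0.
  by field.
(* The y-derivative of the kernel is (2 mbeta x - 2 malpha y) times the kernel, and y h_j is
   expanded by the ladder relation. *)
have rec j : hq j.+1 * I j.+1 = mratio * x * I j - mratio ^+ 2 * hq j * I j.-1.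
  pose du y := (- (2 * malpha) * y + 2 * mbeta * x) * mehler x y.
  have hu y : is_derive y (1 : R) (mehler x) (du y).
    have h : is_derive y (1 : R) (fun y : R => - malpha * (x ^+ 2 + y ^+ 2) + 2 * mbeta * x * y)
       (- (2 * malpha) * y + 2 * mbeta * x).
      by apply: is_derive_eq; rewrite -mulr_natl /GRing.scale/=; ring.
    have h2 := is_deriveZ mconst (is_derive1_comp (is_derive_expR _) h).
    by apply: (is_derive_eq h2); rewrite /du /mehler /GRing.scale/=; ring.
  have cdu : continuous du.
    move=> y; apply: cvgM; last exact: continuous_mehler.
    apply: cvgD; last exact: cvg_cst.
    by apply: cvgM; [exact: cvg_cst|exact: cvg_id].
  have hk y : is_derive y (1 : R) (hermite j) (dhermite j y) by exact: is_derive_hermite.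
  have duE y : du y * hermite j y = - (2 * malpha) * (hq j.+1 * (mehler x y * hermite j.+1 y)) +
      (- (2 * malpha) * (hq j * (mehler x y * hermite j.-1 y)) +
       2 * mbeta * x * (mehler x y * hermite j y)).
    have -> : du y * hermite j y = - (2 * malpha) * mehler x y * (y * hermite j y) +
       2 * mbeta * x * (mehler x y * hermite j y) by rewrite /du; ring.
    by rewrite hermite_xrec; ring.
  have iduE : itg mu (fun y => - (2 * malpha) * (hq j.+1 * (mehler x y * hermite j.+1 y)) +
      (- (2 * malpha) * (hq j * (mehler x y * hermite j.-1 y)) +
       2 * mbeta * x * (mehler x y * hermite j y))).
    by repeat first [apply: itgD | apply: itgZ | exact: iK].
  have idu : itg mu (fun y => du y * hermite j y) by apply: itg_eq iduE => y; rewrite duE.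
  have iud : itg mu (fun y => mehler x y * dhermite j y).
    by apply: sqiM => //; exact: sqi_dhermite.
  have := int_by_parts hu hk cdu (@continuous_dhermite _ j) (iK j) idu iud.
  under eq_Rintegral do rewrite duE.
  do 2 (rewrite RintegralD//; last 2 first;
    [by repeat first [apply: itgD | apply: itgZ | exact: iK]..|]).
  rewrite !RintegralZl//; try by repeat first [apply: itgZ | exact: iK].
  have -> : \int[mu]_y (mehler x y * dhermite j y) = hq j * I j.-1 - hq j.+1 * I j.+1.
    transitivity (\int[mu]_y (mehler x y * (hq j * hermite j.-1 y + (- hq j.+1) * hermite j.+1 y))).
      by apply: eq_Rintegral => y _; rewrite /dhermite mulNr.
    rewrite hermite_coefD_lin// /hermite_coef -/(I _) -/(I _); ring.
  rewrite -/(I j.+1) -/(I j.-1) -/(I j) => H.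
  have H2 : (1 + 2 * malpha) * (hq j.+1 * I j.+1) =
      2 * mbeta * x * I j + (1 - 2 * malpha) * (hq j * I j.-1) by lra.
  have an : 1 + 2 * malpha != 0 by rewrite gt_eqF// addr_gt0// mulr_gt0// malpha_gt0.
  apply: (mulfI an); rewrite H2 /mratio /malpha /mbeta; field.
  by rewrite tn0 tp0.
(* The recursion has order two, so the induction carries two consecutive values. *)
suff H : I k = mratio ^+ k * hermite k x /\ I k.-1 = mratio ^+ k.-1 * hermite k.-1 x.
  by case: H.
elim: k => [|k [IH1 IH2]]; first by rewrite expr0 mul1r.
split => //; apply: (mulfI (x := hq k.+1)); first by rewrite gt_eqF// hq_gt0.
rewrite rec IH1 IH2.
have -> : hq k.+1 * (mratio ^+ k.+1 * hermite k.+1 x) =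
  mratio ^+ k.+1 * (x * hermite k x - hq k * hermite k.-1 x).
  by rewrite hermite_xrec; ring.
case: k {IH1 IH2} => [|k]; first by rewrite hq0 /= !expr0 expr1; ring.
by rewrite succnK !exprS; ring.
Qed.

(* The squared distance from [mehler x] to its N-th partial sum, see mdefectE. *)
Definition mdefect (N : nat) (x : R) : R :=
  mdiag x - \sum_(k < N) (mratio ^+ k * hermite k x) ^+ 2.

Lemma mdefectE N x : mdefect N x =
  \int[mu]_y ((mehler x y - hsum N (fun k => mratio ^+ k * hermite k x) y) ^+ 2).
Proof.
have [sK E] := mehler_sqr x.
rewrite int_sub_hsum_sqr// E /mdefect /hermite_coef.
under [X in 2 * X]eq_bigr do rewrite mehler_hermite -expr2.
by ring.
Qed.

(** The trace minus its first N terms, a geometric tail. Only this integrated form of the Mehler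
    expansion is established; pointwise convergence of the series is bypassed. *)
Lemma mdefect_itg N : itg mu (mdefect N) /\
  \int[mu]_x mdefect N x = (mratio ^+ 2) ^+ N / (1 - mratio ^+ 2).
Proof.
have [id E] := mdiag_itg.
have ih (k : 'I_N) : itg mu (fun x => (mratio ^+ k * hermite k x) ^+ 2).
  by have [] := sqiZ (mratio ^+ k) (@sqi_hermite R k).
have is_ := itg_sum ih.
split; first exact: itgB.
rewrite RintegralB// E Rint_sum//.
have -> : \sum_(i < N) \int[mu]_x ((mratio ^+ i * hermite i x) ^+ 2) =
    \sum_(i < N) (mratio ^+ 2) ^+ i.
  apply: eq_bigr => i _.
  transitivity (\int[mu]_x ((mratio ^+ 2) ^+ i * (hermite i x * hermite i x))).
    by apply: eq_Rintegral => x _; rewrite exprMn exprAC; ring.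
  rewrite RintegralZl; [|by []|by apply: sqiM; exact: sqi_hermite].
  by rewrite -[X in _ * X]/(hermite_coef (hermite i) i) hermite_orthonormal eqxx mulr1.
have r1 : 1 - mratio ^+ 2 != 0.
  by rewrite subr_eq0 eq_sym lt_eqF// expr_lt1// ?mratio_ge0 ?mratio_lt1.
have := subrX1 (mratio ^+ 2) N; set S := \sum_(i < N) _ => H.
apply: (mulfI r1); rewrite mulrBr divff// mulrCA divff// mulr1.
have -> : (1 - mratio ^+ 2) * S = - ((mratio ^+ 2 - 1) * S) by ring.
by rewrite -H; ring.
Qed.

(** Cauchy-Schwarz applied to g and to the kernel minus its partial sum. *)
Lemma mehler_hsum_dist (g : R -> R) N x : sqi mu g ->
  (\int[mu]_y (mehler x y * g y) - hsum N (fun k => mratio ^+ k * hermite_coef g k) x) ^+ 2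
  <= mdefect N x * \int[mu]_y (g y ^+ 2).
Proof.
move=> hg; have [sK _] := mehler_sqr x.
have sh := @sqi_hsum R N (fun k => mratio ^+ k * hermite k x).
have <- : \int[mu]_y ((mehler x y - hsum N (fun k => mratio ^+ k * hermite k x) y) * g y) =
    \int[mu]_y (mehler x y * g y) - hsum N (fun k => mratio ^+ k * hermite_coef g k) x.
  transitivity (\int[mu]_y (mehler x y * g y - g y * hsum N (fun k => mratio ^+ k * hermite k x) y)).
    by apply: eq_Rintegral => y _; ring.
  rewrite RintegralB//; [|exact: sqiM|exact: sqiM].
  rewrite int_mul_hsum//; congr (_ - _); apply: eq_bigr => k _; ring.
by rewrite mdefectE; apply: Cauchy_Schwarz => //; exact: sqiB.
Qed.

End Mehler.

Section FatouBound.
Context d (T : measurableType d) (R : realType) (mu : {measure set T -> \bar R}).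

Lemma limn_einf_geP (u : nat -> \bar R) (c : R) :
  (forall e : R, 0 < e -> exists N, forall n, (N <= n)%N -> ((c - e)%:E <= u n)%E) ->
  (c%:E <= limn_einf u)%E.
Proof.
move=> H; apply/lee_addgt0Pr => e e0; rewrite -leeBlDr//.
have [N HN] := H _ e0; rewrite limn_einf_lim; apply: lime_ge; first exact: is_cvg_einfs.
near=> n; apply: le_ereal_inf_tmp => _ [m /= nm <-]; rewrite -EFinB; apply: HN.
by apply: leq_trans nm; near: n; exists N.
Unshelve. all: by end_near. Qed.

Lemma limn_einf_leP (u : nat -> \bar R) (c : R) :
  (forall e : R, 0 < e -> exists N, forall n, (N <= n)%N -> (u n <= (c + e)%:E)%E) ->
  (limn_einf u <= c%:E)%E.
Proof.
move=> H; apply/lee_addgt0Pr => e e0.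
have [N HN] := H _ e0; rewrite limn_einf_lim; apply: lime_le; first exact: is_cvg_einfs.
near=> n; apply: (@le_trans _ _ (u (maxn n N))).
  by apply: ereal_inf_lbound; exists (maxn n N) => //=; rewrite leq_maxl.
by rewrite -EFinD; apply: HN; rewrite leq_maxr.
Unshelve. all: by end_near. Qed.

(** Fatou's lemma with both comparisons asked up to e, so that the sequence [Q] does not have to
    converge. *)
Lemma fatou_bound (Q : nat -> T -> R) (g : T -> R) (B : R) :
  measurable_fun setT g -> (forall x, 0 <= g x) ->
  (forall n, measurable_fun setT (Q n)) -> (forall n x, 0 <= Q n x) ->
  (forall x e, 0 < e -> exists N, forall n, (N <= n)%N -> g x - e <= Q n x) ->
  (forall e : R, 0 < e -> exists N, forall n, (N <= n)%N ->
    (\int[mu]_x (Q n x)%:E <= (B + e)%:E)%E) ->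
  (\int[mu]_x (g x)%:E <= B%:E)%E.
Proof.
move=> mg g0 mQ Q0 HgQ HQ.
apply: le_trans (limn_einf_leP HQ).
apply: le_trans (fatou mu measurableT _ _); last 2 first.
- by move=> n; exact/measurable_EFinP.
- by move=> n x _; rewrite lee_fin.
apply: ge0_le_integral => //.
- by move=> x _; rewrite lee_fin.
- exact/measurable_EFinP.
- under eq_fun do rewrite /limn_einf; apply: measurableT_comp => //.
  apply: measurable_fun_limn_esup => n; apply: measurableT_comp => //.
  exact/measurable_EFinP.
- move=> x _; apply: limn_einf_geP => e e0; have [N HN] := HgQ x e e0.
  by exists N => n Nn; rewrite lee_fin; exact: HN.
Qed.

End FatouBound.

(** * The Mehler kernel as an approximate identity, and completeness *)

Section Completeness.
Context {R : realType}.
Notation mu := (@lebesgue_measure R).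

Definition shifted_gauss (a x y : R) : R := expR (- (x - y) ^+ 2 / a).

Lemma shifted_gaussE (a x y : R) : 0 < a -> shifted_gauss a x y =
  expR (- a^-1 * x ^+ 2) * expR (- a^-1 * y ^+ 2 + 2 * x / a * y).
Proof. by move=> a0; rewrite -expRD; congr expR; field; rewrite gt_eqF. Qed.

Lemma itg_shifted_gauss (a x : R) : 0 < a ->
  itg mu (shifted_gauss a x) /\ \int[mu]_y shifted_gauss a x y = Num.sqrt (pi * a).
Proof.
move=> a0; have ia0 : 0 < a^-1 by rewrite invr_gt0.
have [ig E] := integral_gauss (2 * x / a) ia0.
have F y := shifted_gaussE x y a0.
split; first by apply: itg_eq (itgZ _ ig) => y; rewrite F.
under eq_Rintegral do rewrite F.
rewrite RintegralZl// E invrK mulrCA -expRD.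
have -> : - a^-1 * x ^+ 2 + (2 * x / a) ^+ 2 / (4 * a^-1) = 0.
  by field; rewrite gt_eqF.
by rewrite expR0 mulr1.
Qed.

Lemma sqi_shifted_gauss (a x : R) : 0 < a -> sqi mu (shifted_gauss a x).
Proof.
move=> a0; have a20 : 0 < a / 2 by rewrite divr_gt0.
split; first by have [/itg_meas] := itg_shifted_gauss x a0.
have [ig _] := itg_shifted_gauss x a20.
apply: itg_eq ig => y; rewrite /shifted_gauss expR_sqr; congr expR.
by field; rewrite gt_eqF.
Qed.

Lemma mehler_le (tau x y : R) : 0 < tau < 1 ->
  mehler tau x y <= (Num.sqrt (pi * tau))^-1 * shifted_gauss (4 * tau) x y.
Proof.
move=> /andP[t0 t1]; have pt : 0 < pi * tau by rewrite mulr_gt0// pi_gt0.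
have st : 0 < Num.sqrt (pi * tau) by rewrite sqrtr_gt0.
(* In the coordinates x + y and x - y the kernel is a Gaussian of width sqrt tau around the
   diagonal, times a factor at most 1. *)
have E : - malpha tau * (x ^+ 2 + y ^+ 2) + 2 * mbeta tau * x * y =
   - (tau / 4 * (x + y) ^+ 2) + - (x - y) ^+ 2 / (4 * tau).
  by rewrite /malpha /mbeta; field; rewrite gt_eqF.
have c0 : 0 <= mconst tau by rewrite ltW// mconst_gt0// t0.
have cS : mconst tau <= (Num.sqrt (pi * tau))^-1.
  rewrite /mconst invfM mulrA ler_piMl ?invr_ge0 ?(ltW st)//.
  by rewrite ler_pdivrMr// mul1r -[2]/(1 + 1) lerD2l ltW.
rewrite /mehler E expRD mulrA; apply: ler_wpM2r; first exact: expR_ge0.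
apply: le_trans cS; rewrite ler_piMr// expR_le1 oppr_le0 mulr_ge0 ?sqr_ge0//.
by rewrite divr_ge0// ltW.
Qed.

Lemma sqrt_pi_ge1 : 1 <= Num.sqrt (pi : R).
Proof.
have p2 := pi_ge2 R.
by rewrite -[leLHS]sqrtr1 ler_wsqrtr//; apply: le_trans p2; rewrite ler1n.
Qed.

Lemma sqrt_piM (tau : R) : Num.sqrt (pi * tau) = Num.sqrt pi * Num.sqrt tau.
Proof. by rewrite sqrtrM// pi_ge0. Qed.

Lemma mehler_mass_le2 (tau x : R) : 0 < tau < 1 -> \int[mu]_y mehler tau x y <= 2.
Proof.
move=> /[dup] t01 /andP[t0 t1].
have t40 : 0 < 4 * tau by rewrite mulr_gt0.
have [ig E] := itg_shifted_gauss x t40.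
apply: (@le_trans _ _ (\int[mu]_y ((Num.sqrt (pi * tau))^-1 * shifted_gauss (4 * tau) x y))).
  apply: Rint_le; [exact: itg_mehler|exact: itgZ|].
  by move=> y; exact: mehler_le.
rewrite RintegralZl// E.
have -> : pi * (4 * tau) = 2 ^+ 2 * (pi * tau) :> R by ring.
rewrite (sqrtrM _ (sqr_ge0 2)) sqrtr_sqr ger0_norm// mulrCA mulVf ?mulr1//.
by rewrite sqrtr_eq0 -ltNge mulr_gt0// pi_gt0.
Qed.

(** The kernel is not of mass one. Its mass is q exp(-u) with q^2 = (1 + tau)^2 / (1 + tau^2) and u
    = x^2 / (4 malpha), whence 1 <= q <= 1 + tau and 0 <= u <= tau x^2. *)
Lemma mehler_mass (tau x : R) : 0 < tau < 1 ->
  `|\int[mu]_y mehler tau x y - 1| <= tau * (1 + x ^+ 2).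
Proof.
move=> /[dup] t01 /andP[t0 t1].
have a0 := malpha_gt0 t01.
have tn0 : tau != 0 by rewrite gt_eqF.
have t2 : tau ^+ 2 + 1 != 0 by rewrite gt_eqF// ltr_wpDl ?sqr_ge0.
have [ig E] := integral_gauss (2 * mbeta tau * x) a0.
pose q := mconst tau * Num.sqrt (pi / malpha tau).
pose u := x ^+ 2 / (4 * malpha tau).
have -> : \int[mu]_y mehler tau x y = q * expR (- u).
  under eq_Rintegral do rewrite mehler_gauss.
  rewrite RintegralZl// E /q.
  have -> : expR (- u) = expR (- malpha tau * x ^+ 2) *
     expR ((2 * mbeta tau * x) ^+ 2 / (4 * malpha tau)).
    rewrite -expRD; congr expR; rewrite /u /malpha /mbeta; field.
    by rewrite tn0 addrC t2.
  by ring.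
have q2 : q ^+ 2 = (1 + tau) ^+ 2 / (tau ^+ 2 + 1).
  rewrite /q exprMn mconst2// sqr_sqrtr; last by rewrite divr_ge0 ?pi_ge0// ltW.
  rewrite /malpha.
  have : pi != 0 :> R by rewrite gt_eqF// pi_gt0.
  by move: (pi : R) => p pn0; field; rewrite ?tn0 ?pn0 ?t2 ?andbT// addrC.
have q0 : 0 <= q by rewrite mulr_ge0 ?sqrtr_ge0// ltW// mconst_gt0.
have q1 : 1 <= q.
  rewrite -(@ler_pXn2r _ 2) ?nnegrE// expr1n q2 ler_pdivlMr ?ltr_wpDl ?sqr_ge0//.
  by nra.
have qt : q <= 1 + tau.
  rewrite -(@ler_pXn2r _ 2) ?nnegrE ?addr_ge0 ?(ltW t0)// q2.
  rewrite ler_pdivrMr ?ltr_wpDl ?sqr_ge0// ler_peMr ?sqr_ge0//.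
  by rewrite lerDr sqr_ge0.
have u0 : 0 <= u by rewrite divr_ge0 ?sqr_ge0// mulr_ge0// ltW.
have ut : u <= tau * x ^+ 2.
  rewrite /u mulrC ler_wpM2r ?sqr_ge0// invf_ple ?posrE//; last by rewrite mulr_gt0.
  by rewrite /malpha mulrC divfK// lerDl ltW.
have e1 : expR (- u) <= 1 by rewrite expR_le1 oppr_le0.
have e2 := expR_ge1Dx (- u).
have e0 := expR_ge0 (- u).
rewrite ler_norml; apply/andP; split.
  have : expR (- u) <= q * expR (- u) by rewrite ler_peMl.
  by lra.
have : q * expR (- u) <= q by rewrite ler_piMr.
have : 0 <= tau * x ^+ 2 by rewrite mulr_ge0 ?sqr_ge0// ltW.
by lra.
Qed.

(** The Gaussian is split into two equal factors. One is at most 8 tau / eta^2, which beats the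
    normalization in 1 / sqrt tau; the other is replaced by a Gaussian independent of tau, which
    serves as a dominating function. *)
Lemma mehler_far (tau eta x y : R) : 0 < tau < 1 -> 0 < eta -> eta <= `|x - y| ->
  mehler tau x y <= Num.sqrt tau * (8 / eta ^+ 2) * shifted_gauss 8 x y.
Proof.
move=> /[dup] t01 /andP[t0 t1] eta0 xy.
apply: le_trans (mehler_le x y t01) _.
pose D := (x - y) ^+ 2.
have eD : eta ^+ 2 <= D.
  by rewrite /D -(real_normK (num_real (x - y))) ler_pXn2r ?nnegrE// ltW.
have e20 : 0 < eta ^+ 2 by rewrite exprn_gt0.
have D0 : 0 < D by exact: lt_le_trans eD.
have st0 : 0 < Num.sqrt tau by rewrite sqrtr_gt0.
have stau : Num.sqrt tau ^+ 2 = tau by rewrite sqr_sqrtr// ltW.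
have -> : shifted_gauss (4 * tau) x y = expR (- (D / (8 * tau))) * expR (- (D / (8 * tau))).
  by rewrite -expRD; congr expR; rewrite /D; field; rewrite gt_eqF.
have g8 : expR (- (D / (8 * tau))) <= shifted_gauss 8 x y.
  rewrite ler_expR -/D mulNr lerN2 ler_wpM2l// ?(ltW D0)// lef_pV2 ?posrE//.
    by rewrite ler_piMr// ltW.
  by rewrite mulr_gt0.
have gk : expR (- (D / (8 * tau))) <= 8 * tau / eta ^+ 2.
  have t80 : 0 < 8 * tau by rewrite mulr_gt0.
  have h : D / (8 * tau) <= expR (D / (8 * tau)).
    by apply: le_trans (expR_ge1Dx _); rewrite lerDr.
  apply: (@le_trans _ _ (8 * tau / D)).
    rewrite expRN -[leRHS]invrK invf_div lef_pV2//.
      by rewrite posrE expR_gt0.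
    by rewrite posrE divr_gt0.
  by rewrite ler_wpM2l ?(ltW t80)// lef_pV2 ?posrE.
have n1 : 0 <= (Num.sqrt (pi * tau))^-1 * expR (- (D / (8 * tau))).
  by rewrite mulr_ge0 ?expR_ge0// invr_ge0 sqrtr_ge0.
rewrite [leLHS]mulrA; apply: ler_pM n1 (expR_ge0 _) _ g8.
apply: (@le_trans _ _ ((Num.sqrt (pi * tau))^-1 * (8 * tau / eta ^+ 2))).
  by rewrite ler_wpM2l// invr_ge0 sqrtr_ge0.
rewrite sqrt_piM -{2}stau invfM.
have -> : (Num.sqrt pi)^-1 / Num.sqrt tau * (8 * Num.sqrt tau ^+ 2 / eta ^+ 2) =
   (Num.sqrt pi)^-1 * (Num.sqrt tau * (8 / eta ^+ 2)).
  have : (Num.sqrt pi)^-1 != 0 :> R by rewrite invr_eq0 gt_eqF// (lt_le_trans _ sqrt_pi_ge1).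
  move: (Num.sqrt pi)^-1 => p pn0; field.
  by rewrite !gt_eqF.
rewrite ler_piMl ?mulr_ge0 ?sqrtr_ge0 ?invr_ge0 ?sqr_ge0// invf_le1 ?sqrt_pi_ge1//.
by rewrite (lt_le_trans _ sqrt_pi_ge1).
Qed.

(** Near x, continuity of g; far from x, [mehler_far]; in addition, the defect of mass. Since g is
    merely square integrable, the far part is controlled by its integral against the fixed weight
    [shifted_gauss 8]. *)
Lemma mehler_approx (g : R -> R) (x e : R) : continuous g -> sqi mu g -> 0 < e ->
  exists2 del : R, 0 < del & forall tau, 0 < tau < 1 -> tau < del ->
    `|\int[mu]_y (mehler tau x y * g y) - g x| <= e.
Proof.
move=> cg sg e0; have e4 : 0 < e / 4 by rewrite divr_gt0.
have /cvgrPdist_lt/(_ _ e4)[/= eta eta0 Heta] := cg x.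
have g8 : 0 < 8 :> R by [].
have [ig8 _] := itg_shifted_gauss x g8.
have s8 := sqi_shifted_gauss x g8.
have sag : sqi mu (fun y => `|g y|).
  have [mg ig2] := sg; split; first exact: measurableT_comp.
  by apply: itg_eq ig2 => y; rewrite real_normK ?num_real.
have iG : itg mu (fun y => shifted_gauss 8 x y * `|g y| + `|g x| * shifted_gauss 8 x y).
  by apply: itgD; [exact: sqiM|exact: itgZ].
pose C := \int[mu]_y (shifted_gauss 8 x y * `|g y| + `|g x| * shifted_gauss 8 x y).
pose B := 8 / eta ^+ 2 * C + `|g x| * (1 + x ^+ 2).
have C0 : 0 <= C.
  by apply: Rint_ge0 => y; rewrite addr_ge0// mulr_ge0// expR_ge0.
have B0 : 0 <= B.
  by rewrite addr_ge0// !mulr_ge0// ?invr_ge0 ?sqr_ge0// addr_ge0 ?sqr_ge0.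
exists ((e / 4 / (B + 1)) ^+ 2); first by rewrite exprn_gt0// divr_gt0// ltr_wpDl.
move=> tau /[dup] t01 /andP[t0 t1] td.
have st : Num.sqrt tau * B <= e / 4.
  have : Num.sqrt tau <= e / 4 / (B + 1).
    rewrite -[leRHS]ger0_norm; last by rewrite divr_ge0 ?ltW// ltr_wpDl.
    by rewrite -sqrtr_sqr; apply: ler_wsqrtr; exact: ltW.
  rewrite ler_pdivlMr ?ltr_wpDl// => h; apply: le_trans h.
  by rewrite ler_wpM2l ?sqrtr_ge0// lerDl.
have tst : tau <= Num.sqrt tau.
  have h : Num.sqrt tau <= 1 by rewrite -[leRHS]sqrtr1 ler_sqrt// ltW.
  by rewrite -{1}[tau]sqr_sqrtr ?(ltW t0)// expr2 ler_piMl ?sqrtr_ge0.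
have [sK _] := mehler_sqr t01 x.
have iK := itg_mehler t01 x.
have iKg : itg mu (fun y => mehler tau x y * g y) by exact: sqiM.
have -> : \int[mu]_y (mehler tau x y * g y) - g x =
   \int[mu]_y (mehler tau x y * g y - g x * mehler tau x y) +
   g x * (\int[mu]_y mehler tau x y - 1).
  by rewrite RintegralB//; [rewrite RintegralZl//; ring|exact: itgZ].
apply: le_trans (ler_normD _ _) _.
have H2 : `|g x * (\int[mu]_y mehler tau x y - 1)| <= Num.sqrt tau * (`|g x| * (1 + x ^+ 2)).
  rewrite normrM mulrCA ler_wpM2l// (le_trans (mehler_mass x t01))//.
  by rewrite ler_wpM2r// addr_ge0 ?sqr_ge0.
have iD : itg mu (fun y => mehler tau x y * g y - g x * mehler tau x y).
  by apply: itgB => //; exact: itgZ.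
have H1 : `|\int[mu]_y (mehler tau x y * g y - g x * mehler tau x y)| <=
   e / 4 * 2 + Num.sqrt tau * (8 / eta ^+ 2) * C.
  apply: le_trans (le_normr_Rintegral _ iD) _ => //.
  apply: (@le_trans _ _ (\int[mu]_y (e / 4 * mehler tau x y + Num.sqrt tau * (8 / eta ^+ 2) *
     (shifted_gauss 8 x y * `|g y| + `|g x| * shifted_gauss 8 x y)))).
    apply: Rint_le.
    - exact: integrable_norm.
    - by apply: itgD; exact: itgZ.
    move=> y; have -> : mehler tau x y * g y - g x * mehler tau x y =
      mehler tau x y * (g y - g x) by ring.
    rewrite normrM (ger0_norm (mehler_ge0 t01 _ _)).
    have K0 := mehler_ge0 t01 x y.
    have [xy|xy] := ltP `|x - y| eta.
      rewrite -[leLHS]addr0 lerD//.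
        by rewrite mulrC ler_wpM2r// distrC ltW//; apply: Heta.
      by rewrite mulr_ge0 ?addr_ge0 ?mulr_ge0 ?sqrtr_ge0 ?invr_ge0 ?sqr_ge0 ?expR_ge0.
    rewrite -[leLHS]add0r lerD//; first by rewrite mulr_ge0// ltW.
    have -> : Num.sqrt tau * (8 / eta ^+ 2) *
      (shifted_gauss 8 x y * `|g y| + `|g x| * shifted_gauss 8 x y) =
      (Num.sqrt tau * (8 / eta ^+ 2) * shifted_gauss 8 x y) * (`|g y| + `|g x|) by ring.
    by apply: ler_pM => //; [exact: mehler_far|exact: ler_normB].
  rewrite (RintD2 _ _ iK iG) -/C; apply: lerD => //.
  by rewrite ler_wpM2l ?(ltW e4)//; exact: mehler_mass_le2.
apply: le_trans (lerD H1 H2) _; move: st; rewrite /B; set w := Num.sqrt tau => st.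
by nra.
Qed.

(** The smoothing of g by the kernel converges to g pointwise and is close to a finite sum whose
    coefficients are those of g, shrunk by powers of r. The square integral of that sum is at most
    A, and Fatou's lemma passes this to g. *)
Lemma hermite_completeness (g : R -> R) (A : R) : continuous g -> sqi mu g ->
  (forall N, \sum_(k < N) hermite_coef g k ^+ 2 <= A) ->
  \int[mu]_x (g x ^+ 2) <= A.
Proof.
move=> cg sg HA; have [mg ig2] := sg.
set G := \int[mu]_x (g x ^+ 2).
have G0 : 0 <= G by apply: Rint_ge0 => x; exact: sqr_ge0.
have A0 : 0 <= A by have := HA 0%N; rewrite big_ord0.
pose tau (j : nat) : R := j.+2%:R^-1.
have t01 j : 0 < tau j < 1.
  by rewrite invr_gt0 ltr0n/= invf_lt1 ?ltr0n// ltr1n.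
(* The geometric tail decays more slowly as r approaches 1, so the number of terms is chosen after
   [tau j]. *)
have exN j : exists N : nat, (mratio (tau j) ^+ 2) ^+ N / (1 - mratio (tau j) ^+ 2) <= j.+1%:R^-1.
  set r := mratio (tau j) ^+ 2.
  have r0 : 0 <= r by exact: sqr_ge0.
  have r1 : r < 1 by rewrite expr_lt1// ?mratio_ge0 ?mratio_lt1.
  have e0 : 0 < j.+1%:R^-1 * (1 - r) by rewrite mulr_gt0 ?subr_gt0// invr_gt0.
  have : (fun n => r ^+ n) @ \oo --> (0 : R) by apply: cvg_expr; rewrite ger0_norm.
  move/cvgrPdist_lt/(_ _ e0) => [N _ /(_ N (leqnn N))] /=.
  rewrite sub0r normrN => h; exists N; rewrite ler_pdivrMr ?subr_gt0//.
  by apply: le_trans (ltW h); exact: ler_norm.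
have [N HN] := choice exN.
pose P j := hsum (N j) (fun k => mratio (tau j) ^+ k * hermite_coef g k).
have intP j : \int[mu]_x (P j x ^+ 2) <= A.
  rewrite int_hsum_sqr; apply: le_trans (HA (N j)); apply: ler_sum => k _.
  rewrite exprMn ler_piMl ?sqr_ge0// exprn_ile1 ?exprn_ge0 ?mratio_ge0//.
  by rewrite exprn_ile1 ?mratio_ge0// ltW// mratio_lt1.
suff key e : 0 < e -> (\int[mu]_x (g x ^+ 2)%:E <= ((1 + e) * A)%:E)%E.
  rewrite -lee_fin -Rint_EFin//; apply/lee_addgt0Pr => e e0.
  have e1 : 0 < e / (A + 1) by rewrite divr_gt0// ltr_wpDl.
  apply: le_trans (key _ e1) _; rewrite -EFinD lee_fin mulrDl mul1r lerD2l.
  by rewrite mulrAC ler_pdivrMr ?ltr_wpDl// ler_wpM2l ?(ltW e0)// lerDl.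
move=> e0; have ei0 : 0 < e^-1 by rewrite invr_gt0.
pose c := (1 + e^-1) * G.
have c0 : 0 <= c by rewrite mulr_ge0// addr_ge0// ltW.
(* From t^2 <= (1 + e) p^2 + (1 + 1/e) (t - p)^2, with t the smoothing of g and p the finite sum.
   The loss e is removed at the end, the defect through j. *)
pose Q j x := (1 + e) * P j x ^+ 2 + c * mdefect (tau j) (N j) x.
have iQ j : itg mu (Q j) /\ \int[mu]_x Q j x <= (1 + e) * A + c * j.+1%:R^-1.
  have [id Ed] := mdefect_itg (t01 j) (N j).
  have [_ iP] := @sqi_hsum R (N j) (fun k => mratio (tau j) ^+ k * hermite_coef g k).
  split; first by apply: itgD; exact: itgZ.
  rewrite (RintD2 _ _ iP id) Ed; apply: lerD; rewrite ler_wpM2l//.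
  - by rewrite addr_ge0// ltW.
  - exact: intP.
have TQ j x : (\int[mu]_y (mehler (tau j) x y * g y)) ^+ 2 <= Q j x.
  have H := mehler_hsum_dist (t01 j) (N j) x sg.
  rewrite -/(P j x) -/G in H; move: H; rewrite /Q /c.
  set t := \int[mu]_y _; set p := P j x; set D := mdefect _ _ _ => H.
  apply: (@le_trans _ _ ((1 + e) * p ^+ 2 + (1 + e^-1) * (t - p) ^+ 2)); last first.
    rewrite lerD2l -mulrA ler_wpM2l//; first by rewrite addr_ge0// ltW.
    by rewrite mulrC.
  have E : (1 + e) * p ^+ 2 + (1 + e^-1) * (t - p) ^+ 2 - t ^+ 2 =
      e^-1 * (e * p - (t - p)) ^+ 2 by field; rewrite gt_eqF.
  by rewrite -subr_ge0 E mulr_ge0 ?sqr_ge0// ltW.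
apply: (@fatou_bound _ _ _ mu Q).
- exact: measurable_funX.
- by move=> x; exact: sqr_ge0.
- by move=> j; have [/itg_meas] := iQ j.
- by move=> j x; apply: le_trans (TQ j x); exact: sqr_ge0.
- move=> x ep ep0.
  have d0 : 0 < ep / (2 * `|g x| + 1) by rewrite divr_gt0// ltr_wpDl// mulr_ge0.
  have [del del0 Hdel] := mehler_approx x cg sg d0.
  exists (Num.bound del^-1) => j jN.
  apply: le_trans (TQ j x).
  have tj : tau j < del.
    rewrite /tau -[del]invrK ltf_pV2 ?posrE ?invr_gt0 ?ltr0n//.
    apply: lt_le_trans (archi_boundP _) _; first by rewrite invr_ge0 ltW.
    by rewrite ler_nat (leq_trans jN)// -addn2 leq_addr.
  have := Hdel _ (t01 j) tj; set t := \int[mu]_y _ => Ht.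
  have H1 : `|g x| * `|t - g x| <= ep / 2.
    apply: (@le_trans _ _ (`|g x| * (ep / (2 * `|g x| + 1)))); first by rewrite ler_wpM2l.
    rewrite mulrA ler_pdivrMr ?ltr_wpDl ?mulr_ge0//.
    have -> : ep / 2 * (2 * `|g x| + 1) = `|g x| * ep + ep / 2 by field.
    by rewrite lerDl divr_ge0// ltW.
  have H2 : - (g x * (t - g x)) <= `|g x| * `|t - g x|.
    by rewrite -normrM -normrN ler_norm.
  have := sqr_ge0 (t - g x); move: H1 H2; set u := `|g x| * _ => H1 H2 H3; nra.
- move=> ep ep0; exists (Num.bound (c / ep)) => j jN.
  have [ij Hj] := iQ j; rewrite Rint_EFin// lee_fin (le_trans Hj)// lerD2l.
  rewrite ler_pdivrMr ?ltr0n// mulrC -ler_pdivrMr//.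
  apply: le_trans (ltW (archi_boundP _)) _; first by rewrite divr_ge0// ltW.
  by rewrite ler_nat (leq_trans jN).
Qed.

End Completeness.

(** * Approximation in Sobolev-Hermite balls *)

Section SobolevApproximation.
Context {R : realType}.
Notation mu := (@lebesgue_measure R).

Lemma weighted_tail (w : nat -> R) (s t D : R) (p N : nat) : (0 < p)%N -> t <= s ->
  \sum_(j < N) j.+1%:R `^ s * w j ^+ 2 <= D ->
  \sum_(j < N) (p <= j.+1)%:R * (j.+1%:R `^ t * w j ^+ 2) <= p%:R `^ (t - s) * D.
Proof.
move=> p0 ts HD; apply: (@le_trans _ _ (p%:R `^ (t - s) *
   \sum_(j < N) j.+1%:R `^ s * w j ^+ 2)); last by rewrite ler_wpM2l// powR_ge0.
rewrite mulr_sumr; apply: ler_sum => j _.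
case: leqP => pj; last first.
  by rewrite mul0r mulr_ge0 ?powR_ge0// mulr_ge0 ?powR_ge0 ?sqr_ge0.
rewrite mul1r mulrA ler_wpM2r ?sqr_ge0//.
have -> : t = (t - s) + s by rewrite subrK.
rewrite powRD; last by rewrite pnatr_eq0 implybT.
rewrite addrK ler_wpM2r ?powR_ge0//.
rewrite -[t - s]opprB !powRN lef_pV2 ?posrE ?powR_gt0 ?ltr0n//.
by apply: ge0_ler_powR; rewrite ?subr_ge0 ?nnegrE ?ler_nat.
Qed.

(** The k-th coefficient of u' combines those of u at k - 1 and k + 1. Collecting by j, each
    coefficient occurs at most twice, with weight at most j + 1; the condition becomes p <= j + 1
    because index p of u' reaches down to p - 1. *)
Lemma derive_coef_bound (u du : R -> R) (p N : nat) :
  (forall x, is_derive x (1 : R) u (du x)) -> continuous du -> sqi mu u -> sqi mu du ->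
  \sum_(k < N) (p <= k)%:R * hermite_coef du k ^+ 2 <=
  2 * \sum_(j < N.+1) (p <= j.+1)%:R * (j.+1%:R * hermite_coef u j ^+ 2).
Proof.
move=> hu cdu su sdu; pose w := hermite_coef u.
pose F (j : nat) := (p <= j.+1)%:R * (j.+1%:R * w j ^+ 2).
have F0 j : 0 <= F j by rewrite /F mulr_ge0// mulr_ge0// sqr_ge0.
rewrite mulr_natl mulr2n.
have : \sum_(k < N) (p <= k)%:R * hermite_coef du k ^+ 2 <=
   \sum_(k < N) F k.+1 + \sum_(k < N) (0 < k)%N%:R * F k.-1.
  rewrite -big_split; apply: ler_sum => k _ /=.
  rewrite (hermite_coef_derive k hu cdu su sdu) -/(w _) -/(w _).
  rewrite /F; case: (leqP p k) => pk; last by rewrite mul0r addr_ge0//; repeat (rewrite mulr_ge0 ?sqr_ge0//).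
  rewrite (leq_trans pk (leqW (leqnSn _))) !mul1r.
  apply: (@le_trans _ _ (2 * hq k.+1 ^+ 2 * w k.+1 ^+ 2 + 2 * hq k ^+ 2 * w k.-1 ^+ 2)).
    by have := sqr_ge0 (hq k.+1 * w k.+1 + hq k * w k.-1); nra.
  rewrite !hq2; apply: lerD.
    have -> : 2 * (k.+1%:R / 2) = k.+1%:R :> R by field.
    by rewrite ler_wpM2r ?sqr_ge0// ler_nat.
  case: (k : nat) pk => [|i] pk; first by rewrite !mul0r mulr0 mul0r.
  by rewrite succnK pk !mul1r; have -> : 2 * (i.+1%:R / 2) = i.+1%:R :> R by field.
move/le_trans; apply; apply: lerD.
  by rewrite big_ord_recl; apply: ler_wpDl; [exact: (F0 0%N)|exact: lexx].
case: N => [|N]; first by rewrite big_ord0; apply: sumr_ge0 => j _; exact: F0.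
rewrite big_ord_recl/= mul0r add0r.
rewrite [leRHS]big_ord_recr/= [X in _ <= X + _]big_ord_recr/= -addrA.
apply: (@le_trans _ _ (\sum_(i < N) F i)); last first.
  by rewrite lerDl; apply: addr_ge0; [exact: (F0 N)|exact: (F0 N.+1)].
by apply: ler_sum => i _; rewrite mul1r.
Qed.

Variables (b db : R -> R).
Hypotheses (hb : forall x, is_derive x (1 : R) b (db x)) (cdb : continuous db).
Hypotheses (sb : sqi mu b) (sdb : sqi mu db).
Variables (s D : R) (q : nat).
Hypotheses (s1 : 1 <= s) (q0 : (0 < q)%N).
Let a := hermite_coef b.
(** The weights use j + 1 instead of j in order to control a_0 as well. The cut at q <= j + 1 keeps
    a_(q-1), which enters the q-th coefficient of the derivative. *)
Hypothesis HD : forall N, \sum_(j < N) j.+1%:R `^ s * ((q <= j.+1)%:R * a j) ^+ 2 <= D.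

Definition dhsum (N : nat) (c : nat -> R) (x : R) : R := \sum_(k < N) c k * dhermite k x.

Lemma is_derive_hsum N c x : is_derive x (1 : R) (hsum N c) (dhsum N c x).
Proof.
have -> : hsum N c = \sum_(k < N) (fun x => c k * hermite k x).
  by apply/funext => y; rewrite fct_sumE.
apply: is_derive_sum => k.
have hk : is_derive x (1 : R) (hermite k) (dhermite k x) by exact: is_derive_hermite.
by have := is_deriveZ (c k) hk.
Qed.

Lemma sqi_dhsum N c : sqi mu (dhsum N c).
Proof. by apply: sqi_sum => k; apply: sqiZ; exact: sqi_dhermite. Qed.

Lemma continuous_hsum N c : continuous (@hsum R N c).
Proof. by apply: is_derive_cont => x; exact: is_derive_hsum. Qed.

Lemma continuous_dhsum N c : continuous (dhsum N c).
Proof.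
elim: N => [|N IH] x.
  have -> : dhsum 0 c = cst 0 by apply/funext => y; rewrite /dhsum big_ord0.
  exact: cvg_cst.
have -> : dhsum N.+1 c = (fun y => dhsum N c y + c N * dhermite N y).
  by apply/funext => y; rewrite /dhsum big_ord_recr.
apply: cvgD; first exact: IH.
by apply: cvgM; [exact: cvg_cst|exact: continuous_dhermite].
Qed.

Definition hrem (x : R) : R := b x - hsum q a x.
Definition dhrem (x : R) : R := db x - dhsum q a x.

Lemma is_derive_hrem x : is_derive x (1 : R) hrem (dhrem x).
Proof.
have h := is_derive_hsum q a x.
exact: (is_deriveB (hb x) h).
Qed.

Lemma continuous_dhrem : continuous dhrem.
Proof. by move=> x; apply: cvgB; [exact: cdb|exact: continuous_dhsum]. Qed.

Lemma sqi_hrem : sqi mu hrem.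
Proof. by apply: sqiB => //; exact: sqi_hsum. Qed.

Lemma sqi_dhrem : sqi mu dhrem.
Proof. by apply: sqiB => //; exact: sqi_dhsum. Qed.

Lemma continuous_hrem : continuous hrem.
Proof. exact: is_derive_cont is_derive_hrem. Qed.

Lemma hermite_coef_hrem k : hermite_coef hrem k = (q <= k)%:R * a k.
Proof.
rewrite /hrem hermite_coefB//; last exact: sqi_hsum.
by rewrite hermite_coef_hsum; case: ltnP => _; rewrite ?mul1r ?mul0r ?subrr ?subr0.
Qed.

Lemma hrem_le k : hermite_coef hrem k ^+ 2 <= ((q <= k.+1)%:R * a k) ^+ 2.
Proof.
rewrite hermite_coef_hrem; case: (leqP q k) => qk; last by rewrite mul0r expr0n sqr_ge0.
by rewrite (leqW qk).
Qed.

Lemma weighted_sum (t : R) N : t <= s ->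
  \sum_(j < N) (q <= j.+1)%:R * (j.+1%:R `^ t * ((q <= j.+1)%:R * a j) ^+ 2) <=
  q%:R `^ (t - s) * D.
Proof. by move=> ts; exact: (weighted_tail (w := fun j => (q <= j.+1)%:R * a j)). Qed.

Lemma int_hrem : \int[mu]_x (hrem x ^+ 2) <= q%:R `^ (- s) * D.
Proof.
apply: hermite_completeness; [exact: continuous_hrem|exact: sqi_hrem|].
move=> N; rewrite -sub0r; apply: le_trans (@weighted_sum 0 N _); last exact: le_trans s1.
apply: ler_sum => k _; apply: le_trans (hrem_le k) _; rewrite powRr0 mul1r.
by case: leqP => _; rewrite ?mul1r// !mul0r expr0n.
Qed.

Lemma int_dhrem : \int[mu]_x (dhrem x ^+ 2) <= 2 * (q%:R `^ (1 - s) * D).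
Proof.
apply: hermite_completeness; [exact: continuous_dhrem|exact: sqi_dhrem|].
move=> N; have := @derive_coef_bound hrem dhrem 0 N is_derive_hrem continuous_dhrem
  sqi_hrem sqi_dhrem.
under eq_bigr do rewrite mul1r.
move/le_trans; apply; rewrite ler_wpM2l//.
apply: le_trans (@weighted_sum 1 N.+1 s1); apply: ler_sum => k _.
rewrite powRr1// mul1r; apply: (@le_trans _ _ (k.+1%:R * ((q <= k.+1)%:R * a k) ^+ 2)).
  by rewrite ler_wpM2l//; exact: hrem_le.
by case: leqP => _; rewrite ?mul1r// !mul0r expr0n mulr0.
Qed.

(** Here b' is projected, whereas [int_dhrem] differentiates the projection of b: these are the
    approximation errors of the second and of the first estimator. *)
Lemma int_proj_derive :
  \int[mu]_x ((db x - hsum q (hermite_coef db) x) ^+ 2) <= 2 * (q%:R `^ (1 - s) * D).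
Proof.
apply: hermite_completeness.
- by move=> x; apply: cvgB; [exact: cdb|exact: continuous_hsum].
- by apply: sqiB => //; exact: sqi_hsum.
move=> N; apply: (@le_trans _ _ (\sum_(k < N) (q <= k)%:R * hermite_coef db k ^+ 2)).
  apply: ler_sum => k _; rewrite hermite_coefB//; last exact: sqi_hsum.
  rewrite hermite_coef_hsum; case: ltnP => _; rewrite ?mul1r ?mul0r ?subr0//.
  by rewrite subrr expr0n.
apply: le_trans (derive_coef_bound q N hb cdb sb sdb) _; rewrite ler_wpM2l//.
apply: le_trans (@weighted_sum 1 N.+1 s1); apply: ler_sum => k _.
rewrite powRr1//; case: leqP => _; rewrite ?mul1r// !mul0r//.
Qed.

(** The one-dimensional Sobolev embedding: a square is at most the integral of the modulus of its
    derivative 2 r r', itself at most r^2 + r'^2. This bound serves off the good event. *)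
Lemma hrem_sup x : hrem x ^+ 2 <= q%:R `^ (- s) * D + 2 * (q%:R `^ (1 - s) * D).
Proof.
have hF y : is_derive y (1 : R) (fun t => hrem t * hrem t)
    (dhrem y * hrem y + hrem y * dhrem y).
  by apply: is_derive_mul; exact: is_derive_hrem.
have [sr sdr] := (sqi_hrem, sqi_dhrem).
have cF : continuous (fun y => dhrem y * hrem y + hrem y * dhrem y).
  by move=> y; apply: cvgD; apply: cvgM;
    solve [exact: continuous_dhrem|exact: continuous_hrem].
have iF : itg mu (fun y => dhrem y * hrem y + hrem y * dhrem y).
  by apply: itgD; exact: sqiM.
have := le_int_derive hF cF (sqiM sr sr) iF x.
rewrite ger0_norm -?expr2 ?sqr_ge0// => /le_trans; apply.
apply: le_trans (lerD int_hrem int_dhrem).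
have [_ ir] := sr; have [_ idr] := sdr.
rewrite -RintegralD//; apply: Rint_le.
- exact: integrable_norm.
- exact: itgD.
- move=> y; rewrite ler_norml; apply/andP; split.
    by have := sqr_ge0 (hrem y + dhrem y); nra.
  by have := sqr_ge0 (hrem y - dhrem y); nra.
Qed.

End SobolevApproximation.

(** * Quadratic forms and least squares *)

Section EuclideanSpace.
Context {R : realType}.

Definition dotv n (u v : 'cV[R]_n) : R := \sum_i u i ord0 * v i ord0.
Definition nsq n (v : 'cV[R]_n) : R := \sum_i v i ord0 ^+ 2.
Definition qf n (A : 'M[R]_n) (u : 'cV[R]_n) : R := dotv u (A *m u).

Lemma dotvE n (u v : 'cV[R]_n) : dotv u v = (u^T *m v) ord0 ord0.
Proof. by rewrite mxE; apply: eq_bigr => i _; rewrite mxE. Qed.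

Lemma nsqE n (v : 'cV[R]_n) : nsq v = dotv v v.
Proof. by apply: eq_bigr => i _; rewrite expr2. Qed.

Lemma nsq_ge0 n (v : 'cV[R]_n) : 0 <= nsq v.
Proof. by apply: sumr_ge0 => i _; exact: sqr_ge0. Qed.

Lemma nsq0 n : nsq (0 : 'cV[R]_n) = 0.
Proof. by rewrite /nsq big1// => i _; rewrite mxE expr0n. Qed.

Lemma nsq_eq0 n (v : 'cV[R]_n) : nsq v = 0 -> v = 0.
Proof.
move=> /eqP; rewrite psumr_eq0; last by move=> i _; exact: sqr_ge0.
move=> /allP H; apply/colP => i; rewrite mxE; apply/eqP.
by have := H i (mem_index_enum i); rewrite sqrf_eq0.
Qed.

Lemma dotvC n (u v : 'cV[R]_n) : dotv u v = dotv v u.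
Proof. by apply: eq_bigr => i _; rewrite mulrC. Qed.

Lemma dotvDl n (u v w : 'cV[R]_n) : dotv (u + v) w = dotv u w + dotv v w.
Proof. by rewrite -big_split; apply: eq_bigr => i _; rewrite mxE mulrDl. Qed.

Lemma dotvDr n (u v w : 'cV[R]_n) : dotv w (u + v) = dotv w u + dotv w v.
Proof. by rewrite dotvC dotvDl ![dotv _ w]dotvC. Qed.

Lemma dotvZl n (a : R) (u v : 'cV[R]_n) : dotv (a *: u) v = a * dotv u v.
Proof. by rewrite mulr_sumr; apply: eq_bigr => i _; rewrite mxE mulrA. Qed.

Lemma dotvZr n (a : R) (u v : 'cV[R]_n) : dotv u (a *: v) = a * dotv u v.
Proof. by rewrite dotvC dotvZl dotvC. Qed.

Lemma dotv_mulmx m n (A : 'M[R]_(m, n)) (u : 'cV[R]_m) (v : 'cV[R]_n) :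
  dotv u (A *m v) = dotv (A^T *m u) v.
Proof. by rewrite !dotvE trmx_mul trmxK mulmxA. Qed.

Lemma nsqZ n (a : R) (v : 'cV[R]_n) : nsq (a *: v) = a ^+ 2 * nsq v.
Proof. by rewrite !nsqE dotvZl dotvZr mulrA expr2. Qed.

Lemma nsqN n (v : 'cV[R]_n) : nsq (- v) = nsq v.
Proof. by rewrite -scaleN1r nsqZ sqrrN expr1n mul1r. Qed.

Lemma nsqD_le n (u v : 'cV[R]_n) : nsq (u + v) <= 2 * (nsq u + nsq v).
Proof.
rewrite /nsq -big_split mulr_sumr; apply: ler_sum => i _ /=; rewrite mxE.
by have := sqr_ge0 (u i ord0 - v i ord0); nra.
Qed.

Lemma dotv_CS n (u v : 'cV[R]_n) : dotv u v ^+ 2 <= nsq u * nsq v.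
Proof.
have H t : 0 <= nsq u * t ^+ 2 + 2 * t * dotv u v + nsq v.
  have := nsq_ge0 (t *: u + v); rewrite nsqE dotvDl !dotvDr !dotvZl !dotvZr -!nsqE.
  by rewrite (dotvC v u); lra.
have u0 := nsq_ge0 u.
have [uE|un] := eqVneq (nsq u) 0.
  rewrite uE mul0r (nsq_eq0 uE) /dotv big1 ?expr0n//.
  by move=> i _; rewrite mxE mul0r.
have up : 0 < nsq u by rewrite lt_neqAle eq_sym un.
have := H (- dotv u v / nsq u).
have -> : nsq u * (- dotv u v / nsq u) ^+ 2 + 2 * (- dotv u v / nsq u) * dotv u v + nsq v =
  nsq v - dotv u v ^+ 2 / nsq u by field.
by rewrite subr_ge0 ler_pdivrMr// mulrC.
Qed.

Lemma dotv_le n (u v : 'cV[R]_n) (c : R) : 0 <= c -> nsq v <= c ^+ 2 * nsq u ->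
  `|dotv u v| <= c * nsq u.
Proof.
move=> c0 H; rewrite -(@ler_pXn2r _ 2) ?nnegrE ?mulr_ge0 ?nsq_ge0//.
rewrite real_normK ?num_real// (le_trans (dotv_CS u v))//.
by rewrite exprMn mulrC expr2 mulrA ler_wpM2r ?nsq_ge0.
Qed.

Definition frob m n (A : 'M[R]_(m, n)) : R := \sum_i \sum_j A i j ^+ 2.

Lemma nsq_mulmx_frob m n (A : 'M[R]_(m, n)) (v : 'cV[R]_n) :
  nsq (A *m v) <= frob A * nsq v.
Proof.
rewrite /nsq /frob mulr_suml; apply: ler_sum => i _; rewrite -/(nsq v).
have := dotv_CS (row i A)^T v; rewrite /dotv /nsq.
have -> : \sum_i0 (row i A)^T i0 ord0 * v i0 ord0 = (A *m v) i ord0.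
  by rewrite mxE; apply: eq_bigr => j _; rewrite !mxE.
move/le_trans; apply; rewrite ler_wpM2r ?nsq_ge0//.
by apply: ler_sum => j _; rewrite !mxE.
Qed.

(** With w = A^T u, the square of |w|^2 = <u, A w> is at most |u|^2 |A w|^2, hence at most c |u|^2
    |w|^2; one factor |w|^2 is cancelled. *)
Lemma nsq_mulmx_tr m n (A : 'M[R]_(m, n)) (c : R) : 0 <= c ->
  (forall v : 'cV[R]_n, nsq (A *m v) <= c * nsq v) ->
  forall u : 'cV[R]_m, nsq (A^T *m u) <= c * nsq u.
Proof.
move=> c0 H u; set w := A^T *m u.
have [E|wn] := eqVneq (nsq w) 0; first by rewrite E mulr_ge0// nsq_ge0.
have wp : 0 < nsq w by rewrite lt_neqAle eq_sym wn nsq_ge0.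
rewrite -(ler_pM2r wp).
have E : nsq w = dotv u (A *m w) by rewrite nsqE dotv_mulmx.
rewrite -{1}expr2 {1}E (le_trans (dotv_CS _ _))// mulrAC mulrC.
by rewrite ler_wpM2r ?nsq_ge0.
Qed.

Lemma l2norm_nsq n (v : 'cV[R]_n) : l2norm v = Num.sqrt (nsq v).
Proof. by []. Qed.

Lemma l2norm_le n (v : 'cV[R]_n) (c : R) : 0 <= c ->
  (l2norm v <= c) = (nsq v <= c ^+ 2).
Proof.
move=> c0; rewrite l2norm_nsq -[X in _ <= X](ger0_norm c0) -sqrtr_sqr.
by rewrite ler_sqrt// sqr_ge0.
Qed.

Let opset m n (A : 'M[R]_(m, n)) : set R :=
  [set l2norm (A *m v) | v in [set v : 'cV[R]_n | l2norm v <= 1]].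

(** A [sup] is informative only on a bounded set; the Frobenius norm supplies the bound. *)
Let opset_ub m n (A : 'M[R]_(m, n)) : has_ubound (opset A).
Proof.
exists (Num.sqrt (frob A)) => _ [v /= v1 <-].
have f0 : 0 <= frob A by apply: sumr_ge0 => i _; apply: sumr_ge0 => j _; exact: sqr_ge0.
rewrite l2norm_le ?sqrtr_ge0// sqr_sqrtr// (le_trans (nsq_mulmx_frob _ _))//.
by rewrite ler_piMr// -(expr1n _ 2) -l2norm_le.
Qed.

Lemma opnorm_ge0 m n (A : 'M[R]_(m, n)) : 0 <= opnorm A.
Proof.
apply: (ub_le_sup (opset_ub A)); exists 0 => /=.
  by rewrite l2norm_nsq nsq0 sqrtr0.
by rewrite mulmx0 l2norm_nsq nsq0 sqrtr0.
Qed.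

Lemma nsq_mulmx_opnorm m n (A : 'M[R]_(m, n)) (v : 'cV[R]_n) :
  nsq (A *m v) <= opnorm A ^+ 2 * nsq v.
Proof.
have [E|vn] := eqVneq (nsq v) 0.
  by rewrite (nsq_eq0 E) mulmx0 !nsq0 mulr0.
have vp : 0 < nsq v by rewrite lt_neqAle eq_sym vn nsq_ge0.
set c := (Num.sqrt (nsq v))^-1.
have c2 : c ^+ 2 = (nsq v)^-1 by rewrite exprVn sqr_sqrtr// ltW.
have : l2norm (A *m (c *: v)) <= opnorm A.
  apply: (ub_le_sup (opset_ub A)); exists (c *: v) => //=.
  by rewrite l2norm_le// nsqZ c2 mulVf// expr1n.
rewrite l2norm_le ?opnorm_ge0// -scalemxAr nsqZ c2.
by rewrite mulrC ler_pdivrMr.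
Qed.

Lemma opnorm_le m n (A : 'M[R]_(m, n)) (c : R) : 0 <= c ->
  (forall v : 'cV[R]_n, nsq (A *m v) <= c ^+ 2 * nsq v) -> opnorm A <= c.
Proof.
move=> c0 H; apply: ge_sup.
  by exists (l2norm (A *m 0)); exists 0 => //=; rewrite l2norm_nsq nsq0 sqrtr0.
move=> _ [v /= v1 <-]; rewrite l2norm_le//; apply: le_trans (H v) _.
by rewrite ler_piMr ?sqr_ge0// -(expr1n _ 2) -l2norm_le.
Qed.

(** Stands for a lower bound on the smallest eigenvalue. For positive semidefinite symmetric
    matrices it is interchangeable with a bound on the norm of the inverse, without any spectral
    theorem. *)
Definition coercive n (lam : R) (A : 'M[R]_n) : Prop :=
  forall u : 'cV[R]_n, lam * nsq u <= qf A u.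

Lemma coercive_unitmx n (lam : R) (A : 'M[R]_n) : 0 < lam -> coercive lam A ->
  A \in unitmx.
Proof.
move=> l0 H; rewrite -unitmx_tr -row_free_unit; apply: inj_row_free => v vA.
have E : A *m v^T = 0 by rewrite -[A]trmxK -trmx_mul vA trmx0.
have := H v^T; rewrite /qf E /dotv big1 => [|i _]; last by rewrite [X in _ * X]mxE mulr0.
rewrite pmulr_rle0// => h; have /nsq_eq0 : nsq v^T = 0 by apply: le_anti; rewrite h nsq_ge0.
by move=> h2; rewrite -[v]trmxK h2 trmx0.
Qed.

Lemma coercive_solve n (lam : R) (A : 'M[R]_n) (z v : 'cV[R]_n) : 0 < lam ->
  coercive lam A -> A *m z = v -> lam ^+ 2 * nsq z <= nsq v /\ lam * qf A z <= nsq v.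
Proof.
move=> l0 H E; have H1 := H z.
have q0 : 0 <= qf A z by apply: le_trans H1; rewrite mulr_ge0 ?nsq_ge0// ltW.
have H2 : qf A z ^+ 2 <= nsq z * nsq v by rewrite /qf E; exact: dotv_CS.
have z0 := nsq_ge0 z; have v0 := nsq_ge0 v.
have [zE|zn] := eqVneq (nsq z) 0.
  have qE : qf A z = 0.
    by apply/eqP; rewrite -sqrf_eq0; apply/eqP/le_anti; rewrite sqr_ge0 andbT (le_trans H2)// zE mul0r.
  by rewrite qE zE !mulr0.
have zp : 0 < nsq z by rewrite lt_neqAle eq_sym zn.
have H3 : lam * qf A z <= nsq v.
  rewrite -(ler_pM2l zp); apply: le_trans H2.
  by rewrite mulrA expr2 ler_wpM2r// mulrC.
split => //; apply: le_trans H3.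
by rewrite expr2 -mulrA ler_wpM2l// ltW.
Qed.

Lemma coercive_opnorm n (lam : R) (A : 'M[R]_n) : 0 < lam -> coercive lam A ->
  opnorm (invmx A) <= lam^-1.
Proof.
move=> l0 H; apply: opnorm_le; first by rewrite invr_ge0 ltW.
move=> v; have uA := coercive_unitmx l0 H.
have [h _] := coercive_solve l0 H (mulKVmx uA v).
by rewrite exprVn mulrC ler_pdivlMr ?exprn_gt0// mulrC.
Qed.

(** Positivity of the form at u - B^-1 A^-1 u gives qf A u >= (2/B) |u|^2 - <u, A^-1 u> / B^2, and
    the last term is at most |u|^2 / B. *)
Lemma opnorm_coercive n (A : 'M[R]_n) (B : R) : A^T = A ->
  (forall u, 0 <= qf A u) -> A \in unitmx -> opnorm (invmx A) <= B -> 0 < B ->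
  coercive B^-1 A.
Proof.
move=> symA psd uA HB B0 u.
pose z := invmx A *m u.
have Az : A *m z = u by rewrite /z mulKVmx.
have nz : nsq z <= B ^+ 2 * nsq u.
  apply: le_trans (nsq_mulmx_opnorm _ _) _; rewrite ler_wpM2r ?nsq_ge0//.
  by rewrite ler_pXn2r ?nnegrE ?opnorm_ge0// ltW.
have zu : `|dotv u z| <= B * nsq u by apply: dotv_le => //; exact: ltW.
have uAz : dotv u (A *m z) = nsq u by rewrite Az nsqE.
have zAu : dotv z (A *m u) = nsq u by rewrite dotv_mulmx symA Az nsqE.
have zAz : qf A z = dotv u z by rewrite /qf Az dotvC.
have H t : 0 <= qf A u + 2 * t * nsq u + t ^+ 2 * dotv u z.
  have := psd (u + t *: z).
  rewrite {1}/qf mulmxDr -scalemxAr dotvDl !dotvDr !dotvZl !dotvZr uAz zAu -/(qf A u).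
  by rewrite -/(qf A z) zAz; lra.
have := H (- B^-1); rewrite sqrrN exprVn.
have h : dotv u z / B ^+ 2 <= nsq u / B.
  rewrite expr2 invfM mulrA ler_wpM2r ?invr_ge0 ?(ltW B0)// ler_pdivrMr// mulrC.
  by apply: le_trans zu; exact: ler_norm.
by move: h; rewrite [B^-1 * nsq u]mulrC; lra.
Qed.

Lemma qfE n (A : 'M[R]_n) (u : 'cV[R]_n) : qf A u = (u^T *m A *m u) ord0 ord0.
Proof. by rewrite /qf dotvE mulmxA. Qed.

Lemma qf_congr m n (A : 'M[R]_m) (S : 'M[R]_(m, n)) (u : 'cV[R]_n) :
  qf (S^T *m A *m S) u = qf A (S *m u).
Proof. by rewrite !qfE trmx_mul !mulmxA. Qed.

(** Induction by elimination of the first coordinate, which leaves the Schur complement C - a^-1 b^T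
    b. The matrix S replaces an inverse square root of A. *)
Lemma cholesky n (A : 'M[R]_n) : A^T = A ->
  (forall u : 'cV[R]_n, u != 0 -> 0 < qf A u) ->
  exists S : 'M[R]_n, S^T *m A *m S = 1%:M.
Proof.
elim: n A => [|n IH].
  by move=> A _ _; exists 1%:M; apply/matrixP => -[].
rewrite -add1n => A symA pdA.
pose a := ulsubmx A ord0 ord0; pose b := ursubmx A; pose C := drsubmx A.
have aE : ulsubmx A = a%:M by rewrite [ulsubmx A]mx11_scalar.
have bE : dlsubmx A = b^T by rewrite /b trmx_ursub symA.
have AE : A = block_mx a%:M b b^T C by rewrite -aE -bE submxK.
have a0 : 0 < a.
  have u0 : col_mx 1%:M 0 != 0 :> 'cV[R]_(1 + n).
    apply/eqP => /(congr1 usubmx); rewrite col_mxKu => /matrixP /(_ ord0 ord0).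
    rewrite !mxE /= => /eqP; by rewrite oner_eq0.
  have := pdA _ u0; rewrite qfE AE tr_col_mx trmx1 trmx0.
  by rewrite mul_row_block mul_row_col !mul0mx !mul1mx !mulmx0 !addr0 mulmx1 mxE eqxx.
have an : a != 0 by rewrite gt_eqF.
pose E : 'M[R]_(1 + n) := block_mx 1%:M (- a^-1 *: b) 0 1%:M.
pose C' := C - a^-1 *: (b^T *m b).
have EAE : E^T *m A *m E = block_mx a%:M 0 0 C'.
  rewrite AE /E tr_block_mx !trmx1 trmx0 linearZ /= !mulmx_block.
  rewrite !mul1mx !mul0mx !mulmx1 !mulmx0 !addr0 -!scalemxAl -!scalemxAr.
  have e1 : - a^-1 *: (a%:M *m b) + b = 0.
    by rewrite mul_scalar_mx scalerA mulNr mulVf// scaleN1r addNr.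
  have e2 : - a^-1 *: (b^T *m a%:M) + b^T = 0.
    by rewrite mul_mx_scalar scalerA mulNr mulVf// scaleN1r addNr.
  by rewrite e1 e2 mul0mx scaler0 add0r addrC scaleNr.
have symC' : C'^T = C'.
  have symC : C^T = C by rewrite /C trmx_drsub symA.
  by rewrite /C' linearB /= linearZ /= trmx_mul trmxK symC.
have [S' HS'] : exists S' : 'M[R]_n, S'^T *m C' *m S' = 1%:M.
  apply: IH => // w w0.
  have u0 : E *m col_mx 0 w != 0.
    apply: contra_neq w0 => /(congr1 dsubmx).
    by rewrite /E mul_block_col mul0mx mulmx0 mul1mx !add0r col_mxKd linear0.
  have := pdA _ u0; rewrite -qf_congr EAE qfE tr_col_mx trmx0.
  by rewrite mul_row_block mul_row_col !mul0mx !mulmx0 !add0r qfE.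
have sa : Num.sqrt a != 0 by rewrite gt_eqF// sqrtr_gt0.
exists (E *m block_mx ((Num.sqrt a)^-1)%:M 0 0 S').
rewrite trmx_mul -!mulmxA [_ *m (E *m _)]mulmxA [E^T *m _]mulmxA [E^T *m (A *m E)]mulmxA EAE.
rewrite tr_block_mx !trmx0 tr_scalar_mx !mulmx_block.
rewrite !mul0mx !mulmx0 !addr0 !add0r ?mul0mx ?mulmx0.
rewrite [S'^T *m (C' *m S')]mulmxA HS' -!scalar_mxM.
have -> : (Num.sqrt a)^-1 * (a * (Num.sqrt a)^-1) = 1.
  by rewrite -{2}[a]sqr_sqrtr ?(ltW a0)//; field.
by rewrite -scalar_mx_block.
Qed.

(** The comparison is relative to A, so it does not deteriorate with the conditioning of A. A
    Frobenius norm with square 1/4 bounds the operator norm by 1/2. *)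
Lemma qf_close n (A M S : 'M[R]_n) : S^T *m A *m S = 1%:M ->
  frob (S^T *m M *m S - 1%:M) <= 4^-1 ->
  forall u, 2^-1 * qf A u <= qf M u <= 3 / 2 * qf A u.
Proof.
move=> HS Hf u.
have uS : S \in unitmx by have /mulmx1_unit[] := HS.
pose w := invmx S *m u.
have uE : u = S *m w by rewrite mulKVmx.
have nw : qf A u = nsq w by rewrite uE -qf_congr HS /qf mul1mx nsqE.
have -> : qf M u = nsq w + dotv w ((S^T *m M *m S - 1%:M) *m w).
  by rewrite uE -qf_congr mulmxBl mul1mx dotvDr -scaleN1r dotvZr -nsqE /qf; ring.
rewrite nw.
have : `|dotv w ((S^T *m M *m S - 1%:M) *m w)| <= 2^-1 * nsq w.
  apply: dotv_le; first by rewrite invr_ge0.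
  apply: le_trans (nsq_mulmx_frob _ _) _; rewrite ler_wpM2r ?nsq_ge0//.
  by apply: le_trans Hf _; rewrite exprVn lef_pV2 ?posrE ?exprn_gt0//; lra.
by rewrite ler_norml => /andP[h1 h2]; apply/andP; split; lra.
Qed.

(** Normalization gives S S^T = A^-1, so the left-hand norm is <v, A^-1 v>. It bounds the normalized
    features uniformly. *)
Lemma nsq_cholesky n (A S : 'M[R]_n) (lam : R) (v : 'cV[R]_n) : 0 < lam ->
  coercive lam A -> S^T *m A *m S = 1%:M -> lam * nsq (S^T *m v) <= nsq v.
Proof.
move=> l0 H HS; pose w := S^T *m v.
have h1 : lam * nsq (S *m w) <= nsq w.
  by apply: le_trans (H _) _; rewrite -qf_congr HS /qf mul1mx nsqE.
have h2 : nsq w = dotv (S *m w) v by rewrite dotvC dotv_mulmx nsqE.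
have h3 := dotv_CS (S *m w) v; rewrite -h2 in h3.
rewrite -/w; have [wE|wn] := eqVneq (nsq w) 0.
  by rewrite wE mulr0 nsq_ge0.
have wp : 0 < nsq w by rewrite lt_neqAle eq_sym wn nsq_ge0.
rewrite -(ler_pM2r wp).
have : lam * nsq w ^+ 2 <= nsq w * nsq v.
  apply: le_trans (_ : _ <= lam * (nsq (S *m w) * nsq v)) _.
    by rewrite ler_wpM2l// ltW.
  by rewrite mulrA ler_wpM2r// nsq_ge0.
by rewrite expr2; lra.
Qed.

End EuclideanSpace.

(** * The norm of the differentiation matrix *)

Section DeltaMatrix.
Context {R : realType}.

Lemma sqrt_div2 j : Num.sqrt j%:R / Num.sqrt 2 = hq j :> R.
Proof. by rewrite /hq sqrtrM// sqrtrV. Qed.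

Lemma sum_shift_up m (w : 'I_m.+1 -> R) (j : 'I_m) (c : R) :
  \sum_(k < m.+1) (if k.+1 == j :> nat then c else 0) * w k =
  if (j : nat) is i.+1 then c * w (inord i) else 0.
Proof.
case: j => -[|i] /= im.
  by rewrite big1// => k _; rewrite mul0r.
rewrite (bigD1 (inord i))//= inordK ?eqxx; last by lia.
rewrite big1 ?addr0// => k ki; case: eqP => [[ki']|_]; last by rewrite mul0r.
by case/eqP: ki; apply: val_inj; rewrite /= inordK //; lia.
Qed.

Lemma sum_shift_down m (w : 'I_m.+1 -> R) (j : 'I_m) (c : R) :
  \sum_(k < m.+1) (if k == j.+1 :> nat then c else 0) * w k = c * w (inord j.+1).
Proof.
rewrite (bigD1 (inord j.+1))//= inordK ?eqxx; last by rewrite ltnS.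
rewrite big1 ?addr0// => k ki; case: eqP => [ki'|_]; last by rewrite mul0r.
by case/eqP: ki; apply: val_inj; rewrite /= inordK // ltnS.
Qed.

Lemma Delta_sum m (w : 'I_m.+1 -> R) (j : 'I_m) :
  \sum_(k < m.+1) Delta m j k * w k =
  hq j * w (inord j.-1) - hq j.+1 * w (inord j.+1).
Proof.
transitivity (\sum_(k < m.+1) (if k.+1 == j :> nat then hq j else 0) * w k +
    \sum_(k < m.+1) (if k == j.+1 :> nat then - hq j.+1 else 0) * w k).
  rewrite -big_split; apply: eq_bigr => k _ /=; rewrite mxE !sqrt_div2 -mulrDl.
  congr (_ * _); case: eqP => [kj|_]; last by rewrite add0r.
  by case: eqP => [kj'|_]; [rewrite -kj in kj'; lia|rewrite addr0].
rewrite sum_shift_up sum_shift_down mulNr; congr (_ - _).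
by case: (j : nat) => [|i] //=; rewrite hq0 mul0r.
Qed.

(** Each row has at most two nonzero entries, and each coordinate of v is met at most twice, with
    weight at most m + 1. *)
Lemma nsq_Delta m (v : 'cV[R]_m.+1) : nsq (Delta m *m v) <= 2 * m.+1%:R * nsq v.
Proof.
pose w (k : nat) : R := if (k < m.+1)%N then v (inord k) ord0 else 0.
have nv : nsq v = \sum_(k < m.+1) w k ^+ 2.
  by apply: eq_bigr => k _; rewrite /w ltn_ord inord_val.
have E (j : 'I_m) : (Delta m *m v) j ord0 = hq j * w j.-1 - hq j.+1 * w j.+1.
  rewrite mxE Delta_sum /w !ltnS (leq_trans (leq_pred j) (ltnW (ltn_ord j))).
  by rewrite (ltn_ord j).
have mm : 0 <= m.+1%:R :> R by [].
apply: (@le_trans _ _ (\sum_(j < m) (m.+1%:R * w j.-1 ^+ 2 *+ (0 < j)%N + m.+1%:R * w j.+1 ^+ 2))).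
  apply: ler_sum => j _; rewrite E.
  apply: (@le_trans _ _ (2 * hq j ^+ 2 * w j.-1 ^+ 2 + 2 * hq j.+1 ^+ 2 * w j.+1 ^+ 2)).
    by have := sqr_ge0 (hq j * w j.-1 + hq j.+1 * w j.+1); nra.
  rewrite !hq2; apply: lerD; last first.
    have -> : 2 * (j.+1%:R / 2) = j.+1%:R :> R by field.
    by rewrite ler_wpM2r ?sqr_ge0// ler_nat ltnW// ltnS.
  have -> : 2 * ((j : nat)%:R / 2) = (j : nat)%:R :> R by field.
  have := ltn_ord j; case: (j : nat) => [|i] im; first by rewrite mul0r mulr0n.
  by rewrite mulr1n ler_wpM2r ?sqr_ge0// ler_nat ltnW// ltnW.
rewrite big_split/= -mulrA mulr_natl mulr2n nv mulr_sumr; apply: lerD.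
  case: m {v nv E} w mm => [|m] w mm.
    by rewrite big_ord0; apply: sumr_ge0 => k _; rewrite mulr_ge0// sqr_ge0.
  rewrite big_ord_recl/= mulr0n add0r big_ord_recr/= big_ord_recr/= -addrA.
  apply: ler_wpDr; first by rewrite addr_ge0// mulr_ge0// sqr_ge0.
  by apply: ler_sum => k _; rewrite mulr1n.
rewrite [leRHS]big_ord_recl; apply: ler_wpDl; [by rewrite mulr_ge0// sqr_ge0|exact: lexx].
Qed.

Lemma nsq_Delta_tr m (v : 'cV[R]_m) : nsq ((Delta m)^T *m v) <= 2 * m.+1%:R * nsq v.
Proof. by apply: nsq_mulmx_tr; [rewrite mulr_ge0|exact: nsq_Delta]. Qed.

End DeltaMatrix.

(** * The empirical Gram matrix and least squares for a fixed design *)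

Section Design.
Context {R : realType}.
Variables (n : nat) (x : 'I_n -> R).
Hypothesis n0 : (0 < n)%N.

Let nr0 : 0 < n%:R :> R. Proof. by rewrite ltr0n. Qed.

Lemma qf_Psi_hat m (u : 'cV[R]_m) : qf (Psi_hat x m) u = n%:R^-1 * nsq (Phi_hat x m *m u).
Proof.
rewrite /qf /Psi_hat -scalemxAl dotvZr; congr (_ * _).
by rewrite -mulmxA dotv_mulmx trmxK nsqE.
Qed.

Lemma Psi_hat_psd m (u : 'cV[R]_m) : 0 <= qf (Psi_hat x m) u.
Proof. by rewrite qf_Psi_hat mulr_ge0 ?nsq_ge0// invr_ge0 ltW. Qed.

Lemma Psi_hat_sym m : (Psi_hat x m)^T = Psi_hat x m.
Proof. by rewrite /Psi_hat linearZ /= trmx_mul trmxK. Qed.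

(** Extension by zeros, which exhibits [Psi_hat q] as a leading block of [Psi_hat N]: one event in
    dimension m + 1 thus controls both dimensions m and m + 1. *)
Definition padv q N (u : 'cV[R]_q) : 'cV[R]_N :=
  \col_i (if insub (i : nat) is Some j then u j ord0 else 0).

Lemma sum_pad q N (u : 'cV[R]_q) (F : nat -> R -> R) : (q <= N)%N ->
  (forall i, F i 0 = 0) ->
  \sum_(i < N) F i (padv N u i ord0) = \sum_(i < q) F i (u i ord0).
Proof.
move=> qN F0.
pose G (i : nat) := F i (if insub i is Some j then u j ord0 else 0).
transitivity (\sum_(i < N) G i); first by apply: eq_bigr => i _; rewrite mxE.
transitivity (\sum_(i < q) G i); last first.
  by apply: eq_bigr => i _; rewrite /G valK.
rewrite (big_ord_widen N G qN) [RHS]big_mkcond; apply: eq_bigr => i _.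
by case: ltnP => // qi; rewrite /G insubF ?F0// ltnNge qi.
Qed.

Lemma Phi_hat_pad q N (u : 'cV[R]_q) : (q <= N)%N ->
  Phi_hat x N *m padv N u = Phi_hat x q *m u.
Proof.
move=> qN; apply/colP => i; rewrite !mxE.
under eq_bigr do rewrite mxE; under [RHS]eq_bigr do rewrite mxE.
by rewrite (sum_pad u (F := fun j v => hermite j (x i) * v))// => j; rewrite mulr0.
Qed.

Lemma nsq_pad q N (u : 'cV[R]_q) : (q <= N)%N -> nsq (padv N u) = nsq u.
Proof.
by move=> qN; apply: (sum_pad u (F := fun _ v => v ^+ 2)) => // j; rewrite expr0n.
Qed.

Lemma coercive_pad q N (lam : R) : (q <= N)%N -> coercive lam (Psi_hat x N) ->
  coercive lam (Psi_hat x q).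
Proof.
move=> qN H u; have := H (padv N u).
by rewrite !qf_Psi_hat Phi_hat_pad// nsq_pad.
Qed.

Lemma Psi_hat_ub_pad q N (Lam : R) : (q <= N)%N ->
  (forall u, qf (Psi_hat x N) u <= Lam * nsq u) ->
  forall u : 'cV[R]_q, qf (Psi_hat x q) u <= Lam * nsq u.
Proof.
move=> qN H u; have := H (padv N u).
by rewrite !qf_Psi_hat Phi_hat_pad// nsq_pad.
Qed.

Lemma Psi_hat_ub_trivial N (L : R) : (forall t : R, \sum_(j < N) hermite j t ^+ 2 <= L) ->
  forall u : 'cV[R]_N, qf (Psi_hat x N) u <= L * nsq u.
Proof.
move=> HL u; rewrite qf_Psi_hat mulrC ler_pdivrMr//.
apply: le_trans (nsq_mulmx_frob _ _) _; rewrite mulrAC ler_wpM2r ?nsq_ge0//.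
rewrite /frob mulr_natr -[X in L *+ X](card_ord n) -sumr_const.
apply: ler_sum => i _; apply: le_trans (HL (x i)).
by apply: ler_sum => j _; rewrite mxE.
Qed.

Section LeastSquares.
Variables (p q : nat) (W : 'M[R]_(p, q)) (lam c : R).
Hypotheses (l0 : 0 < lam) (Hlam : coercive lam (Psi_hat x q)).
Hypotheses (c0 : 0 <= c) (HW : forall w : 'cV[R]_q, nsq (W *m w) <= c * nsq w).

Definition lse_op : 'M[R]_(q, n) := n%:R^-1 *: (invmx (Psi_hat x q) *m (Phi_hat x q)^T).
Definition fit_op : 'M[R]_n := Phi_hat x p *m W *m lse_op.

Lemma lse_exact (u : 'cV[R]_q) : lse_op *m (Phi_hat x q *m u) = u.
Proof.
rewrite /lse_op -scalemxAl -mulmxA [(Phi_hat x q)^T *m _]mulmxA scalemxAr scalemxAl.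
by rewrite -/(Psi_hat x q) mulKmx// (coercive_unitmx l0 Hlam).
Qed.

(** By the normal equations the fitted values are a projection of z, so their norm is at most that
    of z; coercivity converts it into a bound on the coefficients. *)
Lemma nsq_lse (z : 'cV[R]_n) : lam * nsq (lse_op *m z) <= n%:R^-1 * nsq z.
Proof.
set w := lse_op *m z; apply: le_trans (Hlam w) _.
have uP := coercive_unitmx l0 Hlam.
have E : Psi_hat x q *m w = n%:R^-1 *: ((Phi_hat x q)^T *m z).
  by rewrite /w /lse_op -[X in _ *m X]scalemxAl -scalemxAr -mulmxA mulKVmx.
have E1 : qf (Psi_hat x q) w = n%:R^-1 * dotv (Phi_hat x q *m w) z.
  by rewrite /qf E dotvZr; congr (_ * _); rewrite dotv_mulmx trmxK.
have E2 := qf_Psi_hat w.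
have H : 2 * dotv (Phi_hat x q *m w) z <= nsq (Phi_hat x q *m w) + nsq z.
  have := nsq_ge0 (Phi_hat x q *m w - z).
  by rewrite nsqE -scaleN1r dotvDl !dotvDr !dotvZl !dotvZr -!nsqE (dotvC z); lra.
have : 2 * qf (Psi_hat x q) w <= qf (Psi_hat x q) w + n%:R^-1 * nsq z.
  by rewrite {1}E1 E2 mulrCA -mulrDr ler_wpM2l// invr_ge0 ltW.
lra.
Qed.

Lemma nsq_fit (Lam : R) (z : 'cV[R]_n) : 0 <= Lam ->
  (forall u, qf (Psi_hat x p) u <= Lam * nsq u) ->
  n%:R^-1 * nsq (fit_op *m z) <= Lam * (c / lam) * (n%:R^-1 * nsq z).
Proof.
move=> L0 HL; rewrite /fit_op -!mulmxA -qf_Psi_hat; apply: le_trans (HL _) _.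
rewrite -[leRHS]mulrA ler_wpM2l//; apply: le_trans (HW _) _.
rewrite -[leRHS]mulrA ler_wpM2l// mulrC ler_pdivlMr// mulrC.
exact: nsq_lse.
Qed.

(** Row i is n^-1 Phi Psi_hat^-1 v with v = W^T phi(x_i), so its squared norm is n^-1 <v, Psi_hat^-1
    v>. Times sigma^2, this is the variance of the i-th fitted value. *)
Lemma fit_op_row_sqr (L : R) (i : 'I_n) : \sum_(j < p) hermite j (x i) ^+ 2 <= L ->
  \sum_k fit_op i k ^+ 2 <= n%:R^-1 * (c * L / lam).
Proof.
move=> HL; pose v : 'cV[R]_q := W^T *m (row i (Phi_hat x p))^T.
have nv : nsq v <= c * L.
  apply: le_trans (nsq_mulmx_tr c0 HW _) _; rewrite ler_wpM2l//.
  by apply: le_trans HL; apply: ler_sum => j _; rewrite !mxE.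
have uP := coercive_unitmx l0 Hlam.
pose z := invmx (Psi_hat x q) *m v.
have [_ Hz] := coercive_solve l0 Hlam (mulKVmx uP v).
have E : \sum_k fit_op i k ^+ 2 = nsq (n%:R^-1 *: (Phi_hat x q *m z)).
  rewrite /nsq; apply: eq_bigr => k _; congr (_ ^+ 2).
  have -> : fit_op i k = (row i fit_op)^T k ord0 by rewrite !mxE.
  congr (fun A : 'cV[R]_n => A k ord0).
  rewrite /fit_op /lse_op row_mul row_mul -scalemxAr linearZ /= !trmx_mul trmxK.
  by rewrite trmx_inv Psi_hat_sym !mulmxA.
rewrite E nsqZ expr2 -mulrA -qf_Psi_hat ler_wpM2l ?invr_ge0 ?(ltW nr0)//.
rewrite ler_pdivlMr// mulrC; apply: le_trans Hz _; exact: nv.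
Qed.

End LeastSquares.
End Design.

(** * Independence *)

Section WeightedImage.
Context d d' (T : measurableType d) (T' : measurableType d') (R : realType).
Variables (mu : {measure set T -> \bar R}) (nu : {measure set T' -> \bar R}).
Variables (phi : T -> T') (Z : T -> R).
Hypotheses (mphi : measurable_fun setT phi) (mZ : measurable_fun setT Z).
Hypothesis Z0 : forall w, 0 <= Z w.
Hypothesis nuE : forall A, measurable A ->
  nu A = (\int[mu]_w (\1_A (phi w) * Z w)%:E)%E.

Import HBNNSimple.

(** [nu] is the image under [phi] of [mu] weighted by [Z]. With [phi] a random variable and [Z] the
    other factors of a product this yields factorization under independence; with [phi] the identity
    and [Z] a density it yields the transfer formula. *)
Lemma integral_weighted_image (g : T' -> \bar R) : measurable_fun setT g ->
  (forall y, (0 <= g y)%E) ->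
  (\int[nu]_y g y = \int[mu]_w (g (phi w) * (Z w)%:E))%E.
Proof.
move=> mg g0; pose h := nnsfun_approx measurableT mg.
have mZ' : measurable_fun setT (EFin \o Z) by exact/measurable_EFinP.
have -> : (\int[nu]_y g y = lim ((\int[nu]_y (EFin \o h n) y) @[n --> \oo]))%E.
  have gE y : g y = lim ((EFin \o h n) y @[n --> \oo]).
    by apply/esym/cvg_lim => //; exact: cvg_nnsfun_approx.
  under eq_integral => y _ do rewrite gE.
  apply: monotone_convergence => //.
  - by move=> n; apply/measurable_EFinP; exact/measurable_funP.
  - by move=> n x _ /=; rewrite lee_fin.
  - by move=> x _ a b ab; rewrite lee_fin; exact/lefP/nd_nnsfun_approx.
have -> : (\int[mu]_w (g (phi w) * (Z w)%:E) =
    lim ((\int[mu]_w ((h n (phi w))%:E * (Z w)%:E)) @[n --> \oo]))%E.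
  have gE w : (g (phi w) * (Z w)%:E = lim (((h n (phi w))%:E * (Z w)%:E) @[n --> \oo]))%E.
    apply/esym/cvg_lim => //; apply: cvgeZr => //.
    exact: cvg_nnsfun_approx.
  under eq_integral => w _ do rewrite gE.
  apply: monotone_convergence => //.
  - move=> n; apply: emeasurable_funM => //.
    by apply/measurable_EFinP; apply: measurableT_comp => //; exact/measurable_funP.
  - by move=> n x _ /=; rewrite mule_ge0// lee_fin.
  - move=> x _ a b ab; rewrite lee_wpmul2r ?lee_fin//.
    exact/lefP/nd_nnsfun_approx.
suff key n : (\int[nu]_y (EFin \o h n) y = \int[mu]_w ((h n (phi w))%:E * (Z w)%:E))%E.
  by under eq_fun do rewrite key.
have mr r : measurable (h n @^-1` [set r]) by [].
have mI r : measurable_fun setT (fun w => \1_(h n @^-1` [set r]) (phi w) : R).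
  exact: measurableT_comp (measurable_indic (mr r)) mphi.
have r0 r y : (0 <= (r * \1_(h n @^-1` [set r]) y)%:E)%E.
  by rewrite EFinM nnfun_muleindic_ge0.
transitivity (\int[nu]_y (\sum_(r \in range (h n))
   (r * \1_(h n @^-1` [set r]) y)%:E))%E.
  by apply: eq_integral => t _; rewrite /= fimfunE -fsumEFin.
rewrite ge0_integral_fsum//; last first.
  by move=> r; apply/measurable_EFinP; apply: measurable_funM.
transitivity (\int[mu]_w (\sum_(r \in range (h n))
    ((r * \1_(h n @^-1` [set r]) (phi w))%:E * (Z w)%:E)))%E; last first.
  apply: eq_integral => w _.
  rewrite -ge0_mule_fsuml => [|r]; last exact: r0.
  by rewrite fsumEFin // -(fimfunE _ (phi w)).
rewrite ge0_integral_fsum//; last 2 first.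
- move=> r; apply: emeasurable_funM => //.
  by apply/measurable_EFinP; apply: measurable_funM.
- by move=> r w _; rewrite mule_ge0 ?r0 ?lee_fin//.
apply: eq_fsbigr => r rhn.
under eq_integral do rewrite EFinM.
rewrite integralZl_indic_nnsfun // integral_indic// setIT nuE//.
under [RHS]eq_integral do rewrite EFinM -muleA.
rewrite ge0_integralZl//.
- by apply: emeasurable_funM => //; exact/measurable_EFinP.
- by move=> w _; rewrite mule_ge0 ?lee_fin.
- by move: rhn; rewrite inE => -[t _ <-]; rewrite lee_fin.
Qed.

End WeightedImage.

Section Independence.
Context d (T : measurableType d) (R : realType) (P : probability T R).
Implicit Types (U V Z : T -> R).

Lemma integral_indic_weight V (A : set R) : measurable_fun setT V -> measurable A ->
  (\int[P]_w (\1_A (V w))%:E)%E = P (V @^-1` A).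
Proof.
move=> mV mA; have mVA : measurable (V @^-1` A).
  by rewrite -[X in measurable X]setTI; exact: mV.
by rewrite -[X in P X]setIT -integral_indic//.
Qed.

Lemma factor_integral (phi : T -> R) Z (c : R) : measurable_fun setT phi ->
  measurable_fun setT Z -> (forall w, 0 <= Z w) -> 0 <= c ->
  (forall A, measurable A ->
    (\int[P]_w (\1_A (phi w) * Z w)%:E)%E = (c%:E * P (phi @^-1` A))%E) ->
  forall g : R -> R, measurable_fun setT g -> (forall y, 0 <= g y) ->
  (\int[P]_w (g (phi w) * Z w)%:E = c%:E * \int[P]_w (g (phi w))%:E)%E.
Proof.
move=> mphi mZ Z0 c0 H g mg g0.
pose X : {mfun T >-> R} := mfun_Sub (mem_set mphi).
pose nu := mscale (NngNum c0) (distribution P X).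
have nuE A : measurable A -> nu A = (\int[P]_w (\1_A (phi w) * Z w)%:E)%E.
  by move=> mA; rewrite H.
have mgE : measurable_fun setT (EFin \o g) by exact/measurable_EFinP.
have gE0 y : (0 <= (EFin \o g) y)%E by rewrite lee_fin.
have := integral_weighted_image mphi mZ Z0 nuE mgE gE0.
rewrite /nu ge0_integral_mscale//.
by rewrite ge0_integral_distribution// => ->.
Qed.

Definition indep2 U V := forall A B : set R, measurable A -> measurable B ->
  P (U @^-1` A `&` V @^-1` B) = (P (U @^-1` A) * P (V @^-1` B))%E.

Lemma indep2_comp U V (g h : R -> R) : measurable_fun setT g -> measurable_fun setT h ->
  indep2 U V -> indep2 (fun w => g (U w)) (fun w => h (V w)).
Proof.
move=> mg mh I A B mA mB.
have mgA : measurable (g @^-1` A) by rewrite -[X in measurable X]setTI; exact: mg.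
have mhB : measurable (h @^-1` B) by rewrite -[X in measurable X]setTI; exact: mh.
exact: (I _ _ mgA mhB).
Qed.

(** [factor_integral] is applied twice, first to reduce U to an indicator, then V. It asks for
    functions nonnegative on the whole line, hence the detour through max(0, y). *)
Lemma indep2_ge0 U V : measurable_fun setT U -> measurable_fun setT V ->
  (forall w, 0 <= U w) -> (forall w, 0 <= V w) -> itg P V -> indep2 U V ->
  (\int[P]_w (U w * V w)%:E = (\int[P]_w V w)%:E * \int[P]_w (U w)%:E)%E.
Proof.
move=> mU mV U0 V0 iV I.
have EV0 : 0 <= \int[P]_w V w by exact: Rint_ge0.
pose g (y : R) : R := Num.max 0 y.
have mg : measurable_fun setT g by exact: measurable_maxr.
have g0 y : 0 <= g y by rewrite le_max lexx.
have gE y : 0 <= y -> g y = y by move=> y0; rewrite /g; exact/max_idPr.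
have -> : (\int[P]_w (U w * V w)%:E = \int[P]_w (g (U w) * V w)%:E)%E.
  by apply: eq_integral => w _; rewrite gE.
have -> : (\int[P]_w (U w)%:E = \int[P]_w (g (U w))%:E)%E.
  by apply: eq_integral => w _; rewrite gE.
apply: factor_integral => // A mA.
have mUA : measurable (U @^-1` A) by rewrite -[X in measurable X]setTI; exact: mU.
have m1 : measurable_fun setT (fun w => \1_A (U w) : R).
  exact: measurableT_comp (measurable_indic mA) mU.
have p0 : 0 <= fine (P (U @^-1` A)) by exact: fine_ge0.
have pE : (fine (P (U @^-1` A)))%:E = P (U @^-1` A).
  by rewrite fineK// fin_num_measure.
have -> : (\int[P]_w (\1_A (U w) * V w)%:E = \int[P]_w (g (V w) * \1_A (U w))%:E)%E.
  by apply: eq_integral => w _; rewrite gE// mulrC.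
have -> : ((\int[P]_w V w)%:E = \int[P]_w (g (V w))%:E)%E.
  by rewrite -Rint_EFin//; apply: eq_integral => w _; rewrite gE.
rewrite -pE muleC; apply: factor_integral => // B mB.
have mVB : measurable (V @^-1` B) by rewrite -[X in measurable X]setTI; exact: mV.
rewrite pE -I//; rewrite -[X in _ = P X]setIT -integral_indic//; last exact: measurableI.
apply: eq_integral => w _; congr EFin.
by rewrite indicI /= mulrC.
Qed.

Lemma indep2_mul U V : itg P U -> itg P V -> indep2 U V ->
  itg P (fun w => U w * V w) /\
  \int[P]_w (U w * V w) = \int[P]_w U w * \int[P]_w V w.
Proof.
move=> iU iV I.
pose p (y : R) : R := Num.max 0 y; pose m (y : R) : R := Num.max 0 (- y).
have mp : measurable_fun setT p by exact: measurable_maxr.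
have mm : measurable_fun setT m by apply: measurable_maxr => //; exact: measurable_funN.
have p0 y : 0 <= p y by rewrite le_max lexx.
have m0 y : 0 <= m y by rewrite le_max lexx.
have pm y : y = p y - m y.
  rewrite /p /m; have [y0|/ltW y0] := leP 0 y.
    have h : - y <= 0 by rewrite oppr_le0.
    by rewrite (max_idPl h) subr0.
  have h : 0 <= - y by rewrite oppr_ge0.
  by rewrite (max_idPr h) sub0r opprK.
have pl y : `|p y| <= `|y| /\ `|m y| <= `|y|.
  rewrite (ger0_norm (p0 y)) (ger0_norm (m0 y)) /p /m !ge_max !normr_ge0 ler_norm; split => //.
  by rewrite -normrN ler_norm.
have ip Y : itg P Y -> itg P (fun w => p (Y w)) /\ itg P (fun w => m (Y w)).
  move=> iY; have mY := itg_meas iY; have iN : itg P (fun w => `|Y w|) by exact: integrable_norm.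
  by split; apply: (itg_dom _ iN); try exact: measurableT_comp; move=> w; have [] := pl (Y w).
have [ipU imU] := ip _ iU; have [ipV imV] := ip _ iV.
have key (g h : R -> R) : measurable_fun setT g -> measurable_fun setT h ->
  (forall y, 0 <= g y) -> (forall y, 0 <= h y) ->
  itg P (fun w => g (U w)) -> itg P (fun w => h (V w)) ->
  itg P (fun w => g (U w) * h (V w)) /\
  \int[P]_w (g (U w) * h (V w)) = \int[P]_w g (U w) * \int[P]_w h (V w).
  move=> mg mh g0 h0 ig ih.
  have := @indep2_ge0 (fun w => g (U w)) (fun w => h (V w)) (itg_meas ig) (itg_meas ih)
    (fun w => g0 _) (fun w => h0 _) ih (indep2_comp mg mh I).
  rewrite (Rint_EFin ig) -EFinM => E.
  have i : itg P (fun w => g (U w) * h (V w)).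
    apply: itg_fin; first exact: measurable_funM (itg_meas ig) (itg_meas ih).
    - by move=> w; exact: mulr_ge0.
    - by rewrite E ltry.
  split => //; move: E; rewrite (Rint_EFin i) => -[->]; exact: mulrC.
have [i1 E1] := key p p mp mp p0 p0 ipU ipV.
have [i2 E2] := key p m mp mm p0 m0 ipU imV.
have [i3 E3] := key m p mm mp m0 p0 imU ipV.
have [i4 E4] := key m m mm mm m0 m0 imU imV.
have F w : U w * V w = (p (U w) * p (V w) - p (U w) * m (V w)) -
    (m (U w) * p (V w) - m (U w) * m (V w)).
  by rewrite {1}(pm (U w)) {1}(pm (V w)); ring.
have j1 := itgB i1 i2; have j2 := itgB i3 i4; have j := itgB j1 j2.
split; first by apply: itg_eq j => w; rewrite F.
have -> : \int[P]_w U w = \int[P]_w p (U w) - \int[P]_w m (U w).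
  by rewrite -RintegralB//; apply: eq_Rintegral => w _; exact: pm.
have -> : \int[P]_w V w = \int[P]_w p (V w) - \int[P]_w m (V w).
  by rewrite -RintegralB//; apply: eq_Rintegral => w _; exact: pm.
transitivity (\int[P]_w ((p (U w) * p (V w) - p (U w) * m (V w)) -
    (m (U w) * p (V w) - m (U w) * m (V w)))).
  by apply: eq_Rintegral => w _; exact: F.
by rewrite RintegralB// RintegralB// RintegralB// E1 E2 E3 E4; ring.
Qed.

Lemma indep_prod n (X : 'I_n -> {RV P >-> R}) (g : 'I_n -> R -> R) :
  mutually_independent X ->
  (forall i, measurable_fun setT (g i)) -> (forall i y, 0 <= g i y) ->
  (forall i, itg P (fun w => g i (X i w))) ->
  (\int[P]_w (\prod_(i < n) g i (X i w))%:E)%E =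
  (\prod_(i < n) \int[P]_w g i (X i w))%:E.
Proof.
move=> I.
(* Induction on the number of factors that are not yet indicators: those of index at least k are.
   For k = 0 the claim is mutual independence; each step frees one factor by [factor_integral]. *)
suff key (k : nat) (h : 'I_n -> R -> R) : (k <= n)%N ->
  (forall i, measurable_fun setT (h i)) -> (forall i y, 0 <= h i y) ->
  (forall i, itg P (fun w => h i (X i w))) ->
  (forall i : 'I_n, (k <= i)%N -> exists2 A, measurable A & h i = \1_A) ->
  (\int[P]_w (\prod_(i < n) h i (X i w))%:E)%E =
  (\prod_(i < n) \int[P]_w h i (X i w))%:E.
  by move=> mg g0 ig; apply: (key n) => // i; rewrite leqNgt ltn_ord.
elim: k h => [|k IH] h kn mh h0 ih Hh.
  have /choice[A HA] : forall i : 'I_n, exists A, measurable A /\ h i = \1_A.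
    by move=> i; have [A mA hA] := Hh i isT; exists A.
  have := I [set i : 'I_n | true]%SET A (fun i => (HA i).1).
  rewrite (_ : \bigcap_(i in _) _ = [set w | forall i, A i (X i w)]); last first.
    apply/seteqP; split => w /= H i; last by move=> _; exact: H.
    by apply: H => /=; rewrite inE.
  have mX i : measurable (X i @^-1` A i).
    by rewrite -[Y in measurable Y]setTI; apply: measurable_funP => //; exact: (HA i).1.
  have mS : measurable [set w | forall i, A i (X i w)].
    rewrite (_ : [set w | _] = \big[setI/setT]_(i < n) (X i @^-1` A i)).
      by apply: big_ind => //; exact: measurableI.
    apply/seteqP; split => w /=.
      by move=> H; elim/big_ind: _ => // i _; exact: H.
    move=> H i; move: H; rewrite (bigD1 i)//= => -[].
    by [].
  have -> : (\int[P]_w (\prod_(i < n) h i (X i w))%:E)%E = P [set w | forall i, A i (X i w)].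
    rewrite -[Y in P Y]setIT -integral_indic//; apply: eq_integral => w _; congr EFin.
    under eq_bigr => i _ do rewrite (HA i).2 indicE.
    rewrite indicE; case: (asboolP (forall i, A i (X i w))) => H.
      by rewrite mem_set// big1// => i _; rewrite mem_set.
    rewrite memNset//; move/existsNP : H => [i /= Hi].
    by rewrite (bigD1 i)//= memNset// mul0r.
  move=> ->; rewrite -[LHS](_ : (\prod_(i < n) P (X i @^-1` A i))%E = _); last first.
    by apply: eq_bigl => i; rewrite inE.
  rewrite -prodEFin; apply: eq_bigr => i _.
  rewrite -Rint_EFin// -integral_indic_weight//; last exact: (HA i).1.
  by apply: eq_integral => w _; rewrite (HA i).2.
pose i0 : 'I_n := Ordinal kn.
pose Z w := \prod_(i < n | i != i0) h i (X i w).
pose c := \prod_(i < n | i != i0) \int[P]_w h i (X i w).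
have mhX i : measurable_fun setT (fun w => h i (X i w)) by exact: itg_meas.
have mZ : measurable_fun setT Z.
  rewrite /Z (_ : (fun w => _) = (fun w => \prod_(i <- [seq i <- index_enum 'I_n | i != i0]) h i (X i w))).
    exact: measurable_prod.
  by apply/funext => w; rewrite big_filter.
have Z0 w : 0 <= Z w by apply: prodr_ge0 => i _.
have c0 : 0 <= c by apply: prodr_ge0 => i _; exact: Rint_ge0.
have mX0 : measurable_fun setT (X i0) by exact: measurable_funP.
rewrite (bigD1 i0)//= -/c EFinM -Rint_EFin// muleC.
rewrite -(@factor_integral (X i0) Z c mX0 mZ Z0 c0)//.
  by apply: eq_integral => w _; rewrite (bigD1 i0).
move=> A mA; pose h' i := if i == i0 then \1_A else h i.
have h'0 : h' i0 = \1_A by rewrite /h' eqxx.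
have h'n i : i != i0 -> h' i = h i by rewrite /h' => /negbTE ->.
have := IH h' (ltnW kn).
rewrite [Y in (_ -> _ -> _ -> _ -> _ = Y)](_ : _ = (c%:E * P (X i0 @^-1` A))%E); last first.
  rewrite (bigD1 i0)//= h'0 EFinM muleC; congr (_ * _)%E.
    by rewrite /c; congr EFin; apply: eq_bigr => i ii; rewrite h'n.
  rewrite -integral_indic_weight// Rint_EFin//.
  apply: (@itg_dom _ _ _ _ _ (fun=> 1)).
  - exact: measurableT_comp (measurable_indic mA) mX0.
  - exact: finite_measure_integrable_cst.
  - by move=> w; rewrite indicE; case: (_ \in _); rewrite ?normr1 ?normr0.
move=> <-.
- by apply: eq_integral => w _; rewrite [in RHS](bigD1 i0)//= h'0; congr (_ * _)%:E;
    apply: eq_bigr => i ii; rewrite h'n.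
- move=> i; case: (eqVneq i i0) => [->|ii]; first by rewrite h'0; exact: measurable_indic.
  by rewrite h'n.
- move=> i y; case: (eqVneq i i0) => [->|ii]; last by rewrite h'n.
  by rewrite h'0 indicE.
- move=> i; case: (eqVneq i i0) => [->|ii]; last by rewrite h'n.
  rewrite h'0; apply: (@itg_dom _ _ _ _ _ (fun=> 1)).
  + exact: measurableT_comp (measurable_indic mA) mX0.
  + exact: finite_measure_integrable_cst.
  + by move=> w; rewrite indicE; case: (_ \in _); rewrite ?normr1 ?normr0.
- move=> i ki; case: (eqVneq i i0) => [->|ii]; first by rewrite h'0; exists A.
  rewrite h'n//; apply: Hh; rewrite ltn_neqAle ki andbT.
  by apply: contra_neq ii => E; apply: val_inj.
Qed.

End Independence.

(** * Concentration of the empirical Gram matrix *)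

Section Bernstein.
Context d (T : measurableType d) (R : realType) (P : probability T R).

(* Squaring [expR (u / 2) <= (1 - u / 2)^-1] and expanding. *)
Lemma expR_le_quadratic (u : R) : `|u| <= 3 / 8 -> expR u <= 1 + u + u ^+ 2.
Proof.
rewrite ler_norml => /andP[u1 u2].
have h : expR (u / 2) <= (1 - u / 2)^-1.
  rewrite -[u / 2]opprK expRN opprK lef_pV2 ?posrE ?expR_gt0//; last by lra.
  exact: expR_ge1Dx.
have -> : expR u = expR (u / 2) ^+ 2 by rewrite expr2 -expRD -splitr.
apply: (@le_trans _ _ ((1 - u / 2)^-1 ^+ 2)).
  by rewrite ler_pXn2r ?nnegrE ?expR_ge0// invr_ge0; lra.
have p : 0 < (1 - u / 2) ^+ 2 by rewrite exprn_gt0//; lra.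
rewrite exprVn -[leLHS]mul1r ler_pdivrMr//.
have q : 0 <= 1 - 3 * u + u ^+ 2 by nra.
have : 0 <= u ^+ 2 / 4 * (1 - 3 * u + u ^+ 2) by rewrite mulr_ge0// divr_ge0// sqr_ge0.
by lra.
Qed.

Lemma itg_bounded_comp (g : R -> R) (Y : {RV P >-> R}) (B : R) : measurable_fun setT g ->
  (forall x, `|g x| <= B) -> itg P (fun w => g (Y w)).
Proof.
move=> mg gB; apply: (@itg_dom _ _ _ _ _ (fun=> B)).
- by apply: measurableT_comp => //; exact: measurable_funP.
- exact: finite_measure_integrable_cst.
- by move=> w; exact: gB.
Qed.

Lemma Rint_cst (c : R) : \int[P]_w c = c.
Proof. by rewrite Rintegral_cst//= probability_setT/= mulr1. Qed.

(** Centering removes the linear term of [expR_le_quadratic], whose range dictates lam B <= 3/8. The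
    bound is kept on the exponential itself, the form in which it dominates an indicator. *)
Lemma bernstein_mgf n (X : 'I_n -> {RV P >-> R}) (xi : R -> R) (lam B v t : R) :
  mutually_independent X -> measurable_fun setT xi ->
  (forall x, `|xi x| <= B) -> 0 <= lam -> lam * B <= 3 / 8 ->
  (forall i, \int[P]_w xi (X i w) = 0) ->
  (forall i, \int[P]_w (xi (X i w) ^+ 2) <= v) ->
  itg P (fun w => expR (lam * (\sum_(i < n) xi (X i w) - n%:R * t))) /\
  \int[P]_w expR (lam * (\sum_(i < n) xi (X i w) - n%:R * t)) <=
    expR (- (n%:R * (lam * t - lam ^+ 2 * v))).
Proof.
move=> I mxi xB l0 lB E0 Ev.
pose g (x : R) := expR (lam * (xi x - t)).
have mg : measurable_fun setT g.
  apply: measurableT_comp; first exact: measurable_expR.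
  by apply: measurable_funM => //; apply: measurable_funB.
have g0 x : 0 <= g x by exact: expR_ge0.
have lx x : `|lam * xi x| <= 3 / 8.
  by rewrite normrM ger0_norm// (le_trans _ lB)// ler_wpM2l.
have gB x : `|g x| <= expR (3 / 8 - lam * t).
  rewrite ger0_norm// ler_expR mulrBr lerB//.
  by apply: le_trans (lx x); exact: ler_norm.
have gq x : g x <= expR (- (lam * t)) * (1 + lam * xi x + lam ^+ 2 * xi x ^+ 2).
  rewrite /g mulrBr [lam * xi x - _]addrC expRD ler_wpM2l ?expR_ge0//.
  by rewrite -exprMn; exact: expR_le_quadratic.
have ig i : itg P (fun w => g (X i w)) by exact: itg_bounded_comp gB.
have Eg i : \int[P]_w g (X i w) <= expR (- (lam * t - lam ^+ 2 * v)).
  have ix : itg P (fun w => xi (X i w)) by exact: itg_bounded_comp xB.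
  have ix2 : itg P (fun w => xi (X i w) ^+ 2).
    apply: (@itg_bounded_comp (fun x => xi x ^+ 2) _ (B ^+ 2)).
      exact: measurable_funX.
    move=> x; rewrite normrX ler_pXn2r ?nnegrE//.
    by apply: le_trans (xB x).
  have i1 : itg P (fun=> 1) by exact: finite_measure_integrable_cst.
  have iq : itg P (fun w => 1 + lam * xi (X i w) + lam ^+ 2 * xi (X i w) ^+ 2).
    by apply: itgD; [apply: itgD => //; exact: itgZ|exact: itgZ].
  apply: (@le_trans _ _ (\int[P]_w (expR (- (lam * t)) *
      (1 + lam * xi (X i w) + lam ^+ 2 * xi (X i w) ^+ 2)))).
    by apply: Rint_le => //; exact: itgZ.
  have -> : \int[P]_w (expR (- (lam * t)) * (1 + lam * xi (X i w) + lam ^+ 2 * xi (X i w) ^+ 2)) =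
      expR (- (lam * t)) * (1 + lam ^+ 2 * \int[P]_w (xi (X i w) ^+ 2)).
    rewrite (RintegralZl _ _ iq)//; congr (_ * _).
    transitivity (\int[P]_w (1 * (1 * 1 + lam * xi (X i w)) + lam ^+ 2 * xi (X i w) ^+ 2)).
      by apply: eq_Rintegral => w _; rewrite !mul1r.
    rewrite (RintD2 _ _ _ ix2); last by apply: itgD; exact: itgZ.
    by rewrite (RintD2 _ _ i1 ix) E0 Rint_cst; ring.
  have -> : expR (- (lam * t - lam ^+ 2 * v)) = expR (- (lam * t)) * expR (lam ^+ 2 * v).
    by rewrite -expRD; congr expR; ring.
  rewrite ler_wpM2l ?expR_ge0//.
  apply: le_trans (expR_ge1Dx _); rewrite lerD2l ler_wpM2l ?sqr_ge0//.
have prodE w : \prod_(i < n) g (X i w) = expR (lam * (\sum_(i < n) xi (X i w) - n%:R * t)).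
  rewrite -expR_sum; congr expR; rewrite -mulr_sumr sumrB; congr (_ * (_ - _)).
  by rewrite sumr_const card_ord mulr_natl.
have H := indep_prod I (fun i => mg) (fun i => g0) ig.
have mS : measurable_fun setT (fun w => expR (lam * (\sum_(i < n) xi (X i w) - n%:R * t))).
  apply: measurableT_comp; first exact: measurable_expR.
  apply: measurable_funM => //; apply: measurable_funB => //.
  apply: measurable_sum => i; apply: measurableT_comp => //; exact: measurable_funP.
apply: itg_le => //.
rewrite (_ : (\int[P]_w _)%E = (\int[P]_w (\prod_(i < n) g (X i w))%:E)%E); last first.
  by apply: eq_integral => w _; rewrite prodE.
rewrite H lee_fin.
have -> : expR (- (n%:R * (lam * t - lam ^+ 2 * v))) =
    \prod_(i < n) expR (- (lam * t - lam ^+ 2 * v)).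
  by rewrite prodr_const card_ord -expRM_natl mulrN.
by apply: ler_prod => i _; rewrite Rint_ge0//=.
Qed.

End Bernstein.

(** * Expectations under a law with a density *)

Section Law.
Context d (T : measurableType d) (R : realType) (P : probability T R).
Notation mu := (@lebesgue_measure R).
Variables (f : R -> R) (X : {RV P >-> R}).
Hypotheses (mf : measurable_fun setT f) (f0 : forall x, 0 <= f x).
Hypothesis Xf : forall A : set R, measurable A ->
  distribution P X A = (\int[mu]_(x in A) (f x)%:E)%E.

Lemma law_ge0 (g : R -> R) : measurable_fun setT g -> (forall x, 0 <= g x) ->
  (\int[P]_w (g (X w))%:E = \int[mu]_x (g x * f x)%:E)%E.
Proof.
move=> mg g0.
have mgE : measurable_fun setT (EFin \o g) by exact/measurable_EFinP.
have gE0 y : (0 <= (EFin \o g) y)%E by rewrite lee_fin.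
have nuE A : measurable A ->
    distribution P X A = (\int[mu]_x (\1_A (id x) * f x)%:E)%E.
  move=> mA; rewrite Xf// integral_mkcond; apply: eq_integral => x _.
  by rewrite patchE indicE; case: (x \in A); rewrite ?mul1r ?mul0r.
have mid : measurable_fun setT (@id R) by exact: measurable_id.
have := @integral_weighted_image _ _ _ _ R mu (distribution P X) id f mid mf f0 nuE _ mgE gE0.
by rewrite ge0_integral_distribution.
Qed.

Lemma density_int : itg mu f /\ \int[mu]_x f x = 1.
Proof.
have m1 : measurable_fun [set: R] (fun=> 1 : R) by [].
have := law_ge0 m1 (fun=> ler01).
rewrite integral_cst//= probability_setT mule1 => E.
have E' : (\int[mu]_x (f x)%:E)%E = 1%E.
  by rewrite E; apply: eq_integral => x _; rewrite mul1r.
have intf : itg mu f by apply: itg_fin => //; rewrite E' ltry.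
by split => //; rewrite /Rintegral E'.
Qed.

Lemma law_itg (g : R -> R) : measurable_fun setT g -> (forall x, 0 <= g x) ->
  itg mu (fun x => g x * f x) ->
  itg P (fun w => g (X w)) /\ \int[P]_w g (X w) = \int[mu]_x (g x * f x).
Proof.
move=> mg g0 ig; have E := law_ge0 mg g0.
have i : itg P (fun w => g (X w)).
  apply: itg_fin => //.
    by apply: measurableT_comp => //; exact: measurable_funP.
  by rewrite E Rint_EFin// ltry.
by split => //; move: E; rewrite !Rint_EFin// => -[].
Qed.

(** Adding the constant B reduces to the nonnegative case. *)
Lemma law_bnd (g : R -> R) (B : R) : measurable_fun setT g -> (forall x, `|g x| <= B) ->
  [/\ itg mu (fun x => g x * f x), itg P (fun w => g (X w)) &
  \int[P]_w g (X w) = \int[mu]_x (g x * f x)].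
Proof.
move=> mg gB; have [intf f1] := density_int.
have igf : itg mu (fun x => g x * f x).
  by apply: itg_eq (itg_bnd intf mg gB) => x; rewrite mulrC.
have ig : itg P (fun w => g (X w)) by exact: itg_bounded_comp gB.
split => //.
have gp x : 0 <= g x + B by have := gB x; rewrite ler_norml => /andP[h _]; lra.
have mgB : measurable_fun setT (fun x => g x + B) by exact: measurable_funD.
have i2 : itg mu (fun x => (g x + B) * f x).
  by apply: itg_eq (itgD igf (itgZ B intf)) => x; rewrite mulrDl.
have [_] := law_itg mgB gp i2.
have i1 : itg P (fun=> B) by exact: finite_measure_integrable_cst.
rewrite RintegralD// Rint_cst.
have -> : \int[mu]_x ((g x + B) * f x) = \int[mu]_x (1 * (g x * f x) + B * f x).
  by apply: eq_Rintegral => x _; ring.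
by rewrite (RintD2 _ _ igf intf) f1; lra.
Qed.

Lemma law_sqi (g : R -> R) (F : R) : (forall x, f x <= F) -> sqi mu g ->
  itg P (fun w => g (X w) ^+ 2) /\ \int[P]_w (g (X w) ^+ 2) <= F * \int[mu]_x (g x ^+ 2).
Proof.
move=> fF [mg ig].
have F0 : 0 <= F by apply: le_trans (f0 0) (fF 0).
have i : itg mu (fun x => g x ^+ 2 * f x).
  apply: itg_bnd => // x; rewrite ger0_norm//; exact: fF.
have mg2 : measurable_fun setT (fun x => g x ^+ 2) by exact: measurable_funX.
have [i2 ->] := law_itg mg2 (fun x => sqr_ge0 (g x)) i.
split => //; rewrite -RintegralZl//; apply: Rint_le => //; first exact: itgZ.
by move=> x; rewrite mulrC ler_wpM2r ?sqr_ge0.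
Qed.

End Law.

(** * The population Gram matrix *)

Section Gram.
Context {R : realType}.
Notation mu := (@lebesgue_measure R).
Variable f : R -> R.
Hypotheses (f0 : forall x, 0 <= f x) (intf : itg mu f).

Lemma meas_hermite j : measurable_fun setT (@hermite R j).
Proof. by apply: meas_cont; exact: continuous_hermite. Qed.

Lemma itg_gram j k : itg mu (fun x => hermite j x * hermite k x * f x).
Proof.
have [C HC] := @hermite_bound R j; have [C' HC'] := @hermite_bound R k.
apply: itg_eq (itg_bnd (itg_bnd intf (meas_hermite j) HC) (meas_hermite k) HC') => x; ring.
Qed.

Definition phiv N (x : R) : 'cV[R]_N := \col_j hermite j x.

Lemma Psi_sym N : (Psi f N)^T = Psi f N.
Proof.
apply/matrixP => j k; rewrite !mxE; apply: eq_Rintegral => x _.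
by rewrite [hermite k x * _]mulrC.
Qed.

Lemma Psi_bilin N (u v : 'cV[R]_N) :
  itg mu (fun x => dotv u (phiv N x) * dotv v (phiv N x) * f x) /\
  dotv u (Psi f N *m v) = \int[mu]_x (dotv u (phiv N x) * dotv v (phiv N x) * f x).
Proof.
pose G x := \sum_(j < N) \sum_(k < N)
  (u j ord0 * v k ord0) * (hermite j x * hermite k x * f x).
have E x : dotv u (phiv N x) * dotv v (phiv N x) * f x = G x.
  rewrite /dotv mulr_suml mulr_suml; apply: eq_bigr => j _.
  rewrite mulr_sumr mulr_suml; apply: eq_bigr => k _; rewrite !mxE; ring.
have iG (j : 'I_N) : itg mu (fun x => \sum_(k < N)
    (u j ord0 * v k ord0) * (hermite j x * hermite k x * f x)).
  by apply: itg_sum => k; apply: itgZ; exact: itg_gram.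
split; first by apply: itg_eq (itg_sum iG) => x; rewrite E.
transitivity (\int[mu]_x G x); last by apply: eq_Rintegral => x _; rewrite E.
rewrite /G (Rint_sum iG); apply: eq_bigr => j _.
rewrite Rint_sum; last by move=> k; apply: itgZ; exact: itg_gram.
rewrite mxE mulr_sumr; apply: eq_bigr => k _.
rewrite RintegralZl//; last exact: itg_gram.
by rewrite mxE; ring.
Qed.

Lemma qf_PsiE N (u : 'cV[R]_N) :
  qf (Psi f N) u = \int[mu]_x (dotv u (phiv N x) ^+ 2 * f x).
Proof. by rewrite /qf (Psi_bilin u u).2; apply: eq_Rintegral => x _; rewrite expr2. Qed.

Lemma qf_Psi_ge0 N (u : 'cV[R]_N) : 0 <= qf (Psi f N) u.
Proof. by rewrite qf_PsiE; apply: Rint_ge0 => x; rewrite mulr_ge0 ?sqr_ge0. Qed.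

(** By orthonormality |u|^2 is the square integral of sum_j u_j h_j, and the density is at most
    F. *)
Lemma qf_Psi_le N (u : 'cV[R]_N) (F : R) : (forall x, f x <= F) ->
  qf (Psi f N) u <= F * nsq u.
Proof.
move=> fF; rewrite qf_PsiE.
pose c (k : nat) : R := if insub k is Some j then u j ord0 else 0.
have E x : dotv u (phiv N x) = hsum N c x.
  by apply: eq_bigr => j _; rewrite mxE /c valK.
have nE : nsq u = \sum_(k < N) c k ^+ 2 by apply: eq_bigr => j _; rewrite /c valK.
rewrite nE -int_hsum_sqr -RintegralZl//; last by have [] := @sqi_hsum R N c.
apply: Rint_le.
- by apply: itg_eq (Psi_bilin u u).1 => x; rewrite expr2.
- by apply: itgZ; have [] := @sqi_hsum R N c.
- by move=> x; rewrite E mulrC ler_wpM2r ?sqr_ge0.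
Qed.

End Gram.

Lemma le_term_sum (R : realType) N (F : 'I_N -> R) k : (forall i, 0 <= F i) ->
  F k <= \sum_(i < N) F i.
Proof. by move=> F0; rewrite (bigD1 k)//= lerDl sumr_ge0. Qed.

Section GoodDesign.
Context {R : realType}.
Notation mu := (@lebesgue_measure R).
Variables (f : R -> R) (N : nat) (S : 'M[R]_N) (a : R).
Hypotheses (f0 : forall x, 0 <= f x) (intf : itg mu f) (f1 : \int[mu]_x f x = 1).
Hypotheses (N0 : (0 < N)%N) (HS : S^T *m Psi f N *m S = 1%:M).
Hypothesis Sa : forall x, nsq (S^T *m phiv N x) <= a.

(** The basis normalized by S, an orthonormal system for the weight f. *)
Definition wv (k : 'I_N) (x : R) : R := (S^T *m phiv N x) k ord0.

Lemma wvE k x : wv k x = dotv (col k S) (phiv N x).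
Proof. by rewrite /wv mxE; apply: eq_bigr => j _; rewrite !mxE. Qed.

Lemma meas_wv k : measurable_fun setT (wv k).
Proof.
rewrite (_ : wv k = fun x => \sum_(j < N) S j k * hermite j x).
  by apply: measurable_sum => j; apply: measurable_funM => //; exact: meas_hermite.
by apply/funext => x; rewrite wvE; apply: eq_bigr => j _; rewrite !mxE.
Qed.

Lemma wv_sum x : \sum_(k < N) wv k x ^+ 2 <= a.
Proof. exact: Sa. Qed.

Lemma wv_sqr k x : wv k x ^+ 2 <= a.
Proof.
apply: le_trans (wv_sum x); rewrite (bigD1 k)//= lerDl.
by apply: sumr_ge0 => j _; exact: sqr_ge0.
Qed.

Lemma wv_mul k l x : `|wv k x * wv l x| <= a.
Proof.
have := wv_sqr k x; have := wv_sqr l x; rewrite normrM.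
rewrite -(real_normK (num_real (wv k x))) -(real_normK (num_real (wv l x))).
by have := sqr_ge0 (`|wv k x| - `|wv l x|); nra.
Qed.

Lemma wv_gram k l : itg mu (fun x => wv k x * wv l x * f x) /\
  \int[mu]_x (wv k x * wv l x * f x) = (k == l)%:R.
Proof.
have [i E] := Psi_bilin intf (col k S) (col l S).
split; first by apply: itg_eq i => x; rewrite !wvE.
transitivity (\int[mu]_x (dotv (col k S) (phiv N x) * dotv (col l S) (phiv N x) * f x)).
  by apply: eq_Rintegral => x _; rewrite !wvE.
rewrite -E dotvE tr_col.
have := HS => /matrixP/(_ k l); rewrite [X in _ = X]mxE => <-.
by rewrite -mulmxA !mxE; apply: eq_bigr => j _; rewrite !mxE; congr (_ * _);
  apply: eq_bigr => i' _; rewrite !mxE.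
Qed.

Lemma wv_norm k : itg mu (fun x => wv k x ^+ 2 * f x) /\
  \int[mu]_x (wv k x ^+ 2 * f x) = 1.
Proof.
have [i E] := wv_gram k k; rewrite eqxx in E.
split; first by apply: itg_eq i => x; rewrite expr2.
by rewrite -[RHS]E; apply: eq_Rintegral => x _; rewrite expr2.
Qed.

(** N is the integral against f of the sum of the squares of N normalized functions, and this sum is
    at most a everywhere. *)
Lemma dim_le : N%:R <= a.
Proof.
have i k := (wv_norm k).1.
have -> : N%:R = \sum_(k < N) \int[mu]_x (wv k x ^+ 2 * f x).
  by rewrite (eq_bigr (fun=> 1)) ?sumr_const ?card_ord// => k _; exact: (wv_norm k).2.
rewrite -Rint_sum// -[leRHS]mulr1 -f1 -RintegralZl//.
apply: Rint_le; [exact: itg_sum|exact: itgZ|].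
by move=> x; rewrite -mulr_suml ler_wpM2r//; exact: wv_sum.
Qed.

Let a1 : 1 <= a. Proof. by apply: le_trans dim_le; rewrite ler1n. Qed.
Let a0 : 0 < a. Proof. by apply: lt_le_trans a1. Qed.
Let Nr0 : 0 < N%:R :> R. Proof. by rewrite ltr0n. Qed.

Definition dev (k l : 'I_N) (x : R) : R := wv k x * wv l x - (k == l)%:R.

Definition fourth (k l : 'I_N) : R := \int[mu]_x ((wv k x * wv l x) ^+ 2 * f x).

(** The floor a / N keeps the Bernstein parameter within its range even for entries of small
    variance. Over the N^2 entries it adds a N, no more than the bound [sum_fourth] on the moments
    themselves. *)
Definition varproxy (k l : 'I_N) : R := fourth k l + a / N%:R.

(* The thresholds balance two needs: their squares sum to at most 1/4 (sum_devthr2),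
   which makes the normalized Gram matrix invertible, while the Bernstein exponent
   n devthr^2 / (4 varproxy) = n / (32 a N) does not depend on (k, l). *)
Definition devthr (k l : 'I_N) : R := Num.sqrt (varproxy k l / (8 * a * N%:R)).

Lemma meas_dev k l : measurable_fun setT (dev k l).
Proof. by apply: measurable_funB => //; apply: measurable_funM; exact: meas_wv. Qed.

Lemma dev_bound k l x : `|dev k l x| <= 2 * a.
Proof.
rewrite mulrDl mul1r; apply: le_trans (ler_normB _ _) _; apply: lerD.
  exact: wv_mul.
by case: (k == l); rewrite ?normr1 ?normr0 ?(ltW a0).
Qed.

Lemma itg_fourth k l : itg mu (fun x => (wv k x * wv l x) ^+ 2 * f x).
Proof.
have m : measurable_fun setT (fun x => (wv k x * wv l x) ^+ 2).
  by apply: measurable_funX; apply: measurable_funM; exact: meas_wv.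
have B x : `|(wv k x * wv l x) ^+ 2| <= a ^+ 2.
  by rewrite normrX ler_pXn2r ?nnegrE ?(ltW a0)//; exact: wv_mul.
by apply: itg_eq (itg_bnd intf m B) => x; rewrite mulrC.
Qed.

Lemma fourth_ge0 k l : 0 <= fourth k l.
Proof. by apply: Rint_ge0 => x; rewrite mulr_ge0 ?sqr_ge0. Qed.

Lemma sum_fourth : \sum_(k < N) \sum_(l < N) fourth k l <= a * N%:R.
Proof.
have i k : itg mu (fun x => a * (wv k x ^+ 2 * f x)) by exact: itgZ (wv_norm k).1.
rewrite mulr_natr -[X in _ <= _ *+ X](card_ord N) -sumr_const; apply: ler_sum => k _.
have E : \int[mu]_x (a * (wv k x ^+ 2 * f x)) = a.
  by have [ik Ek] := wv_norm k; rewrite RintegralZl// Ek mulr1.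
rewrite -[X in _ <= X]E /fourth -Rint_sum; last by move=> l; exact: itg_fourth.
apply: Rint_le => //; first by apply: itg_sum => l; exact: itg_fourth.
move=> x; rewrite -mulr_suml mulrA ler_wpM2r//.
under eq_bigr do rewrite exprMn.
by rewrite -mulr_sumr mulrC ler_wpM2r ?sqr_ge0//; exact: wv_sum.
Qed.

Lemma varproxy_ge k l : a / N%:R <= varproxy k l.
Proof. by rewrite lerDr fourth_ge0. Qed.

Let aN0 : 0 < a / N%:R. Proof. by rewrite divr_gt0. Qed.
Let vp0 k l : 0 < varproxy k l. Proof. exact: lt_le_trans (varproxy_ge k l). Qed.

Lemma devthr2 k l : devthr k l ^+ 2 = varproxy k l / (8 * a * N%:R).
Proof. by rewrite sqr_sqrtr// divr_ge0 ?(ltW (vp0 _ _))// !mulr_ge0// ltW. Qed.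

Lemma sum_devthr2 : \sum_(k < N) \sum_(l < N) devthr k l ^+ 2 <= 4^-1.
Proof.
have d0 : 0 < 8 * a * N%:R by rewrite !mulr_gt0.
have -> : \sum_(k < N) \sum_(l < N) devthr k l ^+ 2 =
    (\sum_(k < N) \sum_(l < N) fourth k l + \sum_(k < N) \sum_(l < N) a / N%:R) / (8 * a * N%:R).
  rewrite -big_split mulr_suml; apply: eq_bigr => k _ /=.
  rewrite -big_split mulr_suml; apply: eq_bigr => l _ /=.
  by rewrite devthr2.
have -> : \sum_(k < N) \sum_(l < N) a / N%:R = a * N%:R.
  by rewrite !sumr_const card_ord -mulrnA -[_ *+ (N * N)]mulr_natr natrM mulrA divfK ?gt_eqF.
rewrite ler_pdivrMr//.
have -> : 4^-1 * (8 * a * N%:R) = a * N%:R + a * N%:R by field.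
by rewrite lerD2r; exact: sum_fourth.
Qed.

Definition good_design n (x : 'I_n -> R) : Prop :=
  forall k l, `|\sum_(i < n) dev k l (x i)| <= n%:R * devthr k l.

Lemma good_design_frob n (x : 'I_n -> R) : (0 < n)%N -> good_design x ->
  frob (S^T *m Psi_hat x N *m S - 1%:M) <= 4^-1.
Proof.
move=> n0 H; have nr0 : 0 < n%:R :> R by rewrite ltr0n.
apply: le_trans sum_devthr2; apply: ler_sum => k _; apply: ler_sum => l _.
have -> : (S^T *m Psi_hat x N *m S - 1%:M) k l = n%:R^-1 * \sum_(i < n) dev k l (x i).
  have -> : \sum_(i < n) dev k l (x i) =
      \sum_(i < n) wv k (x i) * wv l (x i) - n%:R * (k == l)%:R.
    by rewrite sumrB sumr_const card_ord [n%:R * _]mulr_natl.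
  have nn : n%:R != 0 :> R by rewrite gt_eqF.
  rewrite mulrBr mulrA mulVf// mul1r.
  rewrite [LHS]mxE; congr (_ + _); last by rewrite !mxE.
  rewrite /Psi_hat -scalemxAr -scalemxAl [LHS]mxE; congr (_ * _).
  rewrite !mulmxA -trmx_mul -mulmxA mxE; apply: eq_bigr => i _.
  rewrite [X in X * _]mxE; congr (_ * _); rewrite wvE mxE; apply: eq_bigr => j _;
    rewrite !mxE; exact: mulrC.
rewrite -(real_normK (num_real (_ * _))) ler_pXn2r ?nnegrE ?sqrtr_ge0//.
by rewrite normrM ger0_norm ?invr_ge0 ?(ltW nr0)// mulrC ler_pdivrMr// mulrC; exact: H.
Qed.

Lemma measurable_good_design n d (T : measurableType d) (X : 'I_n -> T -> R) :
  (forall i, measurable_fun setT (X i)) ->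
  measurable [set w | good_design (fun i => X i w)].
Proof.
move=> mX.
pose s k l w := \sum_(i < n) dev k l (X i w).
have ms k l : measurable_fun setT (s k l).
  by apply: measurable_sum => i; apply: measurableT_comp => //; exact: meas_dev.
have mkl k l : measurable [set w | `|s k l w| <= n%:R * devthr k l].
  have m : measurable_fun setT (fun w => `|s k l w|) by exact: measurableT_comp.
  rewrite (_ : [set w | _] = (fun w => `|s k l w|) @^-1` `]-oo, n%:R * devthr k l]).
    by rewrite -[X in measurable X]setTI; exact: m.
  by apply/seteqP; split => w /=; rewrite in_itv.
rewrite (_ : [set w | _] =
   \big[setI/setT]_(k < N) \big[setI/setT]_(l < N) [set w | `|s k l w| <= n%:R * devthr k l]).
  by apply: big_ind => // [|k _]; [exact: measurableI|];
    apply: big_ind => //; exact: measurableI.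
apply/seteqP; split => w /=.
  move=> H; elim/big_ind: _ => // k _; elim/big_ind: _ => // l _; exact: H.
move=> H k l; move: H; rewrite (bigD1 k)//= => -[+ _].
by rewrite (bigD1 l)//= => -[].
Qed.

Section Tail.
Context d (T : measurableType d) (P : probability T R) (n : nat).
Variable X : 'I_n -> {RV P >-> R}.
Hypotheses (mf : measurable_fun setT f) (Xind : mutually_independent X).
Hypothesis Xf : forall (i : 'I_n) (A : set R), measurable A ->
  distribution P (X i) A = (\int[mu]_(x in A) (f x)%:E)%E.
Hypothesis n0 : (0 < n)%N.

(** The minimizer of lam^2 v - lam t, whose minimum is - t^2 / (4 v). *)
Let lam k l := devthr k l / (2 * varproxy k l).

Definition exp_dev (e : R) k l (w : T) : R :=
  expR (lam k l * (\sum_(i < n) e * dev k l (X i w) - n%:R * devthr k l)).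

Lemma exp_dev_int (e : R) k l : e ^+ 2 = 1 -> itg P (exp_dev e k l) /\
  \int[P]_w exp_dev e k l w <= expR (- (n%:R / (32 * a * N%:R))).
Proof.
move=> e2; have v0 := vp0 k l.
have ne : `|e| = 1.
  by apply/eqP; rewrite -(@eqrXn2 _ 2)// ?normr_ge0// real_normK ?num_real// e2 expr1n.
have t0 : 0 <= devthr k l by exact: sqrtr_ge0.
have l0 : 0 <= lam k l by rewrite divr_ge0// mulr_ge0// ltW.
(* After squaring this reads (1/8) (a / N) / varproxy <= 9/64, which holds thanks to the floor a /
   N. *)
have lB : lam k l * (2 * a) <= 3 / 8.
  have l2 : (lam k l * (2 * a)) ^+ 2 =
      devthr k l ^+ 2 / (2 * varproxy k l) ^+ 2 * (2 * a) ^+ 2 by rewrite /lam; field; rewrite gt_eqF.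
  have q0 : 0 <= lam k l * (2 * a) by rewrite mulr_ge0// mulr_ge0// ltW.
  have e0 : 0 <= 3 / 8 :> R by rewrite divr_ge0.
  rewrite -(@ler_pXn2r _ 2) ?nnegrE// l2 devthr2.
  have -> : varproxy k l / (8 * a * N%:R) / (2 * varproxy k l) ^+ 2 * (2 * a) ^+ 2 =
     8^-1 * ((a / N%:R) / varproxy k l) by field; rewrite !gt_eqF.
  have : (a / N%:R) / varproxy k l <= 1 by rewrite ler_pdivrMr// mul1r varproxy_ge.
  by lra.
have m : measurable_fun setT (fun x => e * dev k l x).
  by apply: measurable_funM => //; exact: meas_dev.
have B x : `|e * dev k l x| <= 2 * a by rewrite normrM ne mul1r dev_bound.
have mD := meas_dev k l.
have E0 i : \int[P]_w (e * dev k l (X i w)) = 0.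
  have [_ iP E] := law_bnd mf f0 (Xf i) mD (dev_bound k l).
  rewrite RintegralZl// E.
  have -> : \int[mu]_x (dev k l x * f x) =
      \int[mu]_x (1 * (wv k x * wv l x * f x) + (- (k == l)%:R) * f x).
    by apply: eq_Rintegral => x _; rewrite /dev; ring.
  have [ig Eg] := wv_gram k l.
  by rewrite (RintD2 _ _ ig intf) Eg f1; ring.
have E2 i : \int[P]_w ((e * dev k l (X i w)) ^+ 2) <= varproxy k l.
  have mD2 : measurable_fun setT (fun x => dev k l x ^+ 2) by exact: measurable_funX.
  have bD2 x : `|dev k l x ^+ 2| <= (2 * a) ^+ 2.
    by rewrite normrX ler_pXn2r ?nnegrE ?mulr_ge0 ?(ltW a0)//; exact: dev_bound.
  have [_ iP E] := law_bnd mf f0 (Xf i) mD2 bD2.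
  have -> : \int[P]_w ((e * dev k l (X i w)) ^+ 2) = \int[P]_w (dev k l (X i w) ^+ 2).
    by apply: eq_Rintegral => w _; rewrite exprMn e2 mul1r.
  rewrite E /varproxy; have [ig Eg] := wv_gram k l; have i4 := itg_fourth k l.
  pose dl : R := (k == l)%:R.
  have -> : \int[mu]_x (dev k l x ^+ 2 * f x) =
      \int[mu]_x (1 * ((wv k x * wv l x) ^+ 2 * f x) +
        (- dl) * (2 * (wv k x * wv l x * f x) + (- dl) * f x)).
    by apply: eq_Rintegral => x _; rewrite /dev -/dl; ring.
  rewrite RintD2//; last by apply: itgD; exact: itgZ.
  rewrite (RintD2 _ _ ig intf) Eg f1 -/(fourth k l) -/dl.
  have : 0 <= dl * dl by rewrite -expr2 sqr_ge0.
  by have := ltW aN0; lra.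
have [ie le] := bernstein_mgf (devthr k l) Xind m B l0 lB E0 E2.
split => //; apply: le_trans le _; rewrite ler_expR lerN2 ler_wpM2l//.
have -> : lam k l * devthr k l - lam k l ^+ 2 * varproxy k l =
    devthr k l ^+ 2 / (4 * varproxy k l).
  by rewrite /lam; field; rewrite gt_eqF.
rewrite devthr2 le_eqVlt; apply/orP; left; apply/eqP.
by field; rewrite !gt_eqF.
Qed.

(* A sum of exponentials which dominates the indicator of the complement of the good
   event, so that no measure of an event has to be estimated. *)
Definition bad_bound (w : T) : R :=
  \sum_(k < N) \sum_(l < N) (exp_dev 1 k l w + exp_dev (-1) k l w).

Lemma bad_bound_ge0 w : 0 <= bad_bound w.
Proof.
by apply: sumr_ge0 => k _; apply: sumr_ge0 => l _; rewrite addr_ge0 ?expR_ge0.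
Qed.

Lemma bad_bound_ge1 w : ~ good_design (fun i => X i w) -> 1 <= bad_bound w.
Proof.
move/existsNP => [k /existsNP[l /negP]]; rewrite -ltNge => H.
have l0 : 0 <= lam k l by rewrite divr_ge0 ?sqrtr_ge0// mulr_ge0// ltW.
have key : 1 <= exp_dev 1 k l w + exp_dev (-1) k l w.
  have E e : \sum_(i < n) e * dev k l (X i w) = e * \sum_(i < n) dev k l (X i w).
    by rewrite mulr_sumr.
  rewrite /exp_dev !E mul1r mulN1r.
  have [s0|s0] := leP 0 (\sum_(i < n) dev k l (X i w)).
    rewrite (ger0_norm s0) in H; apply: ler_wpDr; first exact: expR_ge0.
    by apply: le_trans (expR_ge1Dx _); rewrite lerDl mulr_ge0// subr_ge0 ltW.
  rewrite (ltr0_norm s0) in H; apply: ler_wpDl; first exact: expR_ge0.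
  by apply: le_trans (expR_ge1Dx _); rewrite lerDl mulr_ge0// subr_ge0 ltW.
have e0 k' l' : 0 <= exp_dev 1 k' l' w + exp_dev (-1) k' l' w by rewrite addr_ge0 ?expR_ge0.
apply: le_trans key _; rewrite /bad_bound.
apply: le_trans (le_term_sum (F := fun l => exp_dev 1 k l w + exp_dev (-1) k l w) l (e0 k)) _.
apply: (le_term_sum (F := fun k => \sum_(l < N) (exp_dev 1 k l w + exp_dev (-1) k l w))) => i.
by apply: sumr_ge0 => j _; exact: e0.
Qed.

Lemma bad_bound_int : itg P bad_bound /\
  \int[P]_w bad_bound w <= 2 * N%:R ^+ 2 * expR (- (n%:R / (32 * a * N%:R))).
Proof.
have h1 k l := @exp_dev_int 1 k l (expr1n _ _).
have h2 k l : itg P (exp_dev (-1) k l) /\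
  \int[P]_w exp_dev (-1) k l w <= expR (- (n%:R / (32 * a * N%:R))).
  by apply: exp_dev_int; rewrite sqrrN expr1n.
have i1 k l : itg P (fun w => exp_dev 1 k l w + exp_dev (-1) k l w).
  by apply: itgD; [exact: (h1 k l).1|exact: (h2 k l).1].
have i2 k : itg P (fun w => \sum_(l < N) (exp_dev 1 k l w + exp_dev (-1) k l w)).
  exact: itg_sum.
split; first exact: itg_sum.
rewrite /bad_bound Rint_sum//.
apply: (@le_trans _ _ (\sum_(k < N) \sum_(l < N) (2 * expR (- (n%:R / (32 * a * N%:R)))))).
  apply: ler_sum => k _; rewrite Rint_sum//; apply: ler_sum => l _.
  rewrite RintegralD//; [|exact: (h1 k l).1|exact: (h2 k l).1].
  by rewrite mulr_natl mulr2n lerD//; [exact: (h1 k l).2|exact: (h2 k l).2].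
by rewrite !sumr_const card_ord -mulrnA -[_ *+ (N * N)]mulr_natr natrM; lra.
Qed.

End Tail.
End GoodDesign.

(** * Measurable functions of the sample *)

Section Observables.
Context {R : realType}.

Lemma measurable_invr : measurable_fun setT (@GRing.inv R).
Proof.
rewrite -(setUv [set 0 : R]); apply/measurable_funU => //.
  exact: measurableC.
split; first exact: measurable_fun_set1.
apply: open_continuous_measurable_fun.
  by apply: closed_openC; exact: closed_eq.
by move=> x; rewrite inE /= => /eqP x0; exact: inv_continuous.
Qed.

(* A measurable function of the sample, in a form which can be applied to the
   sigma-algebra generated by the sample. *)
Definition observable n (u : ('I_n -> R) -> R) : Prop :=
  forall d (T : measurableType d) (Y : 'I_n -> T -> R),
    (forall i, measurable_fun setT (Y i)) ->
    measurable_fun setT (fun w => u (fun i => Y i w)).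

Lemma observable_cst n c : observable (fun _ : 'I_n -> R => c).
Proof. by move=> d T Y mY; exact: measurable_cst. Qed.

Lemma observable_coord n (g : R -> R) (i : 'I_n) : measurable_fun setT g ->
  observable (fun x => g (x i)).
Proof. by move=> mg d T Y mY; exact: measurableT_comp. Qed.

Lemma observableM n (u v : ('I_n -> R) -> R) : observable u -> observable v ->
  observable (fun x => u x * v x).
Proof. by move=> mu mv d T Y mY; apply: measurable_funM; [exact: mu|exact: mv]. Qed.

Lemma observable_sum n (I : Type) (s : seq I) (u : I -> ('I_n -> R) -> R) :
  (forall i, observable (u i)) -> observable (fun x => \sum_(i <- s) u i x).
Proof. by move=> mu d T Y mY; apply: measurable_sum => i; exact: mu. Qed.

Lemma observable_prod n (I : eqType) (s : seq I) (u : I -> ('I_n -> R) -> R) :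
  (forall i, observable (u i)) -> observable (fun x => \prod_(i <- s) u i x).
Proof. by move=> mu d T Y mY; apply: measurable_prod => i _; exact: mu. Qed.

Definition observable_mx n p q (A : ('I_n -> R) -> 'M[R]_(p, q)) : Prop :=
  forall i j, observable (fun x => A x i j).

Lemma observable_ext n (u v : ('I_n -> R) -> R) : u =1 v -> observable u -> observable v.
Proof. by move=> /funext ->. Qed.

Lemma observable_mulmx n p q r (A : ('I_n -> R) -> 'M[R]_(p, q))
  (B : ('I_n -> R) -> 'M[R]_(q, r)) : observable_mx A -> observable_mx B ->
  observable_mx (fun x => A x *m B x).
Proof.
move=> mA mB i j; apply: (@observable_ext n (fun x => \sum_k A x i k * B x k j)).
  by move=> x; rewrite mxE.
by apply: observable_sum => k; apply: observableM.
Qed.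

Lemma observable_det n p (A : ('I_n -> R) -> 'M[R]_p) : observable_mx A ->
  observable (fun x => \det (A x)).
Proof.
move=> mA; apply: observable_sum => s; apply: observableM.
  exact: observable_cst.
by apply: observable_prod => i; exact: mA.
Qed.

Lemma observable_adj n p (A : ('I_n -> R) -> 'M[R]_p) : observable_mx A ->
  observable_mx (fun x => \adj (A x)).
Proof.
move=> mA i j.
apply: (@observable_ext n (fun x => (-1) ^+ (j + i) * \det (row' j (col' i (A x))))).
  by move=> x; rewrite mxE.
apply: observableM; first exact: observable_cst.
apply: observable_det => k l.
apply: (@observable_ext n (fun x => A x (lift j k) (lift i l))); last exact: mA.
by move=> x; rewrite !mxE.
Qed.

Lemma observable_invmx n p (A : ('I_n -> R) -> 'M[R]_p) : observable_mx A ->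
  observable_mx (fun x => invmx (A x)).
Proof.
move=> mA i j d T Y mY.
have mdet : measurable_fun setT (fun w => \det (A (fun i => Y i w))).
  exact: (observable_det mA).
(* Cramer's rule; on a singular matrix [invmx] returns the matrix itself. *)
rewrite (_ : (fun w => _) = (fun w => if \det (A (fun i => Y i w)) == 0 then A (fun i => Y i w) i j
  else (\det (A (fun i => Y i w)))^-1 * (\adj (A (fun i => Y i w))) i j)); last first.
  apply/funext => w; rewrite /invmx unitmxE unitfE.
  by case: eqVneq => //= _; rewrite mxE.
apply: measurable_fun_ifT.
- exact: measurable_fun_eqr.
- exact: mA.
- apply: measurable_funM; last exact: (observable_adj mA).
  by apply: measurableT_comp => //; exact: measurable_invr.
Qed.

Lemma observable_Phi_hat n m : observable_mx (fun x : 'I_n -> R => Phi_hat x m).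
Proof.
move=> i j; apply: (@observable_ext n (fun x => hermite j (x i))).
  by move=> x; rewrite mxE.
by apply: observable_coord; exact: meas_hermite.
Qed.

Lemma observable_trmx n p q (A : ('I_n -> R) -> 'M[R]_(p, q)) : observable_mx A ->
  observable_mx (fun x => (A x)^T).
Proof.
by move=> mA i j; apply: observable_ext (mA j i) => x; rewrite mxE.
Qed.

Lemma observable_scale n p q c (A : ('I_n -> R) -> 'M[R]_(p, q)) : observable_mx A ->
  observable_mx (fun x => c *: A x).
Proof.
move=> mA i j; apply: (@observable_ext n (fun x => c * A x i j)).
  by move=> x; rewrite mxE.
by apply: observableM => //; exact: observable_cst.
Qed.

Lemma observable_fit_op n p q (W : 'M[R]_(p, q)) :
  observable_mx (fun x : 'I_n -> R => fit_op x W).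
Proof.
apply: observable_mulmx.
  by apply: observable_mulmx; [exact: observable_Phi_hat|move=> i j; exact: observable_cst].
apply: observable_scale; apply: observable_mulmx.
  apply: observable_invmx; apply: observable_scale; apply: observable_mulmx.
    exact/observable_trmx/observable_Phi_hat.
  exact: observable_Phi_hat.
exact/observable_trmx/observable_Phi_hat.
Qed.

Context d (T : measurableType d) (P : probability T R).

(** The quantification over measurable types in [observable] is instantiated with the sample space
    carrying only the sigma-algebra generated by Z. *)
Lemma observable_sigma n (Z : 'I_n -> {RV P >-> R}) (u : ('I_n -> R) -> R) (A : set R) :
  observable u -> measurable A ->
  g_sigma_preimage (fun i => Z i : T -> R) ((fun w => u (fun i => Z i w)) @^-1` A).
Proof.
move=> mu mA.
pose G := \big[setU/set0]_(i < n) preimage_set_system setT (Z i : T -> R) measurable.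
have mZ (i : 'I_n) : measurable_fun setT (Z i : g_sigma_algebraType G -> R).
  move=> _ B mB; apply: sub_sigma_algebra; rewrite /G (bigD1 i)//=; left.
  by exists B.
have := mu _ (g_sigma_algebraType G) (fun i => Z i : g_sigma_algebraType G -> R) mZ.
by move=> /(_ measurableT A mA); rewrite setTI.
Qed.

Lemma indep_observables n (Z Z' : 'I_n -> {RV P >-> R}) (u v : ('I_n -> R) -> R) :
  independent_families Z Z' -> observable u -> observable v ->
  indep2 P (fun w => u (fun i => Z i w)) (fun w => v (fun i => Z' i w)).
Proof. by move=> I ou ov A B mA mB; apply: I; exact: observable_sigma. Qed.

Lemma indep_pair n (Z : 'I_n -> {RV P >-> R}) (i j : 'I_n) : mutually_independent Z ->
  i != j -> indep2 P (Z i) (Z j).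
Proof.
move=> I ij A B mA mB.
pose C (k : 'I_n) := if k == i then A else B.
have mC k : measurable (C k) by rewrite /C; case: ifP.
have := I [set i; j]%SET C mC.
rewrite (_ : \bigcap_(k in _) _ = Z i @^-1` A `&` Z j @^-1` B); last first.
  apply/seteqP; split => w /=.
    move=> H; split; first by have := H i (finset.set21 i j); rewrite /C eqxx.
    by have := H j (finset.set22 i j); rewrite /C eq_sym (negbTE ij).
  move=> [HA HB] k /=; rewrite !inE => /orP[] /eqP ->; rewrite /C ?eqxx//.
  by rewrite eq_sym (negbTE ij).
move=> ->; rewrite big_setU1/=; last by rewrite inE.
by rewrite big_set1 /C eqxx eq_sym (negbTE ij).
Qed.

End Observables.

(** * Risk of a linear estimator *)

Section Noise.
Context d (T : measurableType d) (R : realType) (P : probability T R).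

Lemma itg_avg n (F : 'I_n -> T -> R) (A : R) : (0 < n)%N ->
  (forall i, itg P (F i) /\ \int[P]_w F i w <= A) ->
  itg P (fun w => n%:R^-1 * \sum_(i < n) F i w) /\
  \int[P]_w (n%:R^-1 * \sum_(i < n) F i w) <= A.
Proof.
move=> n0 H; have nr0 : 0 < n%:R :> R by rewrite ltr0n.
have iS := itg_sum (fun i => (H i).1).
split; first exact: itgZ.
rewrite RintegralZl// Rint_sum; last by move=> i; exact: (H i).1.
rewrite mulrC ler_pdivrMr// mulr_natr -[X in _ <= _ *+ X](card_ord n) -sumr_const.
by apply: ler_sum => i _; exact: (H i).2.
Qed.

Lemma noise_sqr (e : {RV P >-> R}) (sigma : R) : ('E_P[e] = 0)%E ->
  ('V_P[e] = (sigma ^+ 2)%:E)%E ->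
  [/\ itg P e, \int[P]_w e w = 0, itg P (fun w => e w ^+ 2) &
      \int[P]_w (e w ^+ 2) = sigma ^+ 2].
Proof.
move=> E0 V.
have V2 : (\int[P]_w (e w ^+ 2)%:E)%E = (sigma ^+ 2)%:E.
  rewrite -V /variance covariance.unlock E0 expectation.unlock /=.
  apply: eq_integral => w _; congr EFin.
  by rewrite expr2 -[X in X * X]subr0.
have me : measurable_fun setT e by exact: measurable_funP.
have i2 : itg P (fun w => e w ^+ 2).
  apply: itg_fin; [exact: measurable_funX|by move=> w; exact: sqr_ge0|].
  by rewrite V2 ltry.
have i1 : itg P (fun=> 1) by exact: finite_measure_integrable_cst.
have ie : itg P e.
  apply: (itg_dom me (itgD i1 i2)) => w; rewrite -(real_normK (num_real (e w))).
  by have := sqr_ge0 (`|e w| - 2^-1); nra.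
split => //; last by rewrite /Rintegral V2.
by move: E0; rewrite expectation.unlock Rint_EFin// => -[].
Qed.

End Noise.

Section LinearEstimator.
Context {R : realType}.
Notation mu := (@lebesgue_measure R).
Variables (N p q n : nat) (W : 'M[R]_(p, q)) (c L B F : R).
Hypotheses (n0 : (0 < n)%N) (N0 : (0 < N)%N) (pN : (p <= N)%N) (qN : (q <= N)%N).
Hypotheses (c0 : 0 <= c) (HW : forall w : 'cV[R]_q, nsq (W *m w) <= c * nsq w).
Hypotheses (L0 : 0 <= L) (HL : forall t : R, \sum_(j < N) hermite j t ^+ 2 <= L).
Variables (b f : R -> R) (sigma : R).
Hypotheses (mf : measurable_fun setT f) (f0 : forall x, 0 <= f x) (fF : forall x, f x <= F).
Hypotheses (intf : itg mu f) (f1 : \int[mu]_x f x = 1).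
Hypotheses (B0 : 0 < B) (HB : coercive B^-1 (Psi f N)).
Variables (theta : 'cV[R]_q) (lam2 rmax bbeta br : R).
Hypothesis lam20 : 0 < lam2.
Let db := derive1 b.

Definition approx_err (t : R) : R := \sum_(j < p) hermite j t * (W *m theta) j ord0 - db t.
Definition trunc_err (t : R) : R := b t - \sum_(j < q) hermite j t * theta j ord0.

Hypotheses (sbeta : sqi mu approx_err) (Ibeta : \int[mu]_x (approx_err x ^+ 2) <= bbeta).
Hypotheses (sr : sqi mu trunc_err) (Ir : \int[mu]_x (trunc_err x ^+ 2) <= br).
Hypothesis rsup : forall x, trunc_err x ^+ 2 <= rmax.

(** The two truncated estimators enter only through these properties: [Lam] lies between two
    coercivity conditions on the Gram matrix, the fitted values are linear in y on [Lam], and the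
    estimator vanishes off it. *)
Variables (Lam : ('I_n -> R) -> Prop) (est : ('I_n -> R) -> ('I_n -> R) -> R -> R).
Hypothesis Hgood : forall x, coercive (2 * B)^-1 (Psi_hat x N) -> Lam x.
Hypothesis Hlam : forall x, Lam x -> coercive lam2 (Psi_hat x N).
Hypothesis Hest : forall x y i, Lam x -> est x y (x i) = (fit_op x W *m Y_vec y) i ord0.
Hypothesis Hest0 : forall x y t, ~ Lam x -> est x y t = 0.

Let nr0 : 0 < n%:R :> R. Proof. by rewrite ltr0n. Qed.
Let B20 : 0 < (2 * B)^-1. Proof. by rewrite invr_gt0 mulr_gt0. Qed.
Let F0 : 0 <= F. Proof. exact: le_trans (f0 0) (fF 0). Qed.

Lemma normalizer_exists : exists S : 'M[R]_N,
  S^T *m Psi f N *m S = 1%:M /\ forall x, nsq (S^T *m phiv N x) <= L * B.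
Proof.
have bi0 : 0 < B^-1 by rewrite invr_gt0.
have [S HS] : exists S : 'M[R]_N, S^T *m Psi f N *m S = 1%:M.
  apply: cholesky; first exact: Psi_sym.
  move=> u u0; apply: lt_le_trans (HB u); rewrite mulr_gt0// lt_neqAle nsq_ge0 andbT.
  by apply: contra_neq u0 => /esym; exact: nsq_eq0.
exists S; split => // x.
have := nsq_cholesky (phiv N x) bi0 HB HS.
rewrite mulrC ler_pdivrMr// => h; apply: le_trans h _; rewrite ler_wpM2r ?(ltW B0)//.
by apply: le_trans (HL x); apply: ler_sum => j _; rewrite mxE.
Qed.

Variable S : 'M[R]_N.
Hypotheses (HS : S^T *m Psi f N *m S = 1%:M) (Sa : forall x, nsq (S^T *m phiv N x) <= L * B).

Let good (x : 'I_n -> R) := good_design f S (L * B) x.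

Lemma good_coercive x : good x -> coercive (2 * B)^-1 (Psi_hat x N).
Proof.
move=> gx u; have fr := good_design_frob f0 intf f1 N0 HS Sa n0 gx.
have /andP[h _] := qf_close HS fr u; apply: le_trans h.
by rewrite invfM -mulrA ler_wpM2l// HB.
Qed.

Lemma good_upper x (u : 'cV[R]_N) : good x -> qf (Psi_hat x N) u <= 3 / 2 * F * nsq u.
Proof.
move=> gx; have fr := good_design_frob f0 intf f1 N0 HS Sa n0 gx.
have /andP[_ h] := qf_close HS fr u; apply: le_trans h _.
by rewrite -[leRHS]mulrA; apply: ler_wpM2l; [rewrite divr_ge0|exact: qf_Psi_le].
Qed.

Definition avg_sqr (g : R -> R) (x : 'I_n -> R) : R := n%:R^-1 * \sum_(i < n) g (x i) ^+ 2.

Definition fit_noise (x e : 'I_n -> R) : R := n%:R^-1 * nsq (fit_op x W *m (\col_i e i)).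

Let Y (x e : 'I_n -> R) : 'I_n -> R := fun i => b (x i) + e i.
Let emp (x e : 'I_n -> R) : R := emp_norm2 x (fun t => est x (Y x e) t - db t).

Let rvec (x : 'I_n -> R) : 'cV[R]_n := \col_i trunc_err (x i).
Let evec (e : 'I_n -> R) : 'cV[R]_n := \col_i e i.

Lemma est_decomp x e i : Lam x -> est x (Y x e) (x i) - db (x i) =
  approx_err (x i) + (fit_op x W *m (rvec x + evec e)) i ord0.
Proof.
move=> lx; rewrite Hest//.
have cq := coercive_pad qN (Hlam lx).
have -> : Y_vec (Y x e) = Phi_hat x q *m theta + (rvec x + evec e).
  apply/colP => j; rewrite !mxE /Y /trunc_err.
  have -> : \sum_k Phi_hat x q j k * theta k ord0 = \sum_(k < q) hermite k (x j) * theta k ord0.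
    by apply: eq_bigr => k _; rewrite mxE.
  by ring.
rewrite mulmxDr mxE /approx_err.
have -> : (fit_op x W *m (Phi_hat x q *m theta)) i ord0 =
   \sum_(j < p) hermite j (x i) * (W *m theta) j ord0.
  rewrite /fit_op -!mulmxA (lse_exact lam20 cq) mxE.
  by apply: eq_bigr => j _; rewrite mxE.
by ring.
Qed.

Lemma nsq_rvec x : n%:R^-1 * nsq (rvec x) = avg_sqr trunc_err x.
Proof. by congr (_ * _); apply: eq_bigr => i _; rewrite mxE. Qed.

Lemma nsq_evec e : n%:R^-1 * nsq (evec e) = avg_sqr id e.
Proof. by congr (_ * _); apply: eq_bigr => i _; rewrite mxE. Qed.

(** In [C1], 3 comes from the square of a sum of three terms, 3/2 F bounds [Psi_hat] from above on
    the good event, and 2 B bounds its inverse. [C2] uses L and 1 / lam2 instead, valid on all of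
    [Lam]. *)
Let C1 : R := 3 * (3 / 2 * F * (c * (2 * B))).
Let C2 : R := 4 * (L * (c / lam2)).

(* On the good event the random design is equivalent to the population one. *)
Lemma emp_good x e : good x ->
  emp x e <= 3 * avg_sqr approx_err x + C1 * avg_sqr trunc_err x + 3 * fit_noise x e.
Proof.
move=> gx; have cN := good_coercive gx; have lx := Hgood cN.
have cq := coercive_pad qN cN.
have ub := Psi_hat_ub_pad pN (fun u => good_upper u gx).
have F32 : 0 <= 3 / 2 * F by rewrite mulr_ge0// divr_ge0.
have H := nsq_fit B20 cq c0 HW (rvec x) F32 ub.
rewrite nsq_rvec invrK in H.
have -> : C1 * avg_sqr trunc_err x =
    3 * (3 / 2 * F * (c * (2 * B)) * avg_sqr trunc_err x) by rewrite /C1; ring.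
apply: (@le_trans _ _ (3 * avg_sqr approx_err x +
   3 * (n%:R^-1 * nsq (fit_op x W *m rvec x)) + 3 * fit_noise x e)); last first.
  by rewrite lerD2r lerD2l ler_wpM2l.
have E (u v w : R) : 3 * (n%:R^-1 * u) + 3 * (n%:R^-1 * v) + 3 * (n%:R^-1 * w) =
    n%:R^-1 * (3 * (u + v + w)) by ring.
rewrite /emp /emp_norm2 /avg_sqr /fit_noise E ler_wpM2l ?invr_ge0 ?(ltW nr0)//.
rewrite /nsq -!big_split/= mulr_sumr; apply: ler_sum => i _.
rewrite est_decomp// mulmxDr [X in _ + X]mxE.
set u := approx_err _; set v := (fit_op x W *m rvec x) i ord0; set w := (fit_op x W *m evec e) _ _.
by have := sqr_ge0 (u - v); have := sqr_ge0 (u - w); have := sqr_ge0 (v - w); nra.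
Qed.

(* A bound valid for every design: where the estimator is truncated its error is b',
   elsewhere the truncation itself bounds the inverse of the Gram matrix. *)
Lemma emp_bad x e :
  emp x e <= 3 * avg_sqr approx_err x + (C2 * (rmax + avg_sqr id e) + avg_sqr db x).
Proof.
have avg0 g y : 0 <= avg_sqr g y.
  by rewrite mulr_ge0 ?invr_ge0 ?(ltW nr0)//; apply: sumr_ge0 => i _; exact: sqr_ge0.
have rm0 : 0 <= rmax by apply: le_trans (rsup 0); exact: sqr_ge0.
have C20 : 0 <= C2.
  by rewrite /C2 mulr_ge0// mulr_ge0// divr_ge0// ltW.
have [lx|lx] := pselect (Lam x); last first.
  apply: (@le_trans _ _ (avg_sqr db x)).
    rewrite /emp /emp_norm2 /avg_sqr ler_wpM2l ?invr_ge0 ?(ltW nr0)//.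
    by apply: ler_sum => i _; rewrite Hest0// sub0r sqrrN.
  rewrite addrA lerDr addr_ge0//; first by rewrite mulr_ge0.
  by rewrite mulr_ge0// addr_ge0.
have cN := Hlam lx; have cq := coercive_pad qN cN.
have ub := Psi_hat_ub_pad pN (Psi_hat_ub_trivial x n0 HL).
have H := nsq_fit lam20 cq c0 HW (rvec x + evec e) L0 ub.
have r2 : avg_sqr trunc_err x <= rmax.
  rewrite /avg_sqr mulrC ler_pdivrMr// mulr_natr -[X in _ <= _ *+ X](card_ord n) -sumr_const.
  by apply: ler_sum => i _; exact: rsup.
have H2 : 2 * (n%:R^-1 * nsq (fit_op x W *m (rvec x + evec e))) <= C2 * (rmax + avg_sqr id e).
  apply: (@le_trans _ _ (2 * (L * (c / lam2) * (n%:R^-1 * nsq (rvec x + evec e))))).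
    by rewrite ler_wpM2l.
  have -> : C2 * (rmax + avg_sqr id e) = 2 * (L * (c / lam2) * (2 * (rmax + avg_sqr id e))).
    by rewrite /C2; ring.
  rewrite ler_wpM2l// ler_wpM2l//; first by rewrite mulr_ge0// divr_ge0// ltW.
  apply: (@le_trans _ _ (n%:R^-1 * (2 * (nsq (rvec x) + nsq (evec e))))).
    by rewrite ler_wpM2l ?invr_ge0 ?(ltW nr0)//; exact: nsqD_le.
  by rewrite mulrCA mulrDr nsq_rvec nsq_evec ler_wpM2l// lerD2r.
rewrite addrA; apply: ler_wpDr => //.
apply: (@le_trans _ _ (3 * avg_sqr approx_err x +
   2 * (n%:R^-1 * nsq (fit_op x W *m (rvec x + evec e))))); last by rewrite lerD2l.
have E (u v : R) : 3 * (n%:R^-1 * u) + 2 * (n%:R^-1 * v) = n%:R^-1 * (3 * u + 2 * v) by ring.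
rewrite /emp /emp_norm2 /avg_sqr E ler_wpM2l ?invr_ge0 ?(ltW nr0)//.
rewrite /nsq !mulr_sumr -big_split/=; apply: ler_sum => i _.
rewrite est_decomp//; set u := approx_err _; set v := (_ *m _) i ord0.
by have := sqr_ge0 (u - v); have := sqr_ge0 u; nra.
Qed.

Definition good_ind (x : 'I_n -> R) : R := if `[< good x >] then 1 else 0.

Lemma observable_good_ind : observable good_ind.
Proof.
move=> d T Z mZ.
have mG := @measurable_good_design _ f N S (L * B) n d T Z mZ.
rewrite (_ : (fun w => _) = \1_[set w | good (fun i => Z i w)]); first exact: measurable_indic.
apply/funext => w; rewrite /good_ind indicE.
have [h|h] := pselect (good (fun i => Z i w)).
  by rewrite mem_set// asboolT.
by rewrite memNset// asboolF.
Qed.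

Lemma good_ind01 x : 0 <= good_ind x <= 1.
Proof. by rewrite /good_ind; case: ifP => _; rewrite ?lexx ?ler01. Qed.

Lemma fit_entry_sum x i :
  good_ind x * \sum_k fit_op x W i k ^+ 2 <= n%:R^-1 * (c * L / (2 * B)^-1).
Proof.
have C0 : 0 <= n%:R^-1 * (c * L / (2 * B)^-1).
  apply: mulr_ge0; first by rewrite invr_ge0 ltW.
  by apply: divr_ge0; [exact: mulr_ge0|exact: ltW].
rewrite /good_ind; have [gx|gx] := pselect (good x); last by rewrite asboolF// mul0r.
rewrite asboolT//.
rewrite mul1r; have cq := coercive_pad qN (good_coercive gx).
apply: (fit_op_row_sqr n0 B20 cq c0 HW).
apply: le_trans (HL (x i)).
rewrite (big_ord_widen N (fun j => hermite j (x i) ^+ 2) pN) [leRHS](bigID (fun j : 'I_N => (j < p)%N))/=.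
by rewrite lerDl; apply: sumr_ge0 => j _; exact: sqr_ge0.
Qed.

Context d (T : measurableType d) (P : probability T R).
Variables (X eps : 'I_n -> {RV P >-> R}).
Hypothesis Xind : mutually_independent X.
Hypothesis Xf : forall (i : 'I_n) (A : set R), measurable A ->
  distribution P (X i) A = (\int[mu]_(x in A) (f x)%:E)%E.
Hypotheses (Eind : mutually_independent eps) (XE : independent_families X eps).
Hypothesis E0 : forall i, ('E_P[eps i] = 0)%E.
Hypothesis EV : forall i, ('V_P[eps i] = (sigma ^+ 2)%:E)%E.

Let xw (w : T) : 'I_n -> R := fun i => X i w.
Let ew (w : T) : 'I_n -> R := fun i => eps i w.

Lemma noise_pair k l : itg P (fun w => eps k w * eps l w) /\
  \int[P]_w (eps k w * eps l w) = (k == l)%:R * sigma ^+ 2.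
Proof.
have [ik Ek ik2 Ek2] := noise_sqr (E0 k) (EV k).
have [->|kl] := eqVneq k l.
  have [il El il2 El2] := noise_sqr (E0 l) (EV l).
  rewrite mul1r -El2; split; first by apply: itg_eq il2 => w; rewrite expr2.
  by apply: eq_Rintegral => w _; rewrite expr2.
have [il El _ _] := noise_sqr (E0 l) (EV l).
have [i E] := indep2_mul ik il (indep_pair Eind kl).
by split => //; rewrite E Ek mul0r mul0r.
Qed.

(** The square is expanded into a double sum over the noise. Its coefficients depend on X alone and
    are bounded thanks to the indicator, so independence applies to each term; the off-diagonal
    terms vanish. *)
Lemma fit_noise_int :
  itg P (fun w => good_ind (xw w) * fit_noise (xw w) (ew w)) /\
  \int[P]_w (good_ind (xw w) * fit_noise (xw w) (ew w)) <=
    sigma ^+ 2 * (n%:R^-1 * (c * L / (2 * B)^-1)).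
Proof.
pose U i k l x := good_ind x * (fit_op x W i k * fit_op x W i l).
pose G i w := \sum_k \sum_l U i k l (xw w) * (eps k w * eps l w).
set C := n%:R^-1 * (c * L / (2 * B)^-1).
have obsF i k : observable (fun x : 'I_n -> R => fit_op x W i k) by exact: observable_fit_op.
have obsU i k l : observable (U i k l).
  by apply: observableM; [exact: observable_good_ind|exact: observableM].
have bU i k l x : `|U i k l x| <= C.
  apply: le_trans (fit_entry_sum x i); have /andP[g0 g1] := good_ind01 x.
  rewrite /U normrM (ger0_norm g0) ler_wpM2l//.
  have hk : fit_op x W i k ^+ 2 <= \sum_k fit_op x W i k ^+ 2.
    by apply: (le_term_sum (F := fun k => fit_op x W i k ^+ 2)) => j; exact: sqr_ge0.
  have hl : fit_op x W i l ^+ 2 <= \sum_k fit_op x W i k ^+ 2.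
    by apply: (le_term_sum (F := fun k => fit_op x W i k ^+ 2)) => j; exact: sqr_ge0.
  move: hk hl; rewrite normrM -(real_normK (num_real (fit_op x W i k))).
  rewrite -(real_normK (num_real (fit_op x W i l))) => hk hl.
  by have := sqr_ge0 (`|fit_op x W i k| - `|fit_op x W i l|); nra.
have iU i k l : itg P (fun w => U i k l (xw w)).
  apply: (@itg_dom _ _ _ _ _ (fun=> C)).
  - by apply: obsU => j; exact: measurable_funP.
  - exact: finite_measure_integrable_cst.
  - by move=> w; exact: bU.
have UV i k l : itg P (fun w => U i k l (xw w) * (eps k w * eps l w)) /\
  \int[P]_w (U i k l (xw w) * (eps k w * eps l w)) =
    (\int[P]_w U i k l (xw w)) * ((k == l)%:R * sigma ^+ 2).
  have [iV EVkl] := noise_pair k l.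
  have oV : observable (fun y : 'I_n -> R => y k * y l).
    by apply: observableM; apply: (@observable_coord _ _ id) => //; exact: measurable_id.
  have I := indep_observables XE (obsU i k l) oV.
  by have [i1 i2] := indep2_mul (iU i k l) iV I; split => //; rewrite i2 EVkl.
have gE w i : good_ind (xw w) * (fit_op (xw w) W *m evec (ew w)) i ord0 ^+ 2 = G i w.
  rewrite mxE expr2 mulr_suml mulr_sumr; apply: eq_bigr => k _.
  rewrite mulr_sumr mulr_sumr; apply: eq_bigr => l _.
  have ev j : evec (ew w) j ord0 = eps j w by rewrite mxE.
  by rewrite !ev /U; ring.
have iG i : itg P (G i) /\ \int[P]_w G i w <= sigma ^+ 2 * C.
  have i1 k : itg P (fun w => \sum_l U i k l (xw w) * (eps k w * eps l w)).
    by apply: itg_sum => l; exact: (UV i k l).1.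
  split; first exact: itg_sum.
  rewrite /G Rint_sum//.
  have -> : \sum_k \int[P]_w (\sum_l U i k l (xw w) * (eps k w * eps l w)) =
      \sum_k sigma ^+ 2 * \int[P]_w U i k k (xw w).
    apply: eq_bigr => k _; rewrite Rint_sum; last by move=> l; exact: (UV i k l).1.
    rewrite (bigD1 k)//= (UV i k k).2 eqxx big1 ?addr0; first by rewrite mul1r mulrC.
    by move=> l lk; rewrite (UV i k l).2 eq_sym (negbTE lk) mul0r mulr0.
  rewrite -mulr_sumr ler_wpM2l ?sqr_ge0// -Rint_sum// -[leRHS](Rint_cst P C).
  apply: Rint_le; [exact: itg_sum|exact: finite_measure_integrable_cst|].
  move=> w; apply: le_trans (fit_entry_sum (xw w) i).
  by rewrite mulr_sumr /U; apply: ler_sum => k _; rewrite -expr2.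
have [i1 i2] := itg_avg n0 iG.
have E w : n%:R^-1 * \sum_(i < n) G i w = good_ind (xw w) * fit_noise (xw w) (ew w).
  rewrite /fit_noise mulrCA; congr (_ * _); rewrite /nsq mulr_sumr.
  by apply: eq_bigr => i _; rewrite gE.
split; first by apply: itg_eq i1 => w; exact: E.
apply: le_trans i2; rewrite le_eqVlt; apply/orP; left; apply/eqP.
by apply: eq_Rintegral => w _; rewrite E.
Qed.

Let pG : R := 2 * N%:R ^+ 2 * expR (- (n%:R / (32 * (L * B) * N%:R))).
Let Z : T -> R := bad_bound f S (L * B) X.

Lemma bad_ind_int : itg P (fun w => 1 - good_ind (xw w)) /\
  \int[P]_w (1 - good_ind (xw w)) <= pG.
Proof.
have [iZ EZ] := bad_bound_int f0 intf f1 N0 HS Sa mf Xind Xf.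
have g01 w : 0 <= 1 - good_ind (xw w) <= Z w.
  rewrite /good_ind; have [h|h] := pselect (good (xw w)).
    by rewrite asboolT// subrr lexx bad_bound_ge0.
  by rewrite asboolF// subr0 ler01 (bad_bound_ge1 f0 intf f1 N0 HS Sa h).
have i1 : itg P (fun w => 1 - good_ind (xw w)).
  apply: (itg_dom _ iZ) => [|w]; last by have /andP[h1 h2] := g01 w; rewrite ger0_norm.
  apply: measurable_funB => //; apply: observable_good_ind => i; exact: measurable_funP.
split => //; apply: le_trans EZ; apply: Rint_le => // w.
by have /andP[] := g01 w.
Qed.

(** The bad event depends on X alone, so it is independent of the noise and the expectation
    factors. *)
Lemma bad_noise_int i : itg P (fun w => (1 - good_ind (xw w)) * eps i w ^+ 2) /\
  \int[P]_w ((1 - good_ind (xw w)) * eps i w ^+ 2) <= pG * sigma ^+ 2.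
Proof.
have [_ _ i2 E2] := noise_sqr (E0 i) (EV i); have [i1 E1] := bad_ind_int.
have o1 : observable (fun x : 'I_n -> R => 1 - good_ind x).
  by move=> d' T' Y' mY; apply: measurable_funB => //; exact: observable_good_ind.
have o2 : observable (fun y : 'I_n -> R => y i ^+ 2).
  by apply: (@observable_coord _ _ (fun t => t ^+ 2)); exact: measurable_funX.
have [j1 j2] := indep2_mul i1 i2 (indep_observables XE o1 o2).
by split => //; rewrite j2 E2 ler_wpM2r// sqr_ge0.
Qed.

Variables (M eta : R).
Hypotheses (eta0 : 0 < eta).
Hypothesis M4 : forall i, itg P (fun w => db (X i w) ^+ 4) /\
  \int[P]_w (db (X i w) ^+ 4) <= M.

(* The last two terms come from 2 b'^2 <= eta b'^4 + 1 / eta on the bad event. *)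
Definition tot (w : T) : R :=
  3 * avg_sqr approx_err (xw w) + C1 * avg_sqr trunc_err (xw w)
  + 3 * (good_ind (xw w) * fit_noise (xw w) (ew w))
  + C2 * (rmax * (1 - good_ind (xw w))
          + n%:R^-1 * \sum_i (1 - good_ind (xw w)) * eps i w ^+ 2)
  + (eta / 2 * (n%:R^-1 * \sum_i db (X i w) ^+ 4) + (2 * eta)^-1 * (1 - good_ind (xw w))).

Let avg0 g y : 0 <= avg_sqr g y.
Proof.
by rewrite mulr_ge0 ?invr_ge0 ?(ltW nr0)//; apply: sumr_ge0 => i _; exact: sqr_ge0.
Qed.

Let C20 : 0 <= C2.
Proof. by rewrite /C2 mulr_ge0// mulr_ge0// divr_ge0// ltW. Qed.

Let C10 : 0 <= C1.
Proof.
rewrite /C1 mulr_ge0// mulr_ge0//; first by rewrite mulr_ge0// divr_ge0.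
by rewrite mulr_ge0// mulr_ge0// ltW.
Qed.

Lemma emp_le_tot w : emp (xw w) (ew w) <= tot w.
Proof.
have avg4 : 0 <= n%:R^-1 * \sum_i db (X i w) ^+ 4.
  rewrite mulr_ge0 ?invr_ge0 ?(ltW nr0)//; apply: sumr_ge0 => i _.
  by rewrite (exprM _ 2 2) sqr_ge0.
have eta20 : 0 <= eta / 2 by rewrite divr_ge0// ltW.
rewrite /tot /good_ind; have [h|h] := pselect (good (xw w)).
  rewrite asboolT// subrr !mulr0 mul1r add0r addr0.
  rewrite big1; last by move=> i _; rewrite mul0r.
  rewrite !mulr0 addr0; apply: ler_wpDr; first exact: mulr_ge0.
  exact: emp_good.
rewrite asboolF// subr0 mul0r !mulr0 addr0 !mulr1.
apply: le_trans (emp_bad _ _) _.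
rewrite (eq_bigr (fun i => ew w i ^+ 2)); last by move=> i _; rewrite mul1r.
rewrite addrA; apply: lerD.
  by rewrite lerD2r lerDl mulr_ge0.
rewrite /avg_sqr.
have -> : (2 * eta)^-1 = n%:R^-1 * \sum_(i < n) (2 * eta)^-1.
  by rewrite sumr_const card_ord -[(2 * eta)^-1 *+ n]mulr_natl mulKf// gt_eqF.
rewrite mulrCA -mulrDr ler_wpM2l ?invr_ge0 ?(ltW nr0)// mulr_sumr -big_split/=.
apply: ler_sum => i _.
have -> : db (xw w i) ^+ 2 = eta / 2 * db (xw w i) ^+ 4 + (2 * eta)^-1
   - eta / 2 * (db (xw w i) ^+ 2 - eta^-1) ^+ 2.
  by field; rewrite gt_eqF.
by rewrite gerBl mulr_ge0// sqr_ge0.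
Qed.

Definition risk_ub : R :=
  3 * (F * bbeta) + C1 * (F * br) + 3 * (sigma ^+ 2 * (n%:R^-1 * (c * L / (2 * B)^-1)))
  + C2 * (rmax * pG + pG * sigma ^+ 2) + (eta / 2 * M + (2 * eta)^-1 * pG).

Lemma tot_int : itg P tot /\ \int[P]_w tot w <= risk_ub.
Proof.
have rm0 : 0 <= rmax by apply: le_trans (rsup 0); exact: sqr_ge0.
have avgI g bd : sqi mu g -> \int[mu]_x (g x ^+ 2) <= bd ->
   itg P (fun w => avg_sqr g (xw w)) /\ \int[P]_w avg_sqr g (xw w) <= F * bd.
  move=> sg bg; apply: itg_avg => // i.
  have [i1 i2] := law_sqi mf f0 (Xf i) fF sg; split => //.
  by apply: le_trans i2 _; rewrite ler_wpM2l.
have [i1 e1] := avgI _ _ sbeta Ibeta; have [i2 e2] := avgI _ _ sr Ir.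
have [i3 e3] := fit_noise_int; have [ig eg] := bad_ind_int.
have [i4 e4] := itg_avg n0 bad_noise_int; have [i5 e5] := itg_avg n0 M4.
have addI (u v : T -> R) a b' : itg P u /\ \int[P]_w u w <= a -> itg P v /\ \int[P]_w v w <= b' ->
    itg P (fun w => u w + v w) /\ \int[P]_w (u w + v w) <= a + b'.
  by move=> [iu eu] [iv ev]; split; [exact: itgD|rewrite RintegralD// lerD].
have mulI k (u : T -> R) a : 0 <= k -> itg P u /\ \int[P]_w u w <= a ->
    itg P (fun w => k * u w) /\ \int[P]_w (k * u w) <= k * a.
  by move=> k0 [iu eu]; split; [exact: itgZ|rewrite (RintegralZl _ _ iu)// ler_wpM2l].
have e20 : 0 <= eta / 2 by rewrite divr_ge0// ltW.
have e2i : 0 <= (2 * eta)^-1 by rewrite invr_ge0 mulr_ge0// ltW.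
have h3 : 0 <= 3 :> R by [].
pose A1 := addI _ _ _ _ (mulI _ _ _ h3 (conj i1 e1)) (mulI _ _ _ C10 (conj i2 e2)).
pose A3 := addI _ _ _ _ A1 (mulI _ _ _ h3 (conj i3 e3)).
pose A4 := addI _ _ _ _ (mulI _ _ _ rm0 (conj ig eg)) (conj i4 e4).
pose A5 := addI _ _ _ _ (mulI _ _ _ e20 (conj i5 e5)) (mulI _ _ _ e2i (conj ig eg)).
exact: (addI _ _ _ _ (addI _ _ _ _ A3 (mulI _ _ _ C20 A4)) A5).
Qed.

Lemma risk_le : (risk b X eps est <= risk_ub%:E)%E.
Proof.
have [it et] := tot_int.
rewrite /risk expectation.unlock.
apply: (@le_trans _ _ (\int[P]_w (tot w)%:E)%E); last by rewrite Rint_EFin// lee_fin.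
apply: ge0_integral_mono => w; apply/andP; split; last exact: emp_le_tot.
by rewrite mulr_ge0 ?invr_ge0 ?(ltW nr0)//; apply: sumr_ge0 => i _; exact: sqr_ge0.
Qed.

End LinearEstimator.

(** * The two estimators *)

Section Stability.
Context {R : realType}.

Lemma stableE n K a m (A : 'M[R]_m) : 0 < K -> (0 < m)%N ->
  stable n K a A <-> A \in unitmx /\
    K * Num.sqrt m%:R * Order.max (opnorm (invmx A)) 1 <= a * (n%:R / ln n%:R).
Proof.
move=> K0 m0; have L0 : 0 < K * Num.sqrt m%:R by rewrite mulr_gt0// sqrtr_gt0 ltr0n.
rewrite /stable /opnorm_inv; case: ifPn => uA.
  by rewrite -EFin_max -EFinM lee_fin; split => [h|[]].
by split => [|[]//]; rewrite maxye gt0_muley ?lte_fin// leye_eq.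
Qed.

Lemma stable_coercive n (x : 'I_n -> R) K a m : 0 < K -> (0 < m)%N -> (0 < n)%N ->
  stable n K a (Psi_hat x m) ->
  coercive (K * Num.sqrt m%:R / (a * (n%:R / ln n%:R))) (Psi_hat x m).
Proof.
move=> K0 m0 n0 /(stableE _ _ _ K0 m0)[uA].
have L0 : 0 < K * Num.sqrt m%:R by rewrite mulr_gt0// sqrtr_gt0 ltr0n.
set L := K * _ in L0 *; set r := a * _ => H.
have h1 : L <= r.
  by apply: le_trans H; rewrite ler_pMr// le_max lexx orbT.
have r0 := lt_le_trans L0 h1.
rewrite -[L / r]invf_div; apply: opnorm_coercive => //.
- exact: Psi_hat_sym.
- by move=> u; exact: Psi_hat_psd.
- rewrite ler_pdivlMr// mulrC; apply: le_trans H; rewrite ler_wpM2l ?(ltW L0)//.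
  by rewrite le_max lexx.
- by rewrite divr_gt0.
Qed.

(** Passing from Psi to Psi_hat doubles the bound on the inverse, and a / 2 becomes a. *)
Lemma coercive_stable n (x : 'I_n -> R) K a m (A : 'M[R]_m) : 0 < K -> (0 < m)%N ->
  stable n K (a / 2) A ->
  coercive (2 * Order.max (opnorm (invmx A)) 1)^-1 (Psi_hat x m) ->
  stable n K a (Psi_hat x m).
Proof.
move=> K0 m0 /(stableE _ _ _ K0 m0)[uA HA] H; apply/stableE => //.
set B := Order.max _ 1 in HA H.
have B1 : 1 <= B by rewrite le_max lexx orbT.
have B20 : 0 < (2 * B)^-1 by rewrite invr_gt0 mulr_gt0// (lt_le_trans ltr01).
split; first exact: coercive_unitmx B20 H.
have := coercive_opnorm B20 H; rewrite invrK => h.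
have L0 : 0 <= K * Num.sqrt m%:R by rewrite mulr_ge0 ?sqrtr_ge0// ltW.
apply: (@le_trans _ _ (K * Num.sqrt m%:R * (2 * B))); last by move: HA; lra.
by rewrite ler_wpM2l// ge_max h; lra.
Qed.

End Stability.

Section FittedValues.
Context {R : realType}.
Variables (n : nat) (x y : 'I_n -> R) (m : nat) (i : 'I_n).

Lemma derive1_hermite j (t : R) : derive1 (hermite j) t = dhermite j t.
Proof. by rewrite derive1E; have := @is_derive_hermite R j t => h; rewrite derive_val. Qed.

Lemma b_hat1_fit : b_hat1 x y m (x i) = (fit_op x (Delta m)^T *m Y_vec y) i ord0.
Proof.
have -> : fit_op x (Delta m)^T *m Y_vec y =
    Phi_hat x m.+1 *m ((Delta m)^T *m theta_hat1 x y m).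
  have E : lse_op x m *m Y_vec y = theta_hat1 x y m by rewrite /lse_op -scalemxAl.
  by rewrite -E /fit_op -!mulmxA.
rewrite mxE.
transitivity (\sum_(k < m.+1) \sum_(j < m) theta_hat1 x y m j ord0 * (Delta m j k * hermite k (x i))).
  rewrite exchange_big; apply: eq_bigr => j _ /=.
  rewrite -mulr_sumr (Delta_sum (fun k => hermite k (x i))) derive1_hermite /dhermite.
  rewrite inordK; last by rewrite (leq_ltn_trans (leq_pred j))// ltnW// ltnS.
  by rewrite inordK// ltnS.
apply: eq_bigr => k _; rewrite !mxE mulr_sumr; apply: eq_bigr => j _.
by rewrite [(Delta m)^T _ _]mxE; ring.
Qed.

Lemma b_hat2_fit : b_hat2 x y m (x i) = (fit_op x (- Delta m) *m Y_vec y) i ord0.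
Proof.
have -> : fit_op x (- Delta m) *m Y_vec y = Phi_hat x m *m theta_hat2 x y m.
  have E : - Delta m *m (lse_op x m.+1 *m Y_vec y) = theta_hat2 x y m.
    by rewrite /lse_op -scalemxAl -scalemxAr mulNmx /theta_hat2 scaleNr scalerN !mulmxA.
  by rewrite -E /fit_op -!mulmxA.
by rewrite mxE; apply: eq_bigr => j _; rewrite [Phi_hat _ _ _ _]mxE mulrC.
Qed.

End FittedValues.

Section EstimatorRisk.
Context {R : realType}.
Notation mu := (@lebesgue_measure R).
Context d (T : measurableType d) (P : probability T R).
Variables (b f : R -> R) (sigma : R) (n m : nat) (X eps : 'I_n -> {RV P >-> R}).
Variables (K F s D M eta : R).
Hypotheses (K0 : 0 < K) (HK : forall (m : nat) (x : R),
  \sum_(j < m) hermite j x ^+ 2 <= K * Num.sqrt m%:R).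
Hypotheses (n0 : (0 < n)%N) (m0 : (0 < m)%N) (s1 : 1 <= s) (eta0 : 0 < eta).
Hypothesis model : regression_model b f sigma X eps.
Hypothesis fF : forall x, f x <= F.
Let db := derive1 b.
Hypotheses (sb : sqi mu b) (sdb : sqi mu db).
Hypothesis HD : forall N, \sum_(j < N) j.+1%:R `^ s * hermite_coef b j ^+ 2 <= D.
Hypothesis M4 : forall i, itg P (fun w => db (X i w) ^+ 4) /\
  \int[P]_w (db (X i w) ^+ 4) <= M.
Hypothesis Hst : stable n K (c_frak / 2) (Psi f m.+1).

Let hb x : is_derive x (1 : R) b (db x).
Proof.
have h : derivable b x 1 by case: model => h *; exact: h.
by apply: (DeriveDef h); rewrite /db derive1E.
Qed.

Let cdb : continuous db. Proof. exact: b_derive_continuous model. Qed.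

Let HDq q N : \sum_(j < N) j.+1%:R `^ s * ((q <= j.+1)%:R * hermite_coef b j) ^+ 2 <= D.
Proof.
apply: le_trans (HD N); apply: ler_sum => j _; rewrite ler_wpM2l ?powR_ge0//.
by case: leqP => _; rewrite ?mul1r// mul0r expr0n sqr_ge0.
Qed.

Let D0 : 0 <= D. Proof. by have := HD 0; rewrite big_ord0. Qed.

Let a := hermite_coef b.

Definition inv_norm : R := Order.max (opnorm (invmx (Psi f m.+1))) 1.
(** What the truncation alone guarantees about the Gram matrix. It degrades like log n / n up to the
    factor sqrt m, so it serves only off the good event. *)
Definition crude_coercivity : R := K * Num.sqrt m.+1%:R / (c_frak * (n%:R / ln n%:R)).
Let L := K * Num.sqrt m.+1%:R.

(** Here 2 (m + 1) bounds the squared norm of [Delta], and 3 D bounds the squared supremum of the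
    remainder: D for the function plus 2 D for its derivative. *)
Definition risk_rate : R := risk_ub m.+1 n (2 * m.+1%:R) L inv_norm F sigma crude_coercivity
  (3 * D) (2 * (m%:R `^ (1 - s) * D)) (m%:R `^ (- s) * D) M eta.

Let B1 : 1 <= inv_norm. Proof. by rewrite le_max lexx orbT. Qed.
Let B0 : 0 < inv_norm. Proof. exact: lt_le_trans B1. Qed.
Let L0 : 0 < L. Proof. by rewrite mulr_gt0// sqrtr_gt0 ltr0n. Qed.

Let HB : coercive inv_norm^-1 (Psi f m.+1).
Proof.
have [intf _] := density_int (f_measurable model) (f_ge0 model) (X_density model (Ordinal n0)).
have [uA _] := (stableE _ _ _ K0 (ltn0Sn m)).1 Hst.
apply: opnorm_coercive => //; first exact: Psi_sym.
  by move=> u; apply: qf_Psi_ge0 => //; exact: f_ge0 model.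
by rewrite le_max lexx.
Qed.

Let lam0 : 0 < crude_coercivity.
Proof.
have [_ H] := (stableE _ _ _ K0 (ltn0Sn m)).1 Hst.
rewrite divr_gt0//; have : 0 < c_frak / 2 * (n%:R / ln n%:R) :> R.
  by apply: lt_le_trans H; rewrite mulr_gt0.
lra.
Qed.

Let rem_pow q : (m <= q)%N -> forall t : R, 0 <= t -> q%:R `^ (- t) * D <= m%:R `^ (- t) * D.
Proof.
move=> mq t t0; rewrite ler_wpM2r// !powRN lef_pV2 ?posrE ?powR_gt0 ?ltr0n ?(leq_trans m0)//.
by apply: ge0_ler_powR; rewrite ?nnegrE ?ler_nat.
Qed.

Let rem_sup q : (m <= q)%N -> forall x, hrem b q x ^+ 2 <= 3 * D.
Proof.
move=> mq x; have q0 : (0 < q)%N := leq_trans m0 mq.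
apply: le_trans (hrem_sup hb cdb sb sdb s1 q0 (HDq q) x) _.
have le1 (t : R) : 0 <= t -> q%:R `^ (- t) * D <= D.
  move=> t0; rewrite -[leRHS]mul1r ler_wpM2r// powRN invf_le1 ?powR_gt0 ?ltr0n//.
  have p1 : 1 `^ t = 1 :> R by rewrite powR1.
  rewrite -[leLHS]p1; apply: ge0_ler_powR; rewrite ?nnegrE ?ler1n//.
have h1 := le1 s (le_trans ler01 s1).
have h2 := le1 (s - 1); rewrite opprB in h2.
by have := h2 _; rewrite subr_ge0 => /(_ s1); lra.
Qed.

Let theta q : 'cV[R]_q := \col_j a j.

Let trunc_hrem q : trunc_err b (theta q) = hrem b q.
Proof.
apply/funext => t; rewrite /trunc_err /hrem; congr (_ - _).
by apply: eq_bigr => j _; rewrite mxE mulrC.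
Qed.

Lemma risk_le_rate p q (W : 'M[R]_(p, q)) (est : ('I_n -> R) -> ('I_n -> R) -> R -> R) :
  (p <= m.+1)%N -> (m <= q <= m.+1)%N ->
  (forall w : 'cV[R]_q, nsq (W *m w) <= 2 * m.+1%:R * nsq w) ->
  sqi mu (approx_err W b (theta q)) ->
  \int[mu]_x (approx_err W b (theta q) x ^+ 2) <= 2 * (m%:R `^ (1 - s) * D) ->
  (forall x y i, Lambda x K m.+1 -> est x y (x i) = (fit_op x W *m Y_vec y) i ord0) ->
  (forall x y t, ~ Lambda x K m.+1 -> est x y t = 0) ->
  (risk b X eps est <= risk_rate%:E)%E.
Proof.
move=> pm /andP[mq qm] HW sbeta Ibeta Hest Hest0; have q0 := leq_trans m0 mq.
have [intf f1] := density_int (f_measurable model) (f_ge0 model) (X_density model (Ordinal n0)).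
have [S [HS Sa]] := normalizer_exists (HK m.+1) B0 HB.
have sr : sqi mu (trunc_err b (theta q)) by rewrite trunc_hrem; exact: sqi_hrem.
have Ir : \int[mu]_x (trunc_err b (theta q) x ^+ 2) <= m%:R `^ (- s) * D.
  rewrite trunc_hrem; apply: le_trans (int_hrem hb sb s1 q0 (HDq q)) _.
  by apply: rem_pow => //; exact: le_trans s1.
have rsup x : trunc_err b (theta q) x ^+ 2 <= 3 * D by rewrite trunc_hrem rem_sup.
have c0 : 0 <= 2 * m.+1%:R :> R by rewrite mulr_ge0.
have Hgood (x : 'I_n -> R) : coercive (2 * inv_norm)^-1 (Psi_hat x m.+1) -> Lambda x K m.+1.
  by move=> H; exact: (coercive_stable K0 (ltn0Sn m) Hst H).
have Hlam (x : 'I_n -> R) : Lambda x K m.+1 -> coercive crude_coercivity (Psi_hat x m.+1).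
  by move=> H; exact: (stable_coercive K0 (ltn0Sn m) n0 H).
exact: (risk_le n0 (ltn0Sn m) pm qm c0 HW (ltW L0) (HK _) (f_measurable model)
  (f_ge0 model) fF intf f1 B0 HB lam0 sbeta Ibeta sr Ir rsup Hgood Hlam Hest Hest0 HS Sa
  (X_independent model) (X_density model) (eps_independent model)
  (X_eps_independent model) (eps_centered model) (eps_variance model) eta0 M4).
Qed.

Lemma risk1_le : (risk b X eps (fun x y => b_tilde1 x y K m) <= risk_rate%:E)%E.
Proof.
(* Applying the transpose of [Delta] to coefficients differentiates the expansion, so the target of
   the first estimator is the derivative of the projection of b. *)
have E : approx_err (Delta m)^T b (theta m) = fun t => (-1) * dhrem b db m t.
  apply/funext => t; rewrite /approx_err mulN1r opprB; congr (_ - _).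
  transitivity (\sum_(k < m.+1) \sum_(j < m) a j * (Delta m j k * hermite k t)).
    apply: eq_bigr => k _; rewrite mxE mulr_sumr; apply: eq_bigr => j _.
    by rewrite [(Delta m)^T _ _]mxE [theta m _ _]mxE; ring.
  rewrite exchange_big; apply: eq_bigr => j _ /=.
  rewrite -mulr_sumr (Delta_sum (fun k => hermite k t)) /dhermite.
  rewrite inordK; last by rewrite (leq_ltn_trans (leq_pred j))// ltnW// ltnS.
  by rewrite inordK// ltnS.
have sd := sqi_dhrem b sdb m.
apply: (@risk_le_rate m.+1 m (Delta m)^T) => //.
- by rewrite leqnn leqnSn.
- exact: nsq_Delta_tr.
- by rewrite E; exact: sqiZ.
- rewrite E; apply: le_trans (int_dhrem hb cdb sb sdb s1 m0 (HDq m)).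
  by apply: Rint_le; [exact: (sqiZ _ sd).2|exact: sd.2|move=> t; rewrite mulN1r sqrrN].
- by move=> x y i lx; rewrite /b_tilde1 asboolT// b_hat1_fit.
- by move=> x y t lx; rewrite /b_tilde1 asboolF.
Qed.

Lemma risk2_le : (risk b X eps (fun x y => b_tilde2 x y K m) <= risk_rate%:E)%E.
Proof.
(* Integration by parts turns - [Delta] applied to the coefficients of b into the first m
   coefficients of b'; this is why b must be estimated in dimension m + 1. *)
have E : approx_err (- Delta m) b (theta m.+1) =
    fun t => (-1) * (db t - hsum m (hermite_coef db) t).
  apply/funext => t; rewrite /approx_err mulN1r opprB; congr (_ - _).
  apply: eq_bigr => j _; rewrite mulrC; congr (_ * _).
  rewrite mulNmx [LHS]mxE mxE (hermite_coef_derive j hb cdb sb sdb).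
  rewrite (eq_bigr (fun k : 'I_m.+1 => Delta m j k * a k)); last by move=> k _; rewrite [theta _ _ _]mxE.
  rewrite (Delta_sum (fun k => a k)).
  rewrite inordK; last by rewrite (leq_ltn_trans (leq_pred j))// ltnW// ltnS.
  by rewrite inordK ?ltnS// opprB.
have sd : sqi mu (fun t => db t - hsum m (hermite_coef db) t).
  by apply: sqiB => //; exact: sqi_hsum.
apply: (@risk_le_rate m m.+1 (- Delta m)) => //.
- by rewrite leqnn leqnSn.
- by move=> w; rewrite mulNmx nsqN; exact: nsq_Delta.
- by rewrite E; exact: sqiZ.
- rewrite E; apply: le_trans (int_proj_derive hb cdb sb sdb s1 m0 (HDq m)).
  by apply: Rint_le; [exact: (sqiZ _ sd).2|exact: sd.2|move=> t; rewrite mulN1r sqrrN].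
- by move=> x y i lx; rewrite /b_tilde2 asboolT// b_hat2_fit.
- by move=> x y t lx; rewrite /b_tilde2 asboolF.
Qed.

End EstimatorRisk.

(** * Rate of convergence *)

(** A single term of the exponential series. It converts the exponential deviation bound into any
    prescribed negative power of m. *)
Lemma expRN_le (R : realType) (t : R) (k : nat) : 0 < t -> expR (- t) <= k`!%:R / t ^+ k.
Proof.
move=> t0; have k0 : 0 < k`!%:R :> R by rewrite ltr0n fact_gt0.
rewrite expRN -invf_div lef_pV2 ?posrE ?expR_gt0 ?divr_gt0 ?exprn_gt0//.
case: k k0 => [|k] k0; first by rewrite expr0 fact0 divr1; have := expR_ge1Dx t; lra.
by have := expR_ge1Dxn k (ltW t0); lra.
Qed.

Section Rate.
Context {R : realType}.
Variables (K g Cb cy ay k0 M s D F v : R) (k : nat).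
Hypotheses (K0 : 0 < K) (g0 : 0 <= g) (Cb0 : 0 < Cb) (cy0 : 0 < cy) (ay0 : 0 < ay).
Hypotheses (kp0 : 0 <= k0) (M0 : 0 <= M) (gs : 1 + g < s) (D0 : 0 <= D) (F0 : 0 <= F) (v0 : 0 <= v).
Variables (del p : R).
Hypotheses (delE : del = s - 1 - g) (pE : p = s + 1 / 2).
(** How much decay is required: 2 is consumed by N^2, 1 + p by the crude factor N L / lam2, and the
    remaining 2 del covers both the rate and a division by eta = x^(-del). *)
Hypothesis kdel : 3 + p + 2 * del <= k%:R * del.

Variables C kap E : R.
Hypotheses (CE : C = Cb * 2 `^ g) (kapE : kap = (128 * K * C * cy)^-1).
Hypothesis EE : E = 8 * (k`!%:R / kap ^+ k).

Definition rate_const : R :=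
  6 * F * D + 36 * F ^+ 2 * D * C + 48 * v * cy * K * C
  + 16 * k0 * ay * (3 * D + v) * E + (M / 2 + E / 2).

Let C0 : 0 < C. Proof. by rewrite CE mulr_gt0// powR_gt0. Qed.
Let kap0 : 0 < kap. Proof. by rewrite kapE invr_gt0 !mulr_gt0. Qed.
Let E0 : 0 < E. Proof. by rewrite EE mulr_gt0// divr_gt0 ?exprn_gt0// ltr0n fact_gt0. Qed.
Let del0 : 0 < del. Proof. by rewrite delE; move: gs; lra. Qed.

Lemma rate_const_ge0 : 0 <= rate_const.
Proof.
have h := (ltW C0, ltW E0, ltW K0, ltW cy0, ltW ay0).
apply: addr_ge0; first (apply: addr_ge0; first (apply: addr_ge0; first apply: addr_ge0)).
- by rewrite !mulr_ge0.
- by rewrite !mulr_ge0 ?h.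
- by rewrite !mulr_ge0 ?h.
- by rewrite mulr_ge0 ?h// mulr_ge0 ?addr_ge0 ?mulr_ge0 ?h.
- by rewrite addr_ge0// divr_ge0 ?h.
Qed.

Variables (N n : nat) (L B sigma lam2 x : R).
Hypotheses (x1 : 1 <= x) (N0 : (0 < N)%N) (n0 : (0 < n)%N) (Nx : N%:R <= 2 * x).
Hypotheses (LE : L = K * Num.sqrt N%:R) (B0 : 0 < B) (BE : B <= Cb * N%:R `^ g).
Hypotheses (yi : n%:R^-1 <= cy * x `^ (- p)) (yu : n%:R <= ay * x `^ p).
Hypotheses (lam0 : 0 < lam2) (Llam : L / lam2 <= k0 * n%:R) (sv : sigma ^+ 2 = v).

Let X (a : R) : R := x `^ a.
Let x0 : 0 < x. Proof. exact: lt_le_trans x1. Qed.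
Let XD a b : X a * X b = X (a + b).
Proof. by rewrite /X powRD//; apply/implyP => _; rewrite gt_eqF. Qed.
Let Xgt0 a : 0 < X a. Proof. exact: powR_gt0. Qed.
Let Xge0 a : 0 <= X a. Proof. exact: ltW. Qed.
Let Xle a b : a <= b -> X a <= X b. Proof. exact: ler_powR. Qed.
Let X1 : X 1 = x. Proof. by rewrite /X powRr1// ltW. Qed.
Let Nr0 : 0 < N%:R :> R. Proof. by rewrite ltr0n. Qed.
Let nr0 : 0 < n%:R :> R. Proof. by rewrite ltr0n. Qed.
Let L0 : 0 < L. Proof. by rewrite LE mulr_gt0// sqrtr_gt0. Qed.

Let Lle : L <= 2 * K * X (1 / 2).
Proof.
rewrite LE [2 * K]mulrC -mulrA ler_wpM2l ?(ltW K0)// /X mul1r powR12_sqrt ?(ltW x0)//.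
have -> : 2 = Num.sqrt (2 ^+ 2) :> R by rewrite sqrtr_sqr ger0_norm.
rewrite -sqrtrM ?sqr_ge0// ler_sqrt; last by rewrite mulr_ge0 ?sqr_ge0// ltW.
by apply: le_trans Nx _; have := x0; lra.
Qed.

Let NBle : N%:R * B <= 2 * C * X (1 + g).
Proof.
have h : N%:R `^ g <= 2 `^ g * X g.
  rewrite -powRM ?(ltW x0)//; apply: ge0_ler_powR; rewrite ?nnegrE// ?mulr_ge0// ltW//.
apply: (@le_trans _ _ ((2 * x) * (Cb * (2 `^ g * X g)))).
  apply: ler_pM => //; rewrite ?(ltW B0)//; apply: le_trans BE _.
  by rewrite ler_wpM2l ?(ltW Cb0).
by rewrite -XD X1 CE le_eqVlt; apply/orP; left; apply/eqP; ring.
Qed.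

Let pG : R := 2 * N%:R ^+ 2 * expR (- (n%:R / (32 * (L * B) * N%:R))).

(** L, N B and n have orders x^(1/2), x^(1+g) and x^p, and p - 1/2 - (1 + g) = del. The constant 128
    in [kap] is 32 times the factors 2 of the bounds on L and on N B. *)
Let expo : kap * X del <= n%:R / (32 * (L * B) * N%:R).
Proof.
have d0 : 0 < 32 * (L * B) * N%:R by rewrite !mulr_gt0.
have nlow : cy^-1 * X p <= n%:R.
  have := yi; rewrite -[n%:R]invrK -[X p]invrK -/(X _) => h.
  rewrite -[cy^-1 * _]invrK lef_pV2 ?posrE ?invr_gt0 ?mulr_gt0 ?invr_gt0//.
  by rewrite invfM !invrK /X -powRN.
rewrite ler_pdivlMr//; apply: le_trans nlow.
apply: (@le_trans _ _ (kap * X del * (32 * (2 * K * X (1 / 2)) * (2 * C * X (1 + g))))).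
  rewrite ler_wpM2l ?mulr_ge0 ?(ltW kap0)//.
  have -> : 32 * (L * B) * N%:R = 32 * L * (N%:R * B) by ring.
  by apply: ler_pM => //; rewrite ?mulr_ge0 ?(ltW L0) ?(ltW B0)// ler_wpM2l.
have -> : X p = X del * X (1 / 2) * X (1 + g) by rewrite !XD; congr X; rewrite pE delE; field.
rewrite le_eqVlt; apply/orP; left; apply/eqP.
by rewrite kapE; field; rewrite !gt_eqF.
Qed.

Let pGle : pG <= E * X (- (1 + p + 2 * del)).
Proof.
have e1 : expR (- (n%:R / (32 * (L * B) * N%:R))) <= k`!%:R / kap ^+ k * X (- (3 + p + 2 * del)).
  apply: (@le_trans _ _ (expR (- (kap * X del)))); first by rewrite ler_expR lerN2.
  apply: le_trans (expRN_le k _) _; first by rewrite mulr_gt0.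
  rewrite exprMn invfM mulrA; apply: ler_wpM2l; last first.
    by rewrite -/(X _) /X -powR_mulrn ?powR_ge0// -powRrM -powRN; apply: Xle; rewrite lerN2 [del * k%:R]mulrC.
  by rewrite divr_ge0// exprn_ge0// ltW.
have e2 : N%:R ^+ 2 <= 4 * X 2.
  have -> : X 2 = x ^+ 2 by rewrite /X powR_mulrn// ltW.
  by have := ltW Nr0; have := Nx; nra.
rewrite /pG; apply: (@le_trans _ _ (2 * (4 * X 2) * (k`!%:R / kap ^+ k * X (- (3 + p + 2 * del))))).
  by apply: ler_pM; rewrite ?mulr_ge0 ?sqr_ge0 ?expR_ge0// ler_wpM2l.
have -> : X (- (1 + p + 2 * del)) = X 2 * X (- (3 + p + 2 * del)) by rewrite XD; congr X; ring.
by rewrite le_eqVlt EE; apply/orP; left; apply/eqP; ring.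
Qed.

Let pG0 : 0 <= pG. Proof. by rewrite mulr_ge0 ?expR_ge0// mulr_ge0 ?sqr_ge0. Qed.

(** The choice eta = x^(-del) puts the moment term eta M / 2 at the rate, while the factor 1 / (2
    eta) is absorbed by the decay of [pG]. *)
Lemma risk_ub_le : risk_ub N n (2 * N%:R) L B F sigma lam2
   (3 * D) (2 * (x `^ (1 - s) * D)) (x `^ (- s) * D) M (x `^ (- del)) <= rate_const * x `^ (- del).
Proof.
rewrite /risk_ub -/pG sv -!/(X _).
have t1 : 3 * (F * (2 * (X (1 - s) * D))) <= 6 * F * D * X (- del).
  have -> : 3 * (F * (2 * (X (1 - s) * D))) = 6 * F * D * X (1 - s) by ring.
  by rewrite ler_wpM2l ?mulr_ge0//; apply: Xle; rewrite delE; have := g0; lra.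
have t2 : 3 * (3 / 2 * F * (2 * N%:R * (2 * B))) * (F * (X (- s) * D)) <=
    36 * F ^+ 2 * D * C * X (- del).
  have -> : X (- del) = X (1 + g) * X (- s) by rewrite XD; congr X; rewrite delE; ring.
  have -> : 3 * (3 / 2 * F * (2 * N%:R * (2 * B))) * (F * (X (- s) * D)) =
     18 * F ^+ 2 * D * X (- s) * (N%:R * B) by field.
  apply: (@le_trans _ _ (18 * F ^+ 2 * D * X (- s) * (2 * C * X (1 + g)))).
    by rewrite ler_wpM2l// !mulr_ge0// sqr_ge0.
  by rewrite le_eqVlt; apply/orP; left; apply/eqP; ring.
have t3 : 3 * (v * (n%:R^-1 * (2 * N%:R * L / (2 * B)^-1))) <= 48 * v * cy * K * C * X (- del).
  have -> : X (- del) = X (- p) * X (1 / 2) * X (1 + g).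
    by rewrite !XD; congr X; rewrite pE delE; field.
  have -> : 3 * (v * (n%:R^-1 * (2 * N%:R * L / (2 * B)^-1))) =
     12 * v * (n%:R^-1 * L * (N%:R * B)) by rewrite invrK; ring.
  apply: (@le_trans _ _ (12 * v * (cy * X (- p) * (2 * K * X (1 / 2)) * (2 * C * X (1 + g))))).
    rewrite ler_wpM2l ?mulr_ge0//; apply: ler_pM => //.
    - by rewrite mulr_ge0 ?invr_ge0 ?(ltW nr0) ?(ltW L0).
    - by rewrite mulr_ge0 ?(ltW B0).
    - by apply: ler_pM => //; rewrite ?invr_ge0 ?(ltW L0).
  by rewrite le_eqVlt; apply/orP; left; apply/eqP; ring.
have t4 : 4 * (L * (2 * N%:R / lam2)) * (3 * D * pG + pG * v) <=
    16 * k0 * ay * (3 * D + v) * E * X (- del).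
  have -> : 4 * (L * (2 * N%:R / lam2)) * (3 * D * pG + pG * v) =
     8 * (3 * D + v) * (N%:R * (L / lam2) * pG) by ring.
  apply: (@le_trans _ _ (8 * (3 * D + v) * (2 * X 1 * (k0 * (ay * X p)) * (E * X (- (1 + p + 2 * del)))))).
    rewrite ler_wpM2l ?mulr_ge0 ?addr_ge0 ?mulr_ge0//; apply: ler_pM => //.
      by rewrite !mulr_ge0 ?invr_ge0 ?(ltW L0) ?(ltW lam0).
    apply: ler_pM => //; first by rewrite divr_ge0 ?(ltW L0) ?(ltW lam0).
      by rewrite X1.
    by apply: le_trans Llam _; rewrite ler_wpM2l.
  have -> : 8 * (3 * D + v) * (2 * X 1 * (k0 * (ay * X p)) * (E * X (- (1 + p + 2 * del)))) =
    16 * k0 * ay * (3 * D + v) * E * (X 1 * X p * X (- (1 + p + 2 * del))) by ring.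
  apply: ler_wpM2l; last by rewrite !XD; apply: Xle; have := del0; lra.
  by rewrite !mulr_ge0 ?addr_ge0 ?mulr_ge0 ?(ltW ay0) ?(ltW E0).
have t5 : X (- del) / 2 * M + (2 * X (- del))^-1 * pG <= (M / 2 + E / 2) * X (- del).
  have -> : X (- del) / 2 * M = M / 2 * X (- del) by field.
  rewrite [leRHS]mulrDl lerD2l invfM -powRN opprK -/(X _).
  apply: (@le_trans _ _ (2^-1 * X del * (E * X (- (1 + p + 2 * del))))).
    by rewrite ler_wpM2l// mulr_ge0.
  have -> : 2^-1 * X del * (E * X (- (1 + p + 2 * del))) =
    E / 2 * (X del * X (- (1 + p + 2 * del))) by ring.
  rewrite ler_wpM2l ?divr_ge0 ?(ltW E0)// XD; apply: Xle.
  by have := del0; have := gs; have := g0; have := pE; lra.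
rewrite /rate_const; move: t1 t2 t3 t4 t5; rewrite -!/(X _); lra.
Qed.

End Rate.

(** * Consequences of the assumptions on f and b: the sign of gamma and the coefficient a_0 *)

Section Regularity.
Context {R : realType}.
Notation mu := (@lebesgue_measure R).

Lemma Lfun_sqi (g : R -> R) : g \in Lfun mu 2%:E -> sqi mu g.
Proof.
move=> h; split; last by have := Lfun2_integrable_sqr h.
by have := sub_Lfun_mfun h; rewrite inE.
Qed.

Lemma sobolev_partial (s D : R) (b : R -> R) N : sobolev_hermite s D b ->
  \sum_(j < N) j%:R `^ s * hermite_coef b j ^+ 2 <= D.
Proof.
move=> [_ H]; rewrite -lee_fin; apply: le_trans H.
rewrite -sumEFin -(big_mkord xpredT (fun j => (j%:R `^ s * hermite_coef b j ^+ 2)%:E)).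
by apply: nneseries_lim_ge => k _ _; rewrite lee_fin mulr_ge0 ?powR_ge0 ?sqr_ge0.
Qed.

Variable f : R -> R.
Hypotheses (f0 : forall x, 0 <= f x) (intf : itg mu f) (f1 : \int[mu]_x f x = 1).
Variables (g Cb : R).
Hypotheses (Cb0 : 0 < Cb).
Hypothesis HB : forall k : nat, (0 < k)%N -> coercive (Cb * k%:R `^ g)^-1 (Psi f k).

(* N = tr (Psi_N^-1 Psi_N) is at most K sqrt N ||Psi_N^-1||. *)
Lemma growth_exponent_ge0 (K : R) : 0 < K ->
  (forall (m : nat) (x : R), \sum_(j < m) hermite j x ^+ 2 <= K * Num.sqrt m%:R) -> 0 <= g.
Proof.
move=> K0 HK; rewrite leNgt; apply/negP => gneg.
pose N := (Num.bound ((K * Cb) ^+ 2)).+1.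
have N0 : (0 < N)%N by [].
have Nr0 : 0 < N%:R :> R by rewrite ltr0n.
have B0 : 0 < Cb * N%:R `^ g by rewrite mulr_gt0// powR_gt0.
have [S [HS Sa]] := normalizer_exists (HK N) B0 (HB N0).
have := dim_le f0 intf f1 HS Sa.
have Ng : N%:R `^ g <= 1.
  rewrite -[leRHS](powRr0 (N%:R : R)).
  by apply: ler_powR; [rewrite ler1n|exact: ltW].
have q0 : 0 < Num.sqrt N%:R :> R by rewrite sqrtr_gt0.
have qq : Num.sqrt N%:R * Num.sqrt N%:R = N%:R :> R by rewrite -expr2 sqr_sqrtr// ltW.
move=> H.
have h1 : Num.sqrt N%:R <= K * Cb.
  rewrite -(ler_pM2r q0) qq; apply: le_trans H _.
  have -> : K * Num.sqrt N%:R * (Cb * N%:R `^ g) = K * Cb * Num.sqrt N%:R * N%:R `^ g by ring.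
  by rewrite ler_piMr// !mulr_ge0 ?ltW.
have h2 : N%:R <= (K * Cb) ^+ 2.
  by rewrite -qq -expr2 ler_pXn2r// ?nnegrE ?(ltW q0)// mulr_ge0 ?ltW.
have := archi_boundP (sqr_ge0 (K * Cb)); rewrite ltNge => /negP; apply.
by apply: le_trans h2; rewrite ler_nat.
Qed.

Context d (T : measurableType d) (P : probability T R) (X : {RV P >-> R}).
Hypothesis mf : measurable_fun setT f.
Hypothesis Xf : forall A : set R, measurable A ->
  distribution P X A = (\int[mu]_(x in A) (f x)%:E)%E.
Variables (b db : R -> R) (s D F M : R).
Hypothesis fF : forall x, f x <= F.
Hypotheses (hb : forall x, is_derive x (1 : R) b (db x)) (cdb : continuous db).
Hypotheses (sb : sqi mu b) (sdb : sqi mu db) (s1 : 1 <= s).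
Hypothesis M4 : itg P (fun w => db (X w) ^+ 4) /\ \int[P]_w (db (X w) ^+ 4) <= M.
Hypothesis HD : forall N, \sum_(j < N) j%:R `^ s * hermite_coef b j ^+ 2 <= D.

Let a := hermite_coef b.
Let b1 := hrem b 1.
Let db1 := dhrem b db 1.

Let coef_b1 k : hermite_coef b1 k = (0 < k)%N%:R * a k.
Proof. exact: hermite_coef_hrem. Qed.

(** For j >= 1 one has j + 1 <= 2 j, which costs 2^s; the term j = 0 is left out. *)
Let shift_sum N : \sum_(j < N) j.+1%:R `^ s * ((0 < j)%N%:R * a j) ^+ 2 <= 2 `^ s * D.
Proof.
apply: (@le_trans _ _ (2 `^ s * \sum_(j < N) j%:R `^ s * a j ^+ 2)); last first.
  by rewrite ler_wpM2l ?powR_ge0//; exact: HD.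
rewrite mulr_sumr; apply: ler_sum => j _.
case: posnP => [_|j0].
  by rewrite mul0r expr0n mulr0 mulr_ge0 ?powR_ge0// mulr_ge0 ?powR_ge0// sqr_ge0.
rewrite mul1r mulrA ler_wpM2r ?sqr_ge0// -powRM//.
apply: ge0_ler_powR; rewrite ?nnegrE ?mulr_ge0//; first by apply: le_trans s1.
by rewrite -natrM ler_nat; lia.
Qed.

Let int_db1 : \int[mu]_x (db1 x ^+ 2) <= 2 * (2 `^ s * D).
Proof.
have hb1 x : is_derive x (1 : R) b1 (db1 x) by exact: is_derive_hrem.
have cdb1 : continuous db1 by exact: continuous_dhrem.
have sb1 : sqi mu b1 by exact: sqi_hrem.
have sdb1 : sqi mu db1 by exact: sqi_dhrem.
have H N : \sum_(j < N) j.+1%:R `^ s * ((1 <= j.+1)%N%:R * hermite_coef b1 j) ^+ 2 <= 2 `^ s * D.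
  apply: le_trans (shift_sum N); apply: ler_sum => j _.
  by rewrite coef_b1 mul1r.
have := int_dhrem hb1 cdb1 sb1 sdb1 s1 (ltn0Sn 0) H.
rewrite powR1 mul1r; apply: le_trans.
rewrite le_eqVlt; apply/orP; left; apply/eqP; apply: eq_Rintegral => x _.
by rewrite /dhrem /dhsum big_ord1 coef_b1 !mul0r subr0.
Qed.

Definition coef0_bound : R := 2 * (Cb * 2 `^ g) * (2 * (1 + M) + 2 * (F * (2 * (2 `^ s * D)))).

(* The weight 0^s of the ball vanishes, hence does not control the coefficient a_0:
   it is recovered from the moment of b'(X), since b' contains the term a_0 h_0'. *)
Lemma hermite_coef0_le : a 0 ^+ 2 <= coef0_bound.
Proof.
have B0 : 0 < Cb * 2 `^ g by rewrite mulr_gt0// powR_gt0.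
have F0 : 0 <= F := le_trans (f0 0) (fF 0).
have sdb1 : sqi mu db1 by exact: sqi_dhrem.
have [C HC] := @hermite_bound R 1.
have mh2 : measurable_fun setT (fun x : R => hermite 1 x ^+ 2).
  by apply: measurable_funX; exact: meas_hermite.
have bh2 x : `|hermite 1 x ^+ 2| <= C ^+ 2.
  by rewrite normrX ler_pXn2r ?nnegrE// (le_trans _ (HC x)).
have [_ ih Eh] := law_bnd mf f0 Xf mh2 bh2.
have low : (Cb * 2 `^ g)^-1 <= \int[P]_w (hermite 1 (X w) ^+ 2).
  (* The Gram matrix of dimension 2, tested on its second basis vector, bounds the second moment of
     h_1(X) from below. *)
  rewrite Eh; have := HB (ltn0Sn 1) (delta_mx (inord 1) ord0).
  rewrite qf_PsiE//.
  have -> : nsq (delta_mx (inord 1) ord0 : 'cV[R]_2) = 1.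
    rewrite /nsq (bigD1 (inord 1))//= mxE !eqxx expr1n big1 ?addr0// => i /negbTE i1.
    by rewrite mxE i1 expr0n.
  rewrite mulr1; congr (_ <= _); apply: eq_Rintegral => x _; congr (_ ^+ 2 * _).
  rewrite /dotv (bigD1 (inord 1))//= !mxE !eqxx mul1r inordK// big1 ?addr0// => i /negbTE i1.
  by rewrite mxE i1 mul0r.
have [id2 _] := law_sqi mf f0 Xf fF sdb.
have [id1 ed1] := law_sqi mf f0 Xf fF sdb1.
have [i4 e4] := M4.
have ione : itg P (fun=> 1) by exact: finite_measure_integrable_cst.
have ed2 : \int[P]_w (db (X w) ^+ 2) <= 1 + M.
  apply: (@le_trans _ _ (\int[P]_w (1 + db (X w) ^+ 4))).
    apply: Rint_le => //; first exact: itgD.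
    by move=> w; rewrite (exprM _ 2 2); have := sqr_ge0 (db (X w) ^+ 2 - 2^-1); lra.
  by rewrite RintegralD// Rint_cst lerD2l.
(* Since h_0' = - h_1 / sqrt 2, the difference between b' and [db1] has square a_0^2 h_1^2 / 2. *)
have key : \int[P]_w (a 0 ^+ 2 / 2 * hermite 1 (X w) ^+ 2) <=
    \int[P]_w (2 * db (X w) ^+ 2 + 2 * db1 (X w) ^+ 2).
  apply: Rint_le; [exact: itgZ|by apply: itgD; exact: itgZ|] => w.
  have -> : a 0 ^+ 2 / 2 * hermite 1 (X w) ^+ 2 = (db (X w) - db1 (X w)) ^+ 2.
    rewrite /db1 /dhrem /dhsum big_ord1 /dhermite /= hq0 mul0r sub0r.
    have -> : db (X w) - (db (X w) - hermite_coef b 0 * - (hq 1 * hermite 1 (X w))) =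
       - (hermite_coef b 0 * hq 1 * hermite 1 (X w)) by ring.
    by rewrite sqrrN !exprMn hq2 mul1r.
  by have := sqr_ge0 (db (X w) + db1 (X w)); lra.
rewrite (RintD2 _ _ id2 id1) (RintegralZl _ _ ih)// in key.
have h1 : a 0 ^+ 2 / 2 * (Cb * 2 `^ g)^-1 <= 2 * (1 + M) + 2 * (F * (2 * (2 `^ s * D))).
  apply: le_trans (_ : _ <= a 0 ^+ 2 / 2 * \int[P]_w (hermite 1 (X w) ^+ 2)) _.
    by rewrite ler_wpM2l// divr_ge0 ?sqr_ge0.
  apply: le_trans key _; apply: lerD; first by rewrite ler_wpM2l.
  rewrite ler_wpM2l//; apply: le_trans ed1 _; rewrite ler_wpM2l//; exact: int_db1.
rewrite /coef0_bound; move: h1; rewrite ler_pdivrMr//; lra.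
Qed.

Lemma full_weighted_sum N :
  \sum_(j < N) j.+1%:R `^ s * hermite_coef b j ^+ 2 <= 2 `^ s * D + coef0_bound.
Proof.
have A0 := hermite_coef0_le.
case: N => [|N].
  have := shift_sum 0; rewrite !big_ord0 => h; rewrite addr_ge0//.
  by apply: le_trans A0; exact: sqr_ge0.
rewrite big_ord_recl powR1 mul1r addrC; apply: lerD => //.
have := shift_sum N.+1; rewrite big_ord_recl mul0r expr0n mulr0 add0r; apply: le_trans.
by apply: ler_sum => j _; rewrite mul1r.
Qed.

End Regularity.

(** * Explicit constants and the exponent in n *)

Section FinalConstant.
Context {R : realType}.
Variables (K g Cg c1 c2 M : R).

(** Adding 1 ensures that the growth bound also dominates the maximum with 1 in [inv_norm]. *)
Definition growth_cst : R := `|Cg| + 1.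
(** With p = s + 1/2, the upper bound on m gives 1/n <= [dim_upper] m^(-p), and the lower bound
    gives n <= [dim_lower] m^p. *)
Definition dim_upper (s : R) : R := (`|c2| + 1) `^ (s + 1 / 2).
Definition dim_lower (s : R) : R := c1 `^ (- (s + 1 / 2)).
Definition stab_cst : R := `|c_frak| / ln 2.
Definition weight_cst (D s F : R) : R := 2 `^ s * D + coef0_bound g growth_cst s D F `|M|.
(** An integer k obtained from the Archimedean property so as to satisfy [kdel]. *)
Definition tail_power (s : R) : nat :=
  Num.bound ((3 + (s + 1 / 2) + 2 * (s - 1 - g)) / (s - 1 - g)).
Definition tail_rate (s : R) : R := (128 * K * (growth_cst * 2 `^ g) * dim_upper s)^-1.
Definition tail_cst (s : R) : R := 8 * ((tail_power s)`!%:R / tail_rate s ^+ tail_power s).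
Definition final_rate (D s F v : R) : R :=
  rate_const K (dim_upper s) (dim_lower s) stab_cst `|M| (weight_cst D s F) F v
    (growth_cst * 2 `^ g) (tail_cst s).
(* The absolute value makes the constant positive also outside of the range of the
   parameters which the theorem uses. *)
Definition final_cst (D s F v : R) : R := 1 + `|final_rate D s F v * c1 `^ (- (s - 1 - g))|.

Lemma final_cst_gt0 D s F v : 0 < final_cst D s F v.
Proof. by rewrite /final_cst ltr_wpDr. Qed.

Hypotheses (K0 : 0 < K) (c10 : 0 < c1) (g0 : 0 <= g).
Variables (D s F v sigma : R) (f : R -> R) (n m : nat).
Hypotheses (gs : 1 + g < s) (D0 : 0 <= weight_cst D s F) (F0 : 0 <= F) (sv : sigma ^+ 2 = v).
Hypotheses (n2 : (2 <= n)%N) (Cb : forall k : nat, (0 < k)%N ->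
  opnorm (invmx (Psi f k)) <= growth_cst * k%:R `^ g).
Hypothesis mn : c1 * n%:R `^ (s + 1 / 2)^-1 <= m%:R <= c2 * n%:R `^ (s + 1 / 2)^-1.
Hypothesis Hst : stable n K (c_frak / 2) (Psi f m.+1).

Let nr0 : 0 < n%:R :> R. Proof. by rewrite ltr0n ltnW. Qed.
Let p0 : 0 < s + 1 / 2. Proof. by have := gs; have := g0; lra. Qed.
Let d0 : 0 < s - 1 - g. Proof. by have := gs; lra. Qed.
Let Gc0 : 0 < growth_cst. Proof. by rewrite /growth_cst ltr_wpDl. Qed.
Let Gc1 : 1 <= growth_cst. Proof. by rewrite /growth_cst lerDr. Qed.

Lemma dim_gt0 : (0 < m)%N.
Proof.
have /andP[h _] := mn; rewrite -(@ltr0n R); apply: lt_le_trans h.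
by rewrite mulr_gt0// powR_gt0.
Qed.

Lemma crude_coercivity_gt0 : 0 < @crude_coercivity R n m K.
Proof.
have L0 : 0 < K * Num.sqrt m.+1%:R by rewrite mulr_gt0// sqrtr_gt0 ltr0n.
have [_ H] := (stableE _ _ _ K0 (ltn0Sn m)).1 Hst.
rewrite divr_gt0//; have : 0 < c_frak / 2 * (n%:R / ln n%:R) :> R.
  by apply: lt_le_trans H; rewrite mulr_gt0// lt_max ltr01 orbT.
lra.
Qed.

Lemma risk_rate_le :
  risk_rate f sigma n m K F s (weight_cst D s F) `|M| (m%:R `^ (- (s - 1 - g))) <=
  final_cst D s F v * n%:R `^ (- 2 * (s - 1 - g) / (2 * s + 1)).
Proof.
have m0 := dim_gt0; have x0 : 0 < m%:R :> R by rewrite ltr0n.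
have /andP[lo up] := mn.
have v0 : 0 <= v by rewrite -sv sqr_ge0.
have du0 : 0 < dim_upper s by rewrite powR_gt0// ltr_wpDl.
have dl0 : 0 < dim_lower s by rewrite powR_gt0.
have ln2 : 0 < ln 2 :> R by apply: ln_gt0; rewrite ltr1n.
have sc0 : 0 <= stab_cst by rewrite divr_ge0// ltW.
have kdel : 3 + (s + 1 / 2) + 2 * (s - 1 - g) <= (tail_power s)%:R * (s - 1 - g).
  rewrite -ler_pdivrMr//; apply: ltW; apply: archi_boundP.
  by rewrite divr_ge0 ?(ltW d0)//; have := p0; have := d0; lra.
have pw : (n%:R `^ (s + 1 / 2)^-1) `^ (s + 1 / 2) = n%:R :> R.
  by rewrite -powRrM mulVf ?gt_eqF// powRr1// ltW.
have yi : n%:R^-1 <= dim_upper s * m%:R `^ (- (s + 1 / 2)).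
  rewrite powRN ler_pdivlMr ?powR_gt0// mulrC ler_pdivrMr//.
  have -> : dim_upper s * n%:R = ((`|c2| + 1) * n%:R `^ (s + 1 / 2)^-1) `^ (s + 1 / 2).
    by rewrite powRM ?powR_ge0 ?addr_ge0// pw.
  apply: ge0_ler_powR; rewrite ?nnegrE ?(ltW p0) ?mulr_ge0 ?powR_ge0 ?addr_ge0//.
  apply: le_trans up _; rewrite ler_wpM2r ?powR_ge0//.
  by apply: le_trans (ler_norm _) _; rewrite lerDl.
have yu : n%:R <= dim_lower s * m%:R `^ (s + 1 / 2).
  rewrite /dim_lower powRN mulrC ler_pdivlMr ?powR_gt0// mulrC -{1}pw -powRM ?powR_ge0 ?(ltW c10)//.
  by apply: ge0_ler_powR; rewrite ?nnegrE ?(ltW p0) ?mulr_ge0 ?powR_ge0 ?(ltW c10).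
have Nx : m.+1%:R <= 2 * m%:R :> R by rewrite -natr1 mulr_natl mulr2n lerD2l ler1n.
have x1 : 1 <= m%:R :> R by rewrite ler1n.
have BE : inv_norm f m <= growth_cst * m.+1%:R `^ g.
  rewrite /inv_norm ge_max Cb//=; apply: (le_trans Gc1).
  rewrite ler_peMr ?(ltW Gc0)//.
  by rewrite -[leLHS](powRr0 (m.+1%:R : R)); apply: ler_powR; rewrite ?ler1n.
have B0 : 0 < inv_norm f m by rewrite /inv_norm lt_max ltr01 orbT.
have l0 := crude_coercivity_gt0.
have Llam : K * Num.sqrt m.+1%:R / crude_coercivity n m K <= stab_cst * n%:R.
  have L0 : K * Num.sqrt m.+1%:R != 0 :> R by rewrite mulf_neq0 ?gt_eqF// sqrtr_gt0 ltr0n.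
  rewrite /crude_coercivity invf_div mulrCA divff// mulr1 /stab_cst.
  have lnn : ln 2 <= ln n%:R :> R by rewrite ler_ln ?posrE// ler_nat.
  rewrite -[leRHS]mulrA; apply: (@le_trans _ _ (`|c_frak| * (n%:R / ln n%:R))).
    rewrite ler_wpM2r ?ler_norm// divr_ge0 ?(ltW nr0)//.
    by apply: le_trans lnn; exact: ltW.
  rewrite ler_wpM2l// mulrC ler_wpM2r ?(ltW nr0)// lef_pV2 ?posrE//.
  exact: lt_le_trans lnn.
have H := risk_ub_le (sigma := sigma) `|M| K0 g0 Gc0 du0 dl0 sc0 gs D0 F0 v0
  erefl erefl kdel erefl erefl erefl
  x1 (ltn0Sn m) (ltnW n2) Nx erefl B0 BE yi yu l0 Llam sv.
rewrite /risk_rate; apply: le_trans H _.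
have R0 : 0 <= final_rate D s F v.
  exact: (rate_const_ge0 K0 Gc0 du0 dl0 sc0 (normr_ge0 M) D0 F0 v0 erefl erefl erefl).
have xd : m%:R `^ (- (s - 1 - g)) <=
    c1 `^ (- (s - 1 - g)) * n%:R `^ (- 2 * (s - 1 - g) / (2 * s + 1)).
  have -> : - 2 * (s - 1 - g) / (2 * s + 1) = (s + 1 / 2)^-1 * (- (s - 1 - g)).
    by field; rewrite !gt_eqF//; have := p0; lra.
  rewrite powRrM -powRM ?powR_ge0 ?(ltW c10)// !powRN.
  rewrite lef_pV2 ?posrE ?powR_gt0// ?mulr_gt0 ?powR_gt0//.
  by apply: ge0_ler_powR; rewrite ?nnegrE ?(ltW d0) ?mulr_ge0 ?powR_ge0 ?(ltW c10).
apply: (@le_trans _ _ (final_rate D s F v * (c1 `^ (- (s - 1 - g)) *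
   n%:R `^ (- 2 * (s - 1 - g) / (2 * s + 1))))).
  by rewrite ler_wpM2l.
rewrite mulrA ler_wpM2r ?powR_ge0// /final_cst; apply: le_trans (ler_norm _) _.
by rewrite lerDr.
Qed.

End FinalConstant.

(** The constant is chosen before b, f, sigma, n and the probability space, hence the uniform moment
    bound M. The constants c1 and c2 make precise that m is an integer of the order of
    n^(1/(s+1/2)). *)
Theorem corollary4p3 (R : realType) (K gamma Cg c1 c2 M : R)
  (K_gt0 : 0 < K)
  (K_bound : forall (m : nat) (x : R),
     \sum_(j < m) hermite j x ^+ 2 <= K * Num.sqrt m%:R)
  (c1_gt0 : 0 < c1) :
  exists c : R -> R -> R -> R -> R,
    (forall D s F v : R, 0 < c D s F v) /\
    forall (D s : R) (b f : R -> R) (sigma : R) (n m : nat)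
      (d : measure_display) (T : measurableType d) (P : probability T R)
      (X eps : 'I_n -> {RV P >-> R}),
      (2 <= n)%N ->
      regression_model b f sigma X eps ->
      has_ubound (range f) ->
      derive1 b \in Lfun lebesgue_measure 2%:E ->
      (forall i, 'E_P[(fun w => derive1 b (X i w) ^+ 4)%R] <= M%:E)%E ->
      (forall i, 'E_P[(fun w => response b X eps i w ^+ 4)%R] < +oo)%E ->
      0 < D ->
      sobolev_hermite s D b ->
      (forall k : nat, (0 < k)%N ->
         (opnorm_inv (Psi f k) <= (Cg * k%:R `^ gamma)%:E)%E) ->
      1 + gamma < s ->
      c1 * n%:R `^ (s + 1 / 2)^-1 <= m%:R <= c2 * n%:R `^ (s + 1 / 2)^-1 ->
      stable n K (c_frak / 2) (Psi f m.+1) ->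
      let bound : \bar R :=
        (c D s (sup (range f)) (sigma ^+ 2)
         * n%:R `^ (- 2 * (s - 1 - gamma) / (2 * s + 1)))%:E in
      (risk b X eps (fun x y => b_tilde1 x y K m) <= bound)%E /\
      (risk b X eps (fun x y => b_tilde2 x y K m) <= bound)%E.
Proof.
exists (final_cst K gamma Cg c1 c2 M); split; first by move=> *; exact: final_cst_gt0.
move=> D s b f sigma n m d T P X eps n2 model fub sdbL HM _ D0 sobolev HPsi gs mn Hst.
have n0 : (0 < n)%N := ltnW n2; pose i0 := Ordinal n0.
set F := sup (range f).
have fF x : f x <= F by apply: ub_le_sup => //; exists x.
have f0 := f_ge0 model; have mf := f_measurable model.
have [intf f1] := density_int mf f0 (X_density model i0).
have F0 : 0 <= F := le_trans (f0 0) (fF 0).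
have Gc0 : 0 < growth_cst Cg by rewrite /growth_cst ltr_wpDl.
have HU k : (0 < k)%N -> Psi f k \in unitmx /\
    opnorm (invmx (Psi f k)) <= growth_cst Cg * k%:R `^ gamma.
  move=> k0; have := HPsi k k0; rewrite /opnorm_inv; case: ifPn => // uP.
  rewrite lee_fin => h; split => //; apply: le_trans h _.
  rewrite ler_wpM2r ?powR_ge0//; apply: le_trans (ler_norm _) _.
  by rewrite /growth_cst lerDl.
have Cb k (k0 : (0 < k)%N) := (HU k k0).2.
have HB k : (0 < k)%N -> coercive (growth_cst Cg * k%:R `^ gamma)^-1 (Psi f k).
  move=> k0; have [uP h] := HU k k0; apply: opnorm_coercive => //.
  - exact: Psi_sym.
  - by move=> u; exact: qf_Psi_ge0.
  - by rewrite mulr_gt0// powR_gt0// ltr0n.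
have g0 := growth_exponent_ge0 f0 intf f1 Gc0 HB K_gt0 K_bound.
have s1 : 1 <= s by lra.
have sb := Lfun_sqi sobolev.1; have sdb := Lfun_sqi sdbL.
have hb x : is_derive x (1 : R) b (derive1 b x).
  have h : derivable b x 1 by case: model => h *; exact: h.
  by apply: (DeriveDef h); rewrite derive1E.
have cdb : continuous (derive1 b) := b_derive_continuous model.
have M4 i : itg P (fun w => derive1 b (X i w) ^+ 4) /\
    \int[P]_w (derive1 b (X i w) ^+ 4) <= `|M|.
  apply: itg_le.
  - apply: measurable_funX; apply: (measurableT_comp (meas_cont cdb)).
    exact: measurable_funP.
  - by move=> w; rewrite (exprM _ 2 2) sqr_ge0.
  - have := HM i; rewrite expectation.unlock => /le_trans; apply.
    by rewrite lee_fin ler_norm.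
have HW N : \sum_(j < N) j.+1%:R `^ s * hermite_coef b j ^+ 2 <= weight_cst gamma Cg M D s F.
  apply: (full_weighted_sum f0 intf Gc0 HB mf (X_density model i0) fF hb cdb sb sdb s1 (M4 i0)).
  by move=> N'; exact: sobolev_partial.
have W0 : 0 <= weight_cst gamma Cg M D s F by have := HW 0; rewrite big_ord0.
have m0 := dim_gt0 c1_gt0 n2 mn.
have eta0 : 0 < m%:R `^ (- (s - 1 - gamma)) :> R by rewrite powR_gt0// ltr0n.
have key := risk_rate_le K_gt0 c1_gt0 g0 gs W0 F0 erefl n2 Cb mn Hst.
split.
- apply: le_trans (risk1_le K_gt0 K_bound n0 m0 s1 eta0 model fF sb sdb HW M4 Hst) _.
  by rewrite lee_fin; exact: key.
- apply: le_trans (risk2_le K_gt0 K_bound n0 m0 s1 eta0 model fF sb sdb HW M4 Hst) _.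
  by rewrite lee_fin; exact: key.
Qed.
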